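(* Let $n\ge 2$, let $S=\{z\in\mathbb{C}^n : |z|=1\}$, $D=\{w\in\mathbb{C}:|w|\le 1\}$ and $\eta\in S$. Let $f$ be a zonal function on $S$ with pole at $\eta$ and profile function $\varphi$ defined on $D$, i.e. $f(\xi)=\varphi((\xi\mid\eta))$ for $\xi\in S$. Assume that $\varphi$ is real analytic on the interior of $D$ and that its Taylor series around $0$, $$\sum_{j,k=0}^{\infty}\frac{\partial^j\bar\partial^k\varphi(0)}{j!\,k!}\,w^j\bar w^k,$$ is absolutely convergent on the unit circle $|w|=1$. Then the coefficients $d_{p,q}$ of the spherical harmonic expansion of $f$, $$f(\xi)=\sum_{p,q=0}^{\infty}d_{p,q}\,\dim H^{(p,q)}\,Z^{(p,q)}_{\eta}(\xi),$$ are given by $$d_{p,q}=d_{p,q}(\varphi)=(n-1)!\sum_{k=0}^{\infty}\frac{\partial^{p+k}\bar\partial^{q+k}\varphi(0)}{k!\,(n-1+p+q+k)!},$$ and the expansion is absolutely and uniformly convergent on $S$.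
   Context: On $\mathbb{C}^n$, $(z\mid w)=\sum_{j=1}^n z_j\bar w_j$ and $|z|^2=(z\mid z)$. The notation $\partial=\frac{\partial}{\partial w}=\frac12\left(\frac{\partial}{\partial x}-i\frac{\partial}{\partial y}\right)$ and $\bar\partial=\frac{\partial}{\partial\bar w}=\frac12\left(\frac{\partial}{\partial x}+i\frac{\partial}{\partial y}\right)$ for $w=x+iy$ is used. A polynomial $P(z,\bar z)$ on $\mathbb{C}^n$ is bihomogeneous of degree $(p,q)$ if $P(\lambda z,\bar\lambda\bar z)=\lambda^p\bar\lambda^qP(z,\bar z)$ for all $\lambda\in\mathbb{C}$. $H^{(p,q)}$ is the space of restrictions to $S$ of the polynomials bihomogeneous of degree $(p,q)$ that are harmonic, i.e. annihilated by $\Delta=4\sum_{j=1}^n\frac{\partial^2}{\partial z_j\partial\bar z_j}$. One has $$\dim H^{(p,q)}=\frac{(n+p+q-1)\,(n-2+p)!\,(n-2+q)!}{p!\,q!\,(n-1)!\,(n-2)!},$$ and $L^2(S,d\sigma)=\bigoplus_{p,q\ge0}H^{(p,q)}$ orthogonally, where $\sigma$ is the normalized surface measure on $S$ ($\sigma(S)=1$). The spherical harmonic expansion of $f$ is its expansion with respect to this orthogonal decomposition. Let $(r)_0=1$, $(r)_i=r(r+1)\cdots(r+i-1)$. For $p,q\in\mathbb{Z}_{\ge0}$ the zonal kernel is $$Z^{(p,q)}_\eta(\xi)=\frac{(n-1)_{p+q}}{(n-1)_p\,(n-1)_q}\sum_{i=0}^{\min(p,q)}\frac{(-p)_i(-q)_i}{(-(n-2)-p-q)_i\,i!}\,(\xi\mid\eta)^{p-i}\,\overline{(\xi\mid\eta)}^{\,q-i},$$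 that is, $\frac{(n-1)_{p+q}}{(n-1)_p(n-1)_q}(\xi\mid\eta)^p\overline{(\xi\mid\eta)}^{\,q}\,{}_2F_1\left(-p,-q;-(n-2)-p-q;|(\xi\mid\eta)|^{-2}\right)$. It lies in $H^{(p,q)}$ and $Z^{(p,q)}_\eta(\eta)=1$.
   Formalization: The pointwise identity of f with its expansion is asserted only at points ξ where |(ξ|η)|<1 or φ is continuous within D at (ξ|η), since φ is otherwise arbitrary on |w|=1; equality in L² and the absolute and uniform convergence on S are unconditional. *)

(* Defs.v *)
From HB Require Import structures.
From mathcomp Require Import all_boot all_order all_algebra.
From mathcomp Require Import complex finmap.
From mathcomp Require all_classical all_reals all_analysis summability mpoly.

Set Implicit Arguments.
Unset Strict Implicit.
Unset Printing Implicit Defensive.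

Import Order.TTheory GRing.Theory Num.Theory.
Local Open Scope ring_scope.

(* The notations of mpoly clash with those of MathComp-Analysis, so everything
   that mentions {mpoly _} is in this module, before the analysis imports. *)
Module BihomPoly.
Import mpoly.

Section BihomPoly.
Variables (R : rcfType) (n : nat).

(* P(z, zbar): the variables of index lshift n j stand for z_j and those of
   index rshift n j for the conjugate of z_j. *)
Definition eval_zzbar (P : {mpoly R[i][n + n]}) (z : 'rV[R[i]]_n) : R[i] :=
  P.@[fun k => match split k with
               | inl j => z 0 j
               | inr j => (z 0 j)^*%C
               end].

Definition bihomogeneous (p q : nat) (P : {mpoly R[i][n + n]}) : Prop :=
  forall (l : R[i]) (z : 'rV[R[i]]_n),
    eval_zzbar P (l *: z) = l ^+ p * l^*%C ^+ q * eval_zzbar P z.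

Definition laplacian (P : {mpoly R[i][n + n]}) : {mpoly R[i][n + n]} :=
  (\sum_(j < n) P^`M(rshift n j)^`M(lshift n j)) *+ 4.

Definition harmonic (P : {mpoly R[i][n + n]}) : Prop := laplacian P = 0.

Definition harmonic_bihom (p q : nat) (P : {mpoly R[i][n + n]}) : Prop :=
  bihomogeneous p q P /\ harmonic P.

End BihomPoly.
End BihomPoly.

Import all_classical all_reals all_analysis.
Import numFieldNormedType.Exports.
Local Open Scope classical_set_scope.

(* The topology of R[i] is the one of its norm. *)
HB.instance Definition _ (R : rcfType) := NormedModule.copy R[i] R[i]^o.

(* C^n with its Borel sigma-algebra *)
Notation borel R n := (g_sigma_algebraType (@open 'rV[complex R]_n)).

Section Defs.
Variables (R : realType) (n : nat).
Local Notation C := R[i].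
Local Notation Cn := 'rV[R[i]]_n.

Definition cabs (z : C) : R := complex.Re `|z|.

(* Partial sums of a double series; their convergence along the filter totally
   of large finite sets of indices is unconditional convergence. *)
Definition dsum (V : zmodType) (u : nat -> nat -> V) (F : {fset nat * nat}) : V :=
  \sum_(i <- F) u i.1 i.2.

Definition cdot (z w : Cn) : C := \sum_(j < n) z 0 j * (w 0 j)^*%C.

Definition enorm (z : Cn) : R := Num.sqrt (complex.Re (cdot z z)).

Definition sphere : set Cn := [set z | enorm z = 1].

Definition unit_disc : set C := [set w | cabs w <= 1].

Definition ediam (U : set Cn) : \bar R :=
  maxe 0%E (ereal_sup [set (enorm (x - y))%:E | x in U & y in U]).

Definition hausdorff_pre (m : nat) (delta : R) (A : set Cn) : \bar R :=
  ereal_inf [set (\sum_(0 <= i <oo) ediam (U i) ^+ m)%E | U in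
    [set U : nat -> set Cn |
      A `<=` \bigcup_i U i /\ forall i, (ediam (U i) <= delta%:E)%E]].

(* The usual constant factor is omitted: it cancels in the normalization. *)
Definition hausdorff (m : nat) (A : set Cn) : \bar R :=
  ereal_sup [set hausdorff_pre m delta A | delta in [set delta | 0 < delta]].

(* The surface measure is the (2n-1)-dimensional Hausdorff measure of the
   sphere; sigma is its normalization, as a Borel measure on C^n carried by the
   sphere. *)
Definition normalized_surface_measure (sigma : probability (borel R n) R) : Prop :=
  forall A : set (borel R n), measurable A ->
    sigma A = (hausdorff (2 * n).-1 (A `&` sphere)
               / hausdorff (2 * n).-1 sphere)%E.

Definition sphere_int (sigma : probability (borel R n) R) (h : Cn -> C) : C :=
  Complex (\int[sigma]_(xi in sphere) complex.Re (h xi))%R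
          (\int[sigma]_(xi in sphere) complex.Im (h xi))%R.

Definition sphere_dot (sigma : probability (borel R n) R) (f g : Cn -> C) : C :=
  sphere_int sigma (fun xi => f xi * (g xi)^*%C).

(* Functions on the sphere are represented by functions on C^n whose values
   outside of the sphere are irrelevant. *)
Definition Hpq (p q : nat) : set (Cn -> C) :=
  [set h | exists2 P, @BihomPoly.harmonic_bihom R n p q P &
           forall xi, sphere xi -> h xi = BihomPoly.eval_zzbar P xi].

Definition has_dim (V : set (Cn -> C)) (m : nat) : Prop :=
  exists b : 'I_m -> Cn -> C,
    [/\ forall i, V (b i),
        forall c : 'I_m -> C,
          (forall xi, sphere xi -> \sum_(i < m) c i * b i xi = 0) ->
          forall i, c i = 0
      & forall h, V h -> exists c : 'I_m -> C,
          forall xi, sphere xi -> h xi = \sum_(i < m) c i * b i xi].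

Definition dimH (p q : nat) : nat := xget 0%N [set m | has_dim (Hpq p q) m].

(* g p q is the orthogonal projection of f onto H^(p,q) for all p, q, and the
   g p q sum to f in L^2(sphere, sigma). *)
Definition spherical_harmonic_expansion (sigma : probability (borel R n) R)
    (f : Cn -> C) (g : nat -> nat -> Cn -> C) : Prop :=
  [/\ forall p q, Hpq p q (g p q),
      forall p q h, Hpq p q h ->
        sphere_dot sigma (fun xi => f xi - g p q xi) h = 0
    & (fun F : {fset nat * nat} => (\int[sigma]_(xi in sphere)
         (cabs (f xi - dsum (fun p q => g p q xi) F) ^+ 2)%:E)%E)
        @ summability.totally --> 0%E].

Definition pochhammer (r : C) (i : nat) : C := \prod_(k < i) (r + k%:R).

Definition zonal_kernel (p q : nat) (eta xi : Cn) : C :=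
  pochhammer (n%:R - 1) (p + q)
    / (pochhammer (n%:R - 1) p * pochhammer (n%:R - 1) q)
  * \sum_(0 <= i < (minn p q).+1)
      pochhammer (- p%:R) i * pochhammer (- q%:R) i
      / (pochhammer (- (n%:R - 2) - p%:R - q%:R) i * i`!%:R)
      * cdot xi eta ^+ (p - i) * (cdot xi eta)^*%C ^+ (q - i).

(* Derivative at w along v of g : R^2 -> C, for real increments *)
Definition dir_derive (v : C) (g : C -> C) (w : C) : C :=
  Complex ((fun t : R => complex.Re (g (w + t%:C%C * v)))^`() 0)
          ((fun t : R => complex.Im (g (w + t%:C%C * v)))^`() 0).

Definition wirtinger (g : C -> C) (w : C) : C :=
  2^-1 * (dir_derive 1 g w - 'i%C * dir_derive 'i%C g w).

Definition wirtinger_bar (g : C -> C) (w : C) : C :=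
  2^-1 * (dir_derive 1 g w + 'i%C * dir_derive 'i%C g w).

Definition wirtinger_iter (j k : nat) (g : C -> C) : C -> C :=
  iter j wirtinger (iter k wirtinger_bar g).

(* Real analyticity in the two real coordinates, on an open set U *)
Definition real_analytic_on (U : set C) (g : C -> C) : Prop :=
  forall w0, U w0 -> exists (c : nat -> nat -> C) (r : R), 0 < r /\
    forall x y : R, `|x| < r -> `|y| < r ->
      dsum (fun j k => c j k * (x ^+ j)%:C%C * (y ^+ k)%:C%C)
        @ summability.totally --> g (w0 + Complex x y).

Definition uniformly_summable_to (A : set Cn)
    (u : nat -> nat -> Cn -> C) (s : Cn -> C) : Prop :=
  {uniform A, (fun (F : {fset nat * nat}) xi => dsum (fun p q => u p q xi) F)
                @ summability.totally --> s}.

Definition taylor_term (phi : C -> C) (w : C) (j k : nat) : C :=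
  wirtinger_iter j k phi 0 / (j`!%:R * k`!%:R) * w ^+ j * w^*%C ^+ k.

Definition abs_summable (u : nat -> nat -> C) : Prop :=
  (\esum_(i in [set: nat * nat]) (cabs (u i.1 i.2))%:E < +oo)%E.

Definition zonal_function (eta : Cn) (phi : C -> C) (f : Cn -> C) : Prop :=
  forall xi, sphere xi -> f xi = phi (cdot xi eta).

Definition zonal_coef_term (phi : C -> C) (p q k : nat) : C :=
  wirtinger_iter (p + k) (q + k) phi 0 / (k`!%:R * (n.-1 + p + q + k)`!%:R).

Definition zonal_coef (phi : C -> C) (p q : nat) : C :=
  (n.-1)`!%:R * limn (series (zonal_coef_term phi p q)).

End Defs.

Arguments unit_disc R : clear implicits.
Arguments sphere R n : clear implicits.

(* Main.v *)
(* Integration over the sphere is a linear functional I on the polynomials in z and its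
   conjugate. The Hausdorff measure is invariant under the unitary maps
   z |-> z + mu (z | v) v; differentiating along one-parameter families of these maps
   shows that I vanishes on the action of gl_n. This and I (|z|^2 P) = I P determine I on
   the products of a harmonic polynomial with the monomials
   (z | eta)^j conj(z | eta)^k; in particular Z_eta is, up to a factor kappa, the
   reproducing kernel of H^(p,q). The trace of a Gram matrix gives
   kappa * dim H^(p,q) = 1, and |Z_eta| <= 1 by Cauchy-Schwarz.

   It follows that w^j conj(w)^k, for w = (z | eta), is the sum over i of
   c_i dim H^(j-i,k-i) Z_eta^(j-i,k-i) with explicit c_i > 0, and evaluation at the pole
   shows that the weights c_i dim H^(j-i,k-i) add up to 1. Inserting this into the Taylor
   series of phi and regrouping gives the zonal series with the coefficients d_(p,q),
   dominated by the sum of the moduli of the Taylor coefficients. The function phi is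
   equal to its Taylor series on the open disc by the identity theorem on rays, and the
   points of the sphere with |w| = 1 form a null set. *)
Require Import Defs.
From HB Require Import structures.
From mathcomp Require Import all_boot all_order all_algebra.
From mathcomp Require Import complex finmap.
From mathcomp Require Import ring lra zify.
From mathcomp Require all_classical all_reals all_analysis measurable_realfun.
From mathcomp Require summability mpoly.

Set Implicit Arguments.
Unset Strict Implicit.
Unset Printing Implicit Defensive.

Import Order.TTheory GRing.Theory Num.Theory.
Local Open Scope ring_scope.

(** * Invariant functionals on polynomials *)

(** No integral is computed in coordinates. The source of all values is the identity I (lap P) = m
    (n + m - 1) I P for P of bidegree (m, m), which turns integration into a recursion on the
    degree. The product of the factors n + m - 1 for m up to p + q + k is (n-1+p+q+k)!/(n-1)!, and
    this is where the factorials of d_(p,q) come from. Two features of the statement shape the rest.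
    The values of phi on the unit circle are arbitrary, so f may fail to be measurable; the
    orthogonality and L^2 claims are therefore established for the sum s of the zonal series and
    transferred to f across a null set. Convergence is unconditional, along finite sets of indices.
    For this reason a single family indexed by triples ((p, q), r) is bounded once in l^1 and then
    grouped in two ways, by the Taylor bidegree (p + r, q + r) and by (p, q); one partition lemma
    serves both groupings. *)

Module SphereAlgebra.
Import mpoly.

Lemma split_l m n (j : 'I_m) : split (lshift n j) = inl j.
Proof. exact: (unsplitK (inl j)). Qed.
Lemma split_r m n (j : 'I_n) : split (rshift m j) = inr j.
Proof. exact: (unsplitK (inr j)). Qed.

Lemma conjci (R : rcfType) : ('i%C)^*%C = - 'i%C :> R[i].
Proof. by apply/eqP; rewrite eq_complex /= oppr0 !eqxx. Qed.

Section Algebra.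
Variables (F : numFieldType) (n : nat).
Local Notation Pol := {mpoly F[n + n]}.
Local Notation zv j := ('X_(lshift n j) : Pol).
Local Notation zb j := ('X_(rshift n j) : Pol).
Implicit Types (P Q h : Pol) (m : 'X_{1..n + n}).

Definition dz (j : 'I_n) P : Pol := P^`M(lshift n j).
Definition dw (j : 'I_n) P : Pol := P^`M(rshift n j).
(** The factor 4 of [BihomPoly.laplacian] is dropped; the harmonic polynomials remain the same. *)
Definition lap P : Pol := \sum_(j < n) dz j (dw j P).

Definition degl m : nat := (\sum_(j < n) m (lshift n j))%N.
Definition degr m : nat := (\sum_(j < n) m (rshift n j))%N.

(** Bihomogeneity read on coefficients, which suits differentiation and induction; [harmonic_bihomP]
    links it with the condition on values. The zero polynomial has every bidegree. *)
Definition bideg (p q : nat) P : Prop :=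
  forall m, P@_m != 0 -> degl m = p /\ degr m = q.

Lemma deglD m1 m2 : degl (m1 + m2) = (degl m1 + degl m2)%N.
Proof. by rewrite /degl -big_split; apply: eq_bigr => j _; rewrite mnmDE. Qed.

Lemma degrD m1 m2 : degr (m1 + m2) = (degr m1 + degr m2)%N.
Proof. by rewrite /degr -big_split; apply: eq_bigr => j _; rewrite mnmDE. Qed.

Lemma deglUl j : degl U_(lshift n j) = 1%N.
Proof.
rewrite /degl (bigD1 j) //= mnm1E eqxx big1 ?addn0 // => i ij.
by rewrite mnm1E eq_lshift eq_sym (negbTE ij).
Qed.

Lemma deglUr j : degl U_(rshift n j) = 0%N.
Proof. by rewrite /degl big1 // => i _; rewrite mnm1E eq_rlshift. Qed.

Lemma degrUr j : degr U_(rshift n j) = 1%N.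
Proof.
rewrite /degr (bigD1 j) //= mnm1E eqxx big1 ?addn0 // => i ij.
by rewrite mnm1E eq_rshift eq_sym (negbTE ij).
Qed.

Lemma degrUl j : degr U_(lshift n j) = 0%N.
Proof. by rewrite /degr big1 // => i _; rewrite mnm1E eq_lrshift. Qed.

Lemma mdeg_degl_degr m : mdeg m = (degl m + degr m)%N.
Proof. by rewrite mdegE big_split_ord. Qed.

Lemma bideg0 p q : bideg p q 0.
Proof. by move=> m; rewrite mcoeff0 eqxx. Qed.

Lemma bidegD p q P Q : bideg p q P -> bideg p q Q -> bideg p q (P + Q).
Proof.
move=> hP hQ m; rewrite mcoeffD.
by have [->|/hP//] := eqVneq P@_m 0; rewrite add0r => /hQ.
Qed.

Lemma bidegZ p q c P : bideg p q P -> bideg p q (c *: P).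
Proof. by move=> hP m; rewrite mcoeffZ mulf_eq0 negb_or => /andP[_ /hP]. Qed.

Lemma bideg_sum p q (I : Type) (r : seq I) (A : pred I) (G : I -> Pol) :
  (forall i, A i -> bideg p q (G i)) -> bideg p q (\sum_(i <- r | A i) G i).
Proof.
move=> hG; elim/big_ind: _ => //; [exact: bideg0|by move=> *; exact: bidegD].
Qed.

Lemma bidegM p q p' q' P Q :
  bideg p q P -> bideg p' q' Q -> bideg (p + p') (q + q') (P * Q).
Proof.
move=> hP hQ m; rewrite -mcoeff_msupp => /msuppM_le /allpairsP[[m1 m2] /= []].
rewrite !mcoeff_msupp => /hP[<- <-] /hQ[<- <-] ->.
by rewrite deglD degrD.
Qed.

Lemma bidegC c : bideg 0 0 c%:MP.
Proof.
move=> m; rewrite mcoeffC.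
have [->|_] := eqVneq m 0%MM; last by rewrite mulr0 eqxx.
by rewrite /degl /degr !big1 // => i _; rewrite mnmE.
Qed.

Lemma bidegXl j : bideg 1 0 (zv j).
Proof.
by move=> m; rewrite mcoeffX pnatr_eq0 eqb0 negbK => /eqP <-; rewrite deglUl degrUl.
Qed.

Lemma bidegXr j : bideg 0 1 (zb j).
Proof.
by move=> m; rewrite mcoeffX pnatr_eq0 eqb0 negbK => /eqP <-; rewrite deglUr degrUr.
Qed.

Lemma bidegXn p q P k : bideg p q P -> bideg (p * k) (q * k) (P ^+ k).
Proof.
move=> hP; elim: k => [|k IHk].
  by rewrite !muln0 expr0 -mpolyC1; exact: bidegC.
by rewrite !mulnS exprS; exact: bidegM.
Qed.

Lemma bideg_dz p q j P : bideg p q P -> bideg p.-1 q (dz j P).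
Proof.
move=> hP m; rewrite mcoeff_mderiv => h.
have /hP : P@_(m + U_(lshift n j)) != 0 by apply: contraNneq h => ->; rewrite mul0rn.
by rewrite deglD degrD deglUl degrUl addn1 addn0 => -[<- <-].
Qed.

Lemma bideg_dw p q j P : bideg p q P -> bideg p q.-1 (dw j P).
Proof.
move=> hP m; rewrite mcoeff_mderiv => h.
have /hP : P@_(m + U_(rshift n j)) != 0 by apply: contraNneq h => ->; rewrite mul0rn.
by rewrite deglD degrD deglUr degrUr addn1 addn0 => -[<- <-].
Qed.

Lemma bideg0_dz q j P : bideg 0 q P -> dz j P = 0.
Proof.
move=> hP; apply/mpolyP => m; rewrite mcoeff_mderiv mcoeff0.
have [->|/hP[]] := eqVneq P@_(m + U_(lshift n j)) 0; first by rewrite mul0rn.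
by rewrite deglD deglUl addn1.
Qed.

Lemma bideg0_dw p j P : bideg p 0 P -> dw j P = 0.
Proof.
move=> hP; apply/mpolyP => m; rewrite mcoeff_mderiv mcoeff0.
have [->|/hP[_]] := eqVneq P@_(m + U_(rshift n j)) 0; first by rewrite mul0rn.
by rewrite degrD degrUr addn1.
Qed.

Lemma mulX_mderiv (i : 'I_(n + n)) m :
  'X_i * ('X_[m])^`M(i) = (m i)%:R *: 'X_[m] :> Pol.
Proof.
rewrite mderivX -scalerAr -mpolyXD.
(* For exponent 0 the truncated subtraction spoils the monomial, but the scalar in front is 0. *)
have [->|mi] := eqVneq (m i) 0%N; first by rewrite !scale0r.
congr (_ *: 'X_[_]); apply/mnmP => k; rewrite mnmDE mnmBE mnm1E.
by case: eqP => [<-|_]; rewrite ?add0n ?subn0// add1n subn1 prednK// lt0n.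
Qed.

Lemma dzM j P Q : dz j (P * Q) = dz j P * Q + P * dz j Q.
Proof. exact: mderivM. Qed.
Lemma dwM j P Q : dw j (P * Q) = dw j P * Q + P * dw j Q.
Proof. exact: mderivM. Qed.
Lemma dzD j P Q : dz j (P + Q) = dz j P + dz j Q. Proof. exact: mderivD. Qed.
Lemma dwD j P Q : dw j (P + Q) = dw j P + dw j Q. Proof. exact: mderivD. Qed.
Lemma dzZ j c P : dz j (c *: P) = c *: dz j P. Proof. exact: mderivZ. Qed.
Lemma dwZ j c P : dw j (c *: P) = c *: dw j P. Proof. exact: mderivZ. Qed.
Lemma dz_sum j (I : Type) (r : seq I) (A : pred I) (G : I -> Pol) :
  dz j (\sum_(i <- r | A i) G i) = \sum_(i <- r | A i) dz j (G i).
Proof. exact: raddf_sum. Qed.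
Lemma dw_sum j (I : Type) (r : seq I) (A : pred I) (G : I -> Pol) :
  dw j (\sum_(i <- r | A i) G i) = \sum_(i <- r | A i) dw j (G i).
Proof. exact: raddf_sum. Qed.
Lemma euler_l p q P : bideg p q P -> \sum_(j < n) zv j * dz j P = p%:R *: P.
Proof.
move=> hP; rewrite {2}(mpolyE P) scaler_sumr.
transitivity (\sum_(j < n) \sum_(m <- msupp P) P@_m *: ((m (lshift n j))%:R *: 'X_[m]) : Pol).
  apply: eq_bigr => j _; rewrite {1}(mpolyE P) dz_sum mulr_sumr.
  by apply: eq_bigr => m _; rewrite dzZ -scalerAr mulX_mderiv.
rewrite exchange_big /=; apply: eq_big_seq => m; rewrite mcoeff_msupp => /hP[<- _].
by rewrite -scaler_sumr -scaler_suml -natr_sum scalerA mulrC -scalerA.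
Qed.

Lemma euler_r p q P : bideg p q P -> \sum_(j < n) zb j * dw j P = q%:R *: P.
Proof.
move=> hP; rewrite {2}(mpolyE P) scaler_sumr.
transitivity (\sum_(j < n) \sum_(m <- msupp P) P@_m *: ((m (rshift n j))%:R *: 'X_[m]) : Pol).
  apply: eq_bigr => j _; rewrite {1}(mpolyE P) dw_sum mulr_sumr.
  by apply: eq_bigr => m _; rewrite dwZ -scalerAr mulX_mderiv.
rewrite exchange_big /=; apply: eq_big_seq => m; rewrite mcoeff_msupp => /hP[_ <-].
by rewrite -scaler_sumr -scaler_suml -natr_sum scalerA mulrC -scalerA.
Qed.

Lemma mderivXU (i j : 'I_(n + n)) : ('X_i)^`M(j) = (i == j)%:R%:MP :> Pol.
Proof.
rewrite mderivX mnm1E; case: eqP => [->|_]; last by rewrite scale0r mpolyC0.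
have -> : (U_(j) - U_(j) = 0)%MM by apply/mnmP => k; rewrite mnmBE subnn mnmE.
by rewrite scale1r mpolyX0 mpolyC1.
Qed.

Lemma dz_zb j k : dz j (zb k) = 0.
Proof. by rewrite /dz mderivXU eq_rlshift mpolyC0. Qed.
Lemma dw_zv j k : dw j (zv k) = 0.
Proof. by rewrite /dw mderivXU eq_lrshift mpolyC0. Qed.
Lemma dz_zv j k : dz j (zv k) = (k == j)%:R.
Proof. by rewrite /dz mderivXU eq_lshift; case: eqP; rewrite ?mpolyC0. Qed.
Lemma dw_zb j k : dw j (zb k) = (k == j)%:R.
Proof. by rewrite /dw mderivXU eq_rshift; case: eqP; rewrite ?mpolyC0. Qed.
Lemma dz_dw i j P : dz i (dw j P) = dw j (dz i P).
Proof. exact: mderiv_comm. Qed.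
Lemma dz_dz i j P : dz i (dz j P) = dz j (dz i P).
Proof. exact: mderiv_comm. Qed.
Lemma dw_dw i j P : dw i (dw j P) = dw j (dw i P).
Proof. exact: mderiv_comm. Qed.
Lemma dzXn j P k : dz j (P ^+ k) = k%:R *: (P ^+ k.-1 * dz j P).
Proof.
elim: k => [|k IHk].
  by rewrite expr0 scale0r -mpolyC1; exact: mderivC.
case: k IHk => [|k] IHk; first by rewrite expr1 expr0 mul1r scale1r.
rewrite [in LHS]exprS dzM IHk /= -scalerAr mulrA -exprS (mulrC (dz j P)).
by rewrite -[X in X + _]scale1r -scalerDl nat1r.
Qed.
Lemma dwXn j P k : dw j (P ^+ k) = k%:R *: (P ^+ k.-1 * dw j P).
Proof.
elim: k => [|k IHk].
  by rewrite expr0 scale0r -mpolyC1; exact: mderivC.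
case: k IHk => [|k] IHk; first by rewrite expr1 expr0 mul1r scale1r.
rewrite [in LHS]exprS dwM IHk /= -scalerAr mulrA -exprS (mulrC (dw j P)).
by rewrite -[X in X + _]scale1r -scalerDl nat1r.
Qed.

Lemma lapZ c P : lap (c *: P) = c *: lap P.
Proof. by rewrite /lap scaler_sumr; apply: eq_bigr => j _; rewrite dwZ dzZ. Qed.

Lemma lap_dz j P : lap (dz j P) = dz j (lap P).
Proof.
rewrite /lap dz_sum; apply: eq_bigr => i _.
by rewrite -dz_dw -dz_dz.
Qed.

Lemma lap_dw j P : lap (dw j P) = dw j (lap P).
Proof.
rewrite /lap dw_sum; apply: eq_bigr => i _.
by rewrite dw_dw dz_dw.
Qed.

Lemma lapM P Q : lap (P * Q) = lap P * Q + P * lap Q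
  + \sum_(j < n) (dz j P * dw j Q + dw j P * dz j Q).
Proof.
rewrite /lap mulr_suml mulr_sumr -!big_split /=; apply: eq_bigr => j _.
by rewrite dwM dzD !dzM; ring.
Qed.

Lemma lap_sum (I : Type) (r : seq I) (A : pred I) (G : I -> Pol) :
  lap (\sum_(i <- r | A i) G i) = \sum_(i <- r | A i) lap (G i).
Proof.
rewrite /lap exchange_big /=; apply: eq_bigr => j _.
by rewrite dw_sum dz_sum.
Qed.

Section Functional.
Variable I : Pol -> F.
Hypothesis ID : forall P Q, I (P + Q) = I P + I Q.
Hypothesis IZ : forall c P, I (c *: P) = c * I P.
Hypothesis IE : forall a b P, I (zv a * dz b P - zb b * dw a P) = 0.
Hypothesis IS : forall P, I ((\sum_(a < n) zv a * zb a) * P) = I P.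

Lemma functional0 : I 0 = 0.
Proof. by rewrite -(scale0r 0) IZ mul0r. Qed.

Lemma functionalB P Q : I (P - Q) = I P - I Q.
Proof. by rewrite ID -scaleN1r IZ mulN1r. Qed.

Lemma functional_sum (J : Type) (r : seq J) (A : pred J) (G : J -> Pol) :
  I (\sum_(i <- r | A i) G i) = \sum_(i <- r | A i) I (G i).
Proof. by apply: (big_morph I) => //; exact: functional0. Qed.

(** Adding the invariances with a = b gives, by the two Euler identities, (p - q) I P = 0. *)
Lemma functional_unbalanced p q P : bideg p q P -> p != q -> I P = 0.
Proof.
move=> hP pq.
have : I (\sum_(j < n) (zv j * dz j P - zb j * dw j P)) = 0.
  by rewrite functional_sum big1.
rewrite big_split /= sumrN (euler_l hP) (euler_r hP) -scalerBl IZ => /eqP.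
by rewrite mulf_eq0 subr_eq0 eqr_nat (negbTE pq) => /eqP.
Qed.

(* Summing the invariance of I for the polynomials zb k * dw j P over all j and k
   produces the Laplacian. *)
Lemma functional_lap (m : nat) P : bideg m m P ->
  I (lap P) = (m * (n + m).-1)%:R * I P.
Proof.
move=> hP.
have : I (\sum_(k < n) \sum_(j < n) (zv k * dz j (zb k * dw j P)
    - zb j * dw k (zb k * dw j P))) = 0.
  by rewrite functional_sum big1// => k _; rewrite functional_sum big1.
have -> : \sum_(k < n) \sum_(j < n) (zv k * dz j (zb k * dw j P)
    - zb j * dw k (zb k * dw j P)) =
    (\sum_(a < n) zv a * zb a) * lap P - (m * (n + m).-1)%:R *: P.
  transitivity (\sum_(k < n) \sum_(j < n) (zv k * zb k * dz j (dw j P))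
     - \sum_(k < n) \sum_(j < n) zb j * dw j P
     - \sum_(j < n) zb j * \sum_(k < n) zb k * dw k (dw j P)).
    under [X in _ = _ - X]eq_bigr do rewrite mulr_sumr.
    rewrite [X in _ = _ - X]exchange_big /= -!sumrB; apply: eq_bigr => k _.
    rewrite -!sumrB; apply: eq_bigr => j _.
    by rewrite dzM dwM dz_zb dw_zb eqxx /= mulr1n; ring.
  rewrite /lap mulr_suml; under [X in X - _ - _]eq_bigr do rewrite -mulr_sumr.
  rewrite -addrA; congr (_ + _); rewrite sumr_const card_ord (euler_r hP).
  under eq_bigr do rewrite (euler_r (bideg_dw hP)) -scalerAr.
  rewrite -scaler_sumr (euler_r hP) -scaler_nat !scalerA -opprD -scalerDl -!natrM -natrD.
  congr (- (_%:R *: _)); case: m {hP} => [|m]; first by rewrite !muln0 mul0n.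
  by rewrite addnS /= -mulnDl mulnC.
by rewrite functionalB IS IZ => /eqP; rewrite subr_eq0 => /eqP.
Qed.

Hypothesis n_gt0 : (0 < n)%N.

(** Here [h'] plays the conjugate of a harmonic polynomial of bidegree (p', q'), hence its bidegree
    (q', p'). By harmonicity the Laplacian of [h * h'] consists only of products of first
    derivatives; these are again harmonic, of lower degree, and still have distinct first indices,
    so induction on the degree applies. *)
Lemma functional_harmonic_ortho (m : nat) p q p' q' h h' :
  bideg p q h -> bideg q' p' h' -> lap h = 0 -> lap h' = 0 ->
  (p + q' = m)%N -> (q + p' = m)%N -> p != p' -> I (h * h') = 0.
Proof.
elim: m p q p' q' h h' => [|m IHm] p q p' q' h h' hb hb' hh hh' e1 e2 pp'.
  by move: e1 e2 pp'; case: p {hb} => // _; case: p' {hb'} => // p'; rewrite addnS.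
have := @functional_lap m.+1 (h * h').
rewrite lapM hh hh' mul0r mulr0 !add0r functional_sum.
have -> : \sum_(j < n) I (dz j h * dw j h' + dw j h * dz j h') = 0.
  apply: big1 => j _; rewrite ID.
  have -> : I (dz j h * dw j h') = 0.
    case: p hb e1 pp' => [|p] hb e1 pp'.
      by rewrite (bideg0_dz _ hb) mul0r functional0.
    case: p' hb' e2 pp' => [|p'] hb' e2 pp'.
      by rewrite (bideg0_dw _ hb') mulr0 functional0.
    have [e3 e4] : (p + q' = m /\ q + p' = m)%N.
      by split; apply: succn_inj; [rewrite -addSn|rewrite -addnS].
    apply: (IHm p q p' q') => //; [exact: (bideg_dz (p := p.+1))| |..].
    - exact: (bideg_dw (q := p'.+1)).
    - by rewrite lap_dz hh /dz mderiv0.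
    - by rewrite lap_dw hh' /dw mderiv0.
  rewrite add0r.
  case: q hb e2 => [|q] hb e2.
    by rewrite (bideg0_dw _ hb) mul0r functional0.
  case: q' hb' e1 => [|q'] hb' e1.
    by rewrite (bideg0_dz _ hb') mulr0 functional0.
  have [e3 e4] : (p + q' = m /\ q + p' = m)%N.
    by split; apply: succn_inj; [rewrite -addnS|rewrite -addSn].
  apply: (IHm p q p' q') => //; [exact: (bideg_dw (q := q.+1))| |..].
  - exact: (bideg_dz (p := q'.+1)).
  - by rewrite lap_dw hh /dw mderiv0.
  - by rewrite lap_dz hh' /dz mderiv0.
(* The Laplacian integrates to 0 while the factor (m + 1)(n + m) does not vanish. *)
move=> /(_ _)/esym/eqP; rewrite mulf_eq0 pnatr_eq0 addnS muln_eq0 /=.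
rewrite addn_eq0 (gtn_eqF n_gt0) /= => H.
by apply/eqP/H; rewrite -{1}e1 -e2; exact: bidegM.
Qed.

Variables eta etab : 'I_n -> F.
Hypothesis eta1 : \sum_(i < n) eta i * etab i = 1.

(** [W] and [Wb] stand for (z | eta) and its conjugate. No conjugation is assumed on [F], so the
    pole and its conjugate are two families tied only by [eta1]. *)
Definition pairing_l : Pol := \sum_(i < n) etab i *: zv i.
Definition pairing_r : Pol := \sum_(i < n) eta i *: zb i.
Local Notation W := pairing_l.
Local Notation Wb := pairing_r.
Definition ev_pole P : F :=
  P.@[fun k => match split k with inl j => eta j | inr j => etab j end].

Lemma bidegW : bideg 1 0 W.
Proof. by apply: bideg_sum => i _; apply: bidegZ; exact: bidegXl. Qed.
Lemma bidegWb : bideg 0 1 Wb.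
Proof. by apply: bideg_sum => i _; apply: bidegZ; exact: bidegXr. Qed.

Lemma dzW i : dz i W = (etab i)%:MP.
Proof.
rewrite /W dz_sum (bigD1 i) //= dzZ dz_zv eqxx big1 => [|j ji].
  by rewrite addr0 -alg_mpolyC.
by rewrite dzZ dz_zv (negbTE ji) scaler0.
Qed.
Lemma dwW i : dw i W = 0.
Proof. by rewrite /W dw_sum big1 // => j _; rewrite dwZ dw_zv scaler0. Qed.
Lemma dwWb i : dw i Wb = (eta i)%:MP.
Proof.
rewrite /Wb dw_sum (bigD1 i) //= dwZ dw_zb eqxx big1 => [|j ji].
  by rewrite addr0 -alg_mpolyC.
by rewrite dwZ dw_zb (negbTE ji) scaler0.
Qed.
Lemma dzWb i : dz i Wb = 0.
Proof. by rewrite /Wb dz_sum big1 // => j _; rewrite dzZ dz_zb scaler0. Qed.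

Lemma dz_pairing i j k :
  dz i (Wb ^+ j * W ^+ k) = (k%:R * etab i) *: (Wb ^+ j * W ^+ k.-1).
Proof.
rewrite dzM !dzXn dzWb dzW mulr0 scaler0 mul0r add0r.
by rewrite -scalerA -alg_mpolyC -!scalerAr mulr1.
Qed.
Lemma dw_pairing i j k :
  dw i (Wb ^+ j * W ^+ k) = (j%:R * eta i) *: (Wb ^+ j.-1 * W ^+ k).
Proof.
rewrite dwM !dwXn dwWb dwW mulr0 scaler0 mulr0 addr0.
by rewrite -scalerA -alg_mpolyC -!scalerAr mulr1 -!scalerAl.
Qed.
Lemma lap_pairing j k :
  lap (Wb ^+ j * W ^+ k) = (j * k)%:R *: (Wb ^+ j.-1 * W ^+ k.-1).
Proof.
rewrite /lap; under eq_bigr do rewrite dw_pairing dzZ dz_pairing scalerA.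
rewrite -scaler_suml; congr (_ *: _).
rewrite natrM -[RHS]mulr1 -eta1 mulr_sumr; apply: eq_bigr => i _; ring.
Qed.

(** The contraction of the gradient of [h] with that of [Wb]; [dpoleb] is the one with [W]. *)
Definition dpole h : Pol := \sum_(i < n) eta i *: dz i h.
Definition dpoleb h : Pol := \sum_(i < n) etab i *: dw i h.

Lemma meval_sum (v : 'I_(n + n) -> F) (J : Type) (r : seq J) (A : pred J) (G : J -> Pol) :
  (\sum_(i <- r | A i) G i).@[v] = \sum_(i <- r | A i) (G i).@[v].
Proof. exact: raddf_sum. Qed.

(** Euler's identity, evaluated at the pole. *)
Lemma ev_pole_dpole p q h : bideg p q h -> ev_pole (dpole h) = p%:R * ev_pole h.
Proof.
move=> hb; rewrite -mevalZ -(euler_l hb) /ev_pole /dpole !meval_sum.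
apply: eq_bigr => i _; rewrite mevalZ mevalM mevalXU.
by case: splitP => k /=; [move/val_inj<-|move=> e; have := ltn_ord i; rewrite e ltnNge leq_addr].
Qed.

Lemma ev_pole_dpoleb p q h : bideg p q h -> ev_pole (dpoleb h) = q%:R * ev_pole h.
Proof.
move=> hb; rewrite -mevalZ -(euler_r hb) /ev_pole /dpoleb !meval_sum.
apply: eq_bigr => i _; rewrite mevalZ mevalM mevalXU.
case: splitP => k /=; first by move=> e; have := ltn_ord k; rewrite -e ltnNge leq_addr.
by move/addnI/val_inj <-.
Qed.

Lemma bideg_dpole p q h : bideg p q h -> bideg p.-1 q (dpole h).
Proof. by move=> hb; apply: bideg_sum => i _; apply: bidegZ; exact: bideg_dz. Qed.
Lemma bideg_dpoleb p q h : bideg p q h -> bideg p q.-1 (dpoleb h).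
Proof. by move=> hb; apply: bideg_sum => i _; apply: bidegZ; exact: bideg_dw. Qed.
Lemma bideg0_dpole q h : bideg 0 q h -> dpole h = 0.
Proof. by move=> hb; apply: big1 => i _; rewrite (bideg0_dz _ hb) scaler0. Qed.
Lemma bideg0_dpoleb p h : bideg p 0 h -> dpoleb h = 0.
Proof. by move=> hb; apply: big1 => i _; rewrite (bideg0_dw _ hb) scaler0. Qed.
Lemma lap_dpole h : lap h = 0 -> lap (dpole h) = 0.
Proof.
move=> hh; rewrite lap_sum big1 // => i _.
by rewrite lapZ lap_dz hh /dz mderiv0 scaler0.
Qed.
Lemma lap_dpoleb h : lap h = 0 -> lap (dpoleb h) = 0.
Proof.
move=> hh; rewrite lap_sum big1 // => i _.
by rewrite lapZ lap_dw hh /dw mderiv0 scaler0.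
Qed.

(** This is [functional_lap] for the product of [h] with a pairing monomial. As [h] is harmonic,
    only the cross terms and the Laplacian of the monomial survive. Every integral on the right has
    smaller degree, so both evaluations below can proceed by induction. *)
Lemma functional_pairing_step p q j k h :
  bideg p q h -> lap h = 0 -> (p + k = q + j)%N ->
  ((p + k) * (n + (p + k)).-1)%:R * I (h * (Wb ^+ j * W ^+ k)) =
  j%:R * I (dpole h * (Wb ^+ j.-1 * W ^+ k))
  + k%:R * I (dpoleb h * (Wb ^+ j * W ^+ k.-1))
  + (j * k)%:R * I (h * (Wb ^+ j.-1 * W ^+ k.-1)).
Proof.
move=> hb hh e.
have hbm : bideg (p + k) (p + k) (h * (Wb ^+ j * W ^+ k)).
  rewrite {2}e; apply: bidegM => //.
  have := bidegM (bidegXn (k := j) bidegWb) (bidegXn (k := k) bidegW).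
  by rewrite !mul0n !mul1n addn0 add0n.
rewrite -functional_lap // lapM hh mul0r add0r lap_pairing -!IZ -!ID; congr (I _).
rewrite addrC -scalerAr; congr (_ + _).
rewrite big_split /= /dpole /dpoleb !mulr_suml !scaler_sumr; congr (_ + _);
  apply: eq_bigr => i _.
  by rewrite dw_pairing -scalerAr -scalerAl scalerA.
by rewrite dz_pairing -scalerAr -scalerAl scalerA.
Qed.

Let npos (m : nat) : (0 < m)%N -> (m * (n + m).-1)%:R != 0 :> F.
Proof.
move=> m0; rewrite pnatr_eq0 muln_eq0 negb_or -lt0n m0 /=.
by case: m m0 => // m _; rewrite addnS /= addn_eq0 (gtn_eqF n_gt0).
Qed.

(** The deficit j < p persists in each term of the recursion: either p and j drop together, or p
    stays and j does not grow. When j = 0 the first term carries the factor 0, so p never catches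
    up. *)
Lemma functional_pairing_low p q j k h :
  bideg p q h -> lap h = 0 -> (p + k = q + j)%N -> (j < p)%N ->
  I (h * (Wb ^+ j * W ^+ k)) = 0.
Proof.
have [m hm] := ubnP (p + k).
elim: m p q j k h hm => // m IHm p q j k h hm hb hh e jp.
have m0 : (0 < p + k)%N by rewrite addn_gt0 (leq_ltn_trans _ jp).
apply: (mulfI (npos m0)); rewrite mulr0 (functional_pairing_step hb hh e).
have -> : j%:R * I (dpole h * (Wb ^+ j.-1 * W ^+ k)) = 0.
  case: j e jp => [|j] e jp; first by rewrite mul0r.
  case: p jp hm hb e {m0} => // p jp hm hb e.
  rewrite (IHm p q j k (dpole h)) ?mulr0//.
  - exact: (bideg_dpole hb).
  - exact: lap_dpole.
  - by apply: succn_inj; rewrite -addSn e addnS.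
have -> : k%:R * I (dpoleb h * (Wb ^+ j * W ^+ k.-1)) = 0.
  case: k hm e {m0} => [|k] hm e; first by rewrite mul0r.
  case: q hb e => [|q] hb e.
    by rewrite (bideg0_dpoleb hb) mul0r functional0 mulr0.
  rewrite (IHm p q j k (dpoleb h)) ?mulr0//.
  - by move: hm; rewrite addnS.
  - exact: (bideg_dpoleb hb).
  - exact: lap_dpoleb.
  - by apply: succn_inj; rewrite -addnS e addSn.
have -> : (j * k)%:R * I (h * (Wb ^+ j.-1 * W ^+ k.-1)) = 0.
  case: k hm e {m0} => [|k] hm e; first by rewrite muln0 mul0r.
  case: j e jp => [|j] e jp; first by rewrite mul0n mul0r.
  rewrite (IHm p q j k h) ?mulr0//.
  - by move: hm; rewrite addnS.
  - by apply: succn_inj; rewrite -!addnS.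
  - exact: ltnW.
by rewrite !addr0.
Qed.

(** After division by the Taylor denominators (p+r)! (q+r)! this is the weight (n-1)!/(r!
    (n-1+p+q+r)!) in the formula for d_(p,q). *)
Definition pairing_coef (p q r : nat) : F :=
  (n.-1)`!%:R * ((p + r)`!%:R * (q + r)`!%:R) / (r`!%:R * (n.-1 + p + q + r)`!%:R).

Hypothesis I1 : I 1 = 1.

(** Put N = n - 1 + p + q + r. The three terms of the recursion contribute p N, q N and r N times
    the claimed value, and (p + q + r) N is exactly the factor on the left. *)
Lemma functional_pairing p q r h :
  bideg p q h -> lap h = 0 ->
  I (h * (Wb ^+ (p + r) * W ^+ (q + r))) = pairing_coef p q r * ev_pole h.
Proof.
have [m] := ubnP (p + q + r).
elim: m p q r h => // m IHm p q r h hm hb hh.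
have fN0 k : k`!%:R != 0 :> F by rewrite pnatr_eq0 -lt0n fact_gt0.
have [s0|s0] := posnP (p + q + r).
  move/eqP: s0; rewrite !addn_eq0 => /andP[/andP[/eqP p0 /eqP q0] /eqP r0].
  rewrite {}p0 {}q0 {}r0 !addn0 !expr0 !mulr1 in hm hb *.
  have -> : pairing_coef 0 0 0 = 1.
    by rewrite /pairing_coef !addn0 fact0 !mulr1 mul1r divff.
  have -> : h = (h@_0)%:MP.
    apply/mpolyP => u; rewrite mcoeffC; have [->|u0] := eqVneq u 0%MM.
      by rewrite mulr1.
    rewrite mulr0; apply/eqP; apply: contraNT u0 => /hb [d1 d2].
    by rewrite -mdeg_eq0 mdeg_degl_degr d1 d2.
  by rewrite mul1r -alg_mpolyC IZ I1 /ev_pole mevalZ meval1.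
have e : (p + (q + r) = q + (p + r))%N by rewrite addnCA.
have s1 : (0 < p + (q + r))%N by rewrite addnA.
apply: (mulfI (npos s1)); rewrite (functional_pairing_step hb hh e).
have nn : (n + (p + (q + r))).-1 = (n.-1 + p + q + r)%N.
  by case: n n_gt0 => // k _; rewrite addSn /= !addnA.
have fS (a b : nat) (x y : F) : (a.+1)`!%:R = a.+1%:R * a`!%:R :> F.
  by rewrite factS natrM.
have -> : (p + r)%:R * I (dpole h * (Wb ^+ (p + r).-1 * W ^+ (q + r))) =
    (p%:R * (n.-1 + p + q + r)%:R) * (pairing_coef p q r * ev_pole h).
  case: p hm hb hh {s0 s1 e nn} => [|p] hm hb hh.
    by rewrite (bideg0_dpole hb) !mul0r functional0 mulr0.
  rewrite addSn /= (IHm p q r) ?(bideg_dpole hb) ?lap_dpole//; last first.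
    exact: (bideg_dpole hb).
  rewrite (ev_pole_dpole hb) /pairing_coef !addSn !addnS !addSn !factS !natrM.
  move: (n.-1 + p + q + r)%N => N.
  by field; rewrite ?nat1r !fN0 ?pnatr_eq0.
have -> : (q + r)%:R * I (dpoleb h * (Wb ^+ (p + r) * W ^+ (q + r).-1)) =
    (q%:R * (n.-1 + p + q + r)%:R) * (pairing_coef p q r * ev_pole h).
  case: q hm hb hh {s0 s1 e nn} => [|q] hm hb hh.
    by rewrite (bideg0_dpoleb hb) !mul0r functional0 mulr0.
  rewrite addSn /= (IHm p q r) ?lap_dpoleb//; last 2 first.
  - by move: hm; rewrite addnS addSn.
  - exact: (bideg_dpoleb hb).
  rewrite (ev_pole_dpoleb hb) /pairing_coef !addnS !addSn !factS !natrM.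
  move: (n.-1 + p + q + r)%N => N.
  by field; rewrite ?nat1r !fN0 ?pnatr_eq0.
have -> : ((p + r) * (q + r))%:R * I (h * (Wb ^+ (p + r).-1 * W ^+ (q + r).-1)) =
    (r%:R * (n.-1 + p + q + r)%:R) * (pairing_coef p q r * ev_pole h).
  (* For r = 0 the lowered exponents fall below the bidegree of [h], so this term vanishes by
     [functional_pairing_low] instead of the induction hypothesis. *)
  case: r hm e {s0 s1 nn} => [|r] hm e.
    rewrite mul0r mul0r !addn0; case: p hb hm e => [|p] hb hm e.
      by rewrite !mul0n mul0r.
    case: q hb hm e => [|q] hb hm e; first by rewrite !muln0 mul0r.
    rewrite (functional_pairing_low hb hh) ?mulr0 //=.
    by rewrite !addSn addnC.
  rewrite !addnS /= (IHm p q r) //; last by move: hm; rewrite addnS.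
  rewrite /pairing_coef !addnS !factS !natrM.
  move: (n.-1 + p + q + r)%N => N.
  by field; rewrite ?nat1r !fN0 ?pnatr_eq0.
rewrite nn -!mulrDl !natrM !natrD; ring.
Qed.

End Functional.
End Algebra.
End SphereAlgebra.

(** * Coefficients of the zonal kernel *)

Section ZonalCoefficients.
Variable F : numFieldType.

Definition poch (x : F) (i : nat) : F := \prod_(k < i) (x + k%:R).

Lemma pochS x i : poch x i.+1 = poch x i * (x + i%:R).
Proof. by rewrite /poch big_ord_recr. Qed.

Lemma poch_oppn (p i : nat) : poch (- p%:R) i = (-1) ^+ i * (p ^_ i)%:R.
Proof.
elim: i => [|i IHi]; first by rewrite /poch big_ord0 ffactn0 mulr1.
rewrite pochS IHi ffactnSr natrM exprS mulN1r.
have [ip|pi] := leqP i p; first by rewrite natrB //; ring.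
by rewrite ffact_small // !mul0r !mulr0 mul0r.
Qed.

Lemma poch_nat (m k : nat) : poch m.+1%:R k * m`!%:R = (m + k)`!%:R.
Proof.
elim: k => [|k IHk]; first by rewrite /poch big_ord0 mul1r addn0.
rewrite pochS mulrAC IHk addnS factS natrM -natrD mulrC; congr (_%:R * _); lia.
Qed.

Variable n : nat.

Definition zonal_lead (p q : nat) : F :=
  poch (n%:R - 1) (p + q) / (poch (n%:R - 1) p * poch (n%:R - 1) q).

Definition zonal_c (p q i : nat) : F := zonal_lead p q *
  (poch (- p%:R) i * poch (- q%:R) i
   / (poch (- (n%:R - 2) - p%:R - q%:R) i * i`!%:R)).

(** Two free variables replace (xi | eta) and its conjugate, so that statements about the profile
    are polynomial identities. *)
Definition zonal_profile (p q : nat) (x y : F) : F :=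
  \sum_(i < (minn p q).+1) zonal_c p q i * x ^+ (p - i) * y ^+ (q - i).

(** A Chu-Vandermonde evaluation, responsible for the value 1 of the kernel at its pole. Pascal's
    rule on the first binomial turns the sum for p + 1 into a sum of differences of the second one;
    Pascal's rule again turns these differences into the sum for p. *)
Lemma alternating_binomial_sum (m p q : nat) :
  \sum_(i < p.+1) (-1) ^+ i * ('C(p, i) * 'C(m + p + q - i, m + p))%:R
  = 'C(m + q, m)%:R :> F.
Proof.
elim: p q => [|p IHp] q; first by rewrite big_ord1 expr0 !mul1r subn0 bin0 mul1n !addn0.
rewrite -IHp.
pose a i : F := 'C(m + p.+1 + q - i, m + p.+1)%:R.
transitivity (\sum_(i < p.+1) (-1) ^+ i * 'C(p, i)%:R * a i
   - \sum_(i < p.+1) (-1) ^+ i * 'C(p, i)%:R * a i.+1).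
  rewrite big_ord_recl /=.
  under eq_bigr do rewrite /bump /= add1n binS natrM natrD mulrDl mulrDr.
  rewrite big_split /= addrA; congr (_ + _).
    rewrite [in RHS]big_ord_recl [X in _ + X = _]big_ord_recr /= (bin_small (ltnSn p)) mul0r mulr0 addr0.
    rewrite expr0 !bin0 !mul1r mul1n; congr (_ + _).
    by apply: eq_bigr => i _; rewrite /bump /= add1n mulrA.
  by rewrite -sumrN; apply: eq_bigr => i _; rewrite exprS mulrA mulN1r !mulNr.
rewrite -sumrB; apply: eq_bigr => i _; rewrite -mulrBr natrM mulrA; congr (_ * _).
rewrite /a; have ip : (i <= p)%N by rewrite -ltnS.
have -> : (m + p.+1 + q - i = (m + p + q - i).+1)%N by lia.
have -> : (m + p.+1 + q - i.+1 = (m + p + q - i))%N by lia.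
by rewrite addnS binS natrD addrC addKr.
Qed.

Hypothesis n_gt1 : (1 < n)%N.

Let natn1 : n%:R - 1 = n.-2.+1%:R :> F.
Proof. by case: n n_gt1 => [|[|k]] // _ /=; rewrite -(natr1 k.+1) addrK. Qed.
Let natn2 p q : - (n%:R - 2) - p%:R - q%:R = - (n.-2 + p + q)%:R :> F.
Proof.
case: n n_gt1 => [|[|k]] //= _.
rewrite !natrD -addn2 natrD; ring.
Qed.
Let fN0 k : k`!%:R != 0 :> F.
Proof. by rewrite pnatr_eq0 -lt0n fact_gt0. Qed.

Lemma zonal_leadE p q : zonal_lead p q =
  ((n.-2 + p + q)`! * n.-2`!)%:R / ((n.-2 + p)`! * (n.-2 + q)`!)%:R.
Proof.
have := poch_nat n.-2 (p + q); rewrite addnA => E.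
rewrite /zonal_lead natn1 !natrM -E -(poch_nat n.-2 p) -(poch_nat n.-2 q).
have P k : poch n.-2.+1%:R k != 0.
  by apply: contraNneq (fN0 (n.-2 + k)) => e; rewrite -poch_nat e mul0r.
by field; rewrite !fN0 !P.
Qed.

Lemma zonal_lead_gt0 p q : 0 < zonal_lead p q.
Proof. by rewrite zonal_leadE divr_gt0 // ltr0n muln_gt0 !fact_gt0. Qed.

Lemma zonal_c0 p q : zonal_c p q 0 = zonal_lead p q.
Proof. by rewrite /zonal_c /poch !big_ord0 fact0 !mulr1 divr1 mulr1. Qed.

(** Each of the three Pochhammer symbols at a negative integer yields a sign (-1)^i; one sign is
    left, which makes the sum over i an alternating binomial sum. *)
Lemma zonal_cE p q i : (i <= p)%N -> (i <= q)%N -> zonal_c p q i =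
  (-1) ^+ i * ('C(p, i) * 'C(n.-2 + p + q - i, n.-2 + p))%:R
  / 'C(n.-2 + q, n.-2)%:R.
Proof.
move=> ip iq; rewrite /zonal_c natn2 !poch_oppn zonal_leadE.
set m := n.-2.
have b1 := bin_ffact p i.
have h1 : 'C(p, i)%:R = (p ^_ i)%:R / i`!%:R :> F by rewrite -b1 natrM mulfK.
have h2 : 'C(m + q, m)%:R = (m + q)`!%:R / (m`!%:R * q`!%:R) :> F.
  by rewrite -(bin_fact (leq_addr q m)) addKn !natrM mulfK // mulf_neq0.
have l3 : (m + p <= m + p + q - i)%N by lia.
have h3 : 'C(m + p + q - i, m + p)%:R
    = (m + p + q - i)`!%:R / ((m + p)`!%:R * (q - i)`!%:R) :> F.
  rewrite -(bin_fact l3); have -> : (m + p + q - i - (m + p) = q - i)%N by lia.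
  by rewrite !natrM mulfK // mulf_neq0.
have l4 : (i <= m + p + q)%N by lia.
have h4 : (q ^_ i)%:R = q`!%:R / (q - i)`!%:R :> F.
  by rewrite -(ffact_fact iq) natrM mulfK.
have h5 : ((m + p + q) ^_ i)%:R = (m + p + q)`!%:R / (m + p + q - i)`!%:R :> F.
  by rewrite -(ffact_fact l4) natrM mulfK.
rewrite !natrM h1 h2 h3 h4 h5.
have s2 : (-1) ^+ i * (-1) ^+ i = 1 :> F by rewrite -expr2 sqrr_sign.
have s0 : (-1) ^+ i != 0 :> F by rewrite signr_eq0.
by field; rewrite !fN0 s0.
Qed.

Lemma zonal_profile11 p q : zonal_profile p q 1 1 = 1.
Proof.
transitivity (\sum_(i < (minn p q).+1) zonal_c p q i).
  by apply: eq_bigr => i _; rewrite !expr1n !mulr1.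
have b0 : 'C(n.-2 + q, n.-2)%:R != 0 :> F.
  by rewrite pnatr_eq0 -lt0n bin_gt0 leq_addr.
transitivity ((\sum_(i < p.+1) (-1) ^+ i
    * ('C(p, i) * 'C(n.-2 + p + q - i, n.-2 + p))%:R)
  / 'C(n.-2 + q, n.-2)%:R : F); last first.
  by rewrite alternating_binomial_sum divff.
rewrite mulr_suml (big_ord_widen p.+1 (fun i => zonal_c p q i)); last by rewrite ltnS geq_minl.
rewrite big_mkcond /=; apply: eq_bigr => i _.
rewrite ltnS leq_min -(ltnS i p) ltn_ord /=.
case: leqP => iq; first by rewrite zonal_cE // -ltnS.
(* Extending the range from min(p, q) to p is harmless: the second binomial is 0 for i > q. *)
rewrite [X in (_ * X)%N]bin_small ?muln0 ?mulr0 ?mul0r //.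
have := ltn_ord i; lia.
Qed.

(** The two-term recursion that harmonicity imposes on the coefficients of |z|^(2i) conj(w)^(q-i)
    w^(p-i); it drives the cancellation in [lap_zonal_pol]. *)
Lemma zonal_c_rec p q i : (i < p)%N -> (i < q)%N ->
  zonal_c p q i.+1 * (i.+1 * (n + (p - i.+1 + (q - i.+1)) + i))%:R
  = - (zonal_c p q i * ((q - i) * (p - i))%:R).
Proof.
move=> ip iq; rewrite /zonal_c natn2 !poch_oppn !ffactnSr !factS exprS !natrM.
have e : (n + (p - i.+1 + (q - i.+1)) + i = n.-2 + p + q - i)%N by lia.
rewrite e; have l1 : ((n.-2 + p + q) ^_ i)%N != 0%N.
  by rewrite -lt0n ffact_gt0; lia.
have l2 : (n.-2 + p + q - i)%N != 0%N by lia.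
have s0 : (-1) ^+ i != 0 :> F by rewrite signr_eq0.
move: l1 l2; set A := ((n.-2 + p + q) ^_ i)%N; set B := (n.-2 + p + q - i)%N.
rewrite -(pnatr_eq0 F) => l1; rewrite -(pnatr_eq0 F) => l2.
have i0 : i.+1%:R != 0 :> F by rewrite pnatr_eq0.
move: i0; move: (i.+1%:R : F) => J J0.
move: (zonal_lead p q) (p ^_ i)%N (q ^_ i)%N (p - i)%N (q - i)%N => *.
by field; rewrite s0 fN0 l1 l2 J0.
Qed.

(** The profiles are triangular with respect to the monomials, with nonzero leading coefficient
    [zonal_lead], so the system can be inverted by induction on min(j, k). Only existence of the
    coefficients is recorded; integration identifies them later, in [monomial_zonal]. *)
Lemma monomial_zonal_span (j k : nat) : exists b : nat -> F,
  forall x y : F, x ^+ j * y ^+ k =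
    \sum_(i < (minn j k).+1) b i * zonal_profile (j - i) (k - i) x y.
Proof.
have [s] := ubnP (minn j k); elim: s j k => // s IHs j k hs.
set M := minn j k.
pose V (g : F -> F -> F) := exists b : nat -> F, forall x y : F, g x y =
    \sum_(i < M.+1) b i * zonal_profile (j - i) (k - i) x y.
have VD g1 g2 : V g1 -> V g2 -> V (fun x y => g1 x y + g2 x y).
  move=> [b1 h1] [b2 h2]; exists (fun i => b1 i + b2 i) => x y.
  by rewrite h1 h2 -big_split /=; apply: eq_bigr => i _; rewrite mulrDl.
have VZ c g : V g -> V (fun x y => c * g x y).
  move=> [b h]; exists (fun i => c * b i) => x y.
  by rewrite h mulr_sumr; apply: eq_bigr => i _; rewrite mulrA.
have V0 : V (fun _ _ => 0).
  by exists (fun=> 0) => x y; rewrite big1 // => i _; rewrite mul0r.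
have Vsum N (g : nat -> F -> F -> F) : (forall i, (i < N)%N -> V (g i)) ->
    V (fun x y => \sum_(i < N) g i x y).
  elim: N => [|N IHN] hg.
    by case: V0 => b hb; exists b => x y; rewrite big_ord0 -hb.
  case: (VD _ _ (IHN (fun i iN => hg i (ltnW iN))) (hg N (ltnSn N))) => b hb.
  by exists b => x y; rewrite big_ord_recr /= -hb.
have Vp : V (zonal_profile j k).
  exists (fun i => (i == 0%N)%:R) => x y.
  rewrite big_ord_recl /= !subn0 mul1r big1 ?addr0 // => i _.
  by rewrite /bump /= mul0r.
have Vlow i : (i < M)%N -> V (fun x y => zonal_c j k i.+1 * x ^+ (j - i.+1) * y ^+ (k - i.+1)).
  move=> iM; have : (minn (j - i.+1) (k - i.+1) < s)%N by lia.
  move=> /IHs[b hb].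
  have : V (fun x y => zonal_c j k i.+1 * (x ^+ (j - i.+1) * y ^+ (k - i.+1))).
    (* Profiles for the lower monomial occur among those for (j, k), shifted by i + 1 places. *)
    apply: VZ; exists (fun l => if (i < l)%N then b (l - i.+1)%N else 0) => x y.
    rewrite hb -(big_mkord xpredT (fun l => b l * zonal_profile (j - i.+1 - l) (k - i.+1 - l) x y)).
    pose f l := (if (i < l)%N then b (l - i.+1)%N else 0)
      * zonal_profile (j - l) (k - l) x y.
    rewrite -(big_mkord xpredT f).
    rewrite [RHS](big_cat_nat (n := i.+1)) //=; last by lia.
    rewrite [X in _ = X + _]big_nat_cond [X in _ = X + _]big1 => [|l]; last first.
      by rewrite andbT leq0n /= ltnS /f ltnNge => -> /=; rewrite mul0r.
    rewrite add0r (_ : \sum_(i.+1 <= l < M.+1) f l = \sum_(0 + i.+1 <= l < M.+1) f l) // big_addn.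
    have -> : ((minn (j - i.+1) (k - i.+1)).+1 = M.+1 - i.+1)%N by lia.
    by apply: eq_bigr => l _; rewrite /f ltn_addl // addnK !subnDA ![(_ - i.+1 - l)%N]subnAC.
  by case=> b' hb'; exists b' => x y; rewrite -hb' mulrA.
have L0 : zonal_lead j k != 0 by rewrite gt_eqF // zonal_lead_gt0.
(* The definition of the profile, solved for its leading monomial. *)
have : V (fun x y => (zonal_lead j k)^-1 * (zonal_profile j k x y + -1 *
   \sum_(i < M) zonal_c j k i.+1 * x ^+ (j - i.+1) * y ^+ (k - i.+1))).
  apply/VZ/(VD _ _ Vp)/VZ.
  exact: (Vsum M (fun i x y => zonal_c j k i.+1 * x ^+ (j - i.+1) * y ^+ (k - i.+1)) Vlow).
case=> b hb; exists b => x y; rewrite -hb /zonal_profile big_ord_recl /= zonal_c0 !subn0.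
rewrite mulN1r /bump /= addrK -mulrA mulKf //.
Qed.

End ZonalCoefficients.

(** * Zonal polynomials *)

Module ZonalPolynomials.
Import mpoly SphereAlgebra.

Lemma poly_closure (F : numFieldType) (k : nat) (K : {mpoly F[k]} -> Prop) :
  (forall c, K c%:MP) -> (forall i, K 'X_i) ->
  (forall P Q, K P -> K Q -> K (P + Q)) ->
  (forall P Q, K P -> K Q -> K (P * Q)) -> forall P, K P.
Proof.
move=> KC KX KD KM.
have KXm m : K 'X_[m].
  rewrite mpolyXE_id; elim/big_ind: _ => //; first by rewrite -mpolyC1.
  move=> i _; elim: (m i) => [|d IHd]; first by rewrite expr0 -mpolyC1.
  by rewrite exprS; exact: KM.
elim/mpolyind => [|c m P _ _ KP]; first by rewrite -mpolyC0.
by apply: KD => //; rewrite -mul_mpolyC; exact: KM.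
Qed.

Section ZonalPol.
Variables (F : numFieldType) (n : nat) (eta etab : 'I_n -> F).
Hypothesis n_gt1 : (1 < n)%N.
Hypothesis eta1 : \sum_(i < n) eta i * etab i = 1.
Local Notation Pol := {mpoly F[n + n]}.
Local Notation zv j := ('X_(lshift n j) : Pol).
Local Notation zb j := ('X_(rshift n j) : Pol).
Local Notation W := (pairing_l etab).
Local Notation Wb := (pairing_r eta).

Definition normsq : Pol := \sum_(a < n) zv a * zb a.

Lemma bideg_normsq : bideg 1 1 normsq.
Proof.
apply: bideg_sum => i _.
exact: (bidegM (bidegXl (j := i)) (bidegXr (j := i))).
Qed.

Lemma dz_normsq j : dz j normsq = zb j.
Proof.
rewrite /normsq dz_sum (bigD1 j) //= dzM dz_zv dz_zb eqxx mulr0 addr0 mul1r.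
by rewrite big1 ?addr0 // => i ij; rewrite dzM dz_zv dz_zb (negbTE ij) mulr0 mul0r addr0.
Qed.

Lemma dw_normsq j : dw j normsq = zv j.
Proof.
rewrite /normsq dw_sum (bigD1 j) //= dwM dw_zv dw_zb eqxx mul0r add0r mulr1.
by rewrite big1 ?addr0 // => i ij; rewrite dwM dw_zv dw_zb (negbTE ij) mulr0 mul0r addr0.
Qed.

(** The Laplacian of |z|^2 is n, and the cross terms are the two Euler operators, which contribute p
    and q. *)
Lemma lap_normsqM p q (G : Pol) : bideg p q G ->
  lap (normsq * G) = normsq * lap G + (n + (p + q))%:R *: G.
Proof.
move=> hG; rewrite lapM.
have -> : lap normsq = n%:R%:MP.
  rewrite /lap; under eq_bigr do rewrite dw_normsq dz_zv eqxx.
  by rewrite sumr_const card_ord mpolyC_nat.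
under eq_bigr do rewrite dz_normsq dw_normsq.
rewrite big_split /= (euler_l hG) (euler_r hG) -!mul_mpolyC !natrD !mpolyCD; ring.
Qed.

(** The factor is the sum of n + p + q + 2 l over l < i, from i applications of [lap_normsqM]. *)
Lemma lap_normsqXM p q (G : Pol) i : bideg p q G ->
  lap (normsq ^+ i * G) = normsq ^+ i * lap G
    + (i * (n + (p + q) + i.-1))%:R *: (normsq ^+ i.-1 * G).
Proof.
move=> hG; elim: i => [|i IHi]; first by rewrite !expr0 !mul1r mul0n scale0r addr0.
have hb : bideg (1 * i + p) (1 * i + q) (normsq ^+ i * G).
  by apply: bidegM => //; apply: bidegXn; exact: bideg_normsq.
rewrite exprS -[in LHS]mulrA (lap_normsqM hb) IHi mulrDr mulrA -exprS -addrA.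
congr (_ + _); case: i {IHi hb} => [|i] /=.
  by rewrite mul0n scale0r mulr0 add0r expr0 mul1r; congr (_%:R *: _); lia.
rewrite -scalerAr mulrA -exprS -scalerDl -natrD; congr (_%:R *: _); nia.
Qed.

(** The zonal kernel made bihomogeneous: powers of |z|^2, equal to 1 on the sphere, compensate the
    missing degrees. *)
Definition zonal_pol p q : Pol := \sum_(i < (minn p q).+1)
  zonal_c F n p q i *: (normsq ^+ i * (Wb ^+ (q - i) * W ^+ (p - i))).

Lemma bideg_pairing a b : bideg a b (Wb ^+ b * W ^+ a).
Proof.
have := bidegM (bidegXn (k := b) (bidegWb (eta := eta))) (bidegXn (k := a) (bidegW (etab := etab))).
by rewrite !mul0n !mul1n addn0 add0n.
Qed.

Lemma bideg_zonal_pol p q : bideg p q (zonal_pol p q).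
Proof.
apply: bideg_sum => i _; apply: bidegZ.
have := bidegM (bidegXn (k := i) bideg_normsq) (@bideg_pairing (p - i) (q - i)).
have il : (i <= minn p q)%N by rewrite -ltnS.
by rewrite !mul1n !subnKC //; lia.
Qed.

(** Differentiating the pairing monomial in the term i gives the same monomial as differentiating
    |z|^2 in the term i + 1; [zonal_c_rec] says that the two cancel. *)
Lemma lap_zonal_pol p q : lap (zonal_pol p q) = 0.
Proof.
rewrite /zonal_pol lap_sum.
set M := minn p q.
pose G a b : Pol := Wb ^+ b * W ^+ a.
transitivity (\sum_(i < M.+1) zonal_c F n p q i *: (((q - i) * (p - i))%:R *:
      (normsq ^+ i * G (p - i).-1 (q - i).-1))
   + \sum_(i < M.+1) zonal_c F n p q i *: ((i * (n + (p - i + (q - i)) + i.-1))%:R *: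
      (normsq ^+ i.-1 * G (p - i)%N (q - i)%N))).
  rewrite -big_split; apply: eq_bigr => i _ /=.
  rewrite lapZ (lap_normsqXM _ (@bideg_pairing (p - i) (q - i))).
  by rewrite (lap_pairing eta1) scalerDr -!scalerAr.
rewrite big_ord_recr /= [X in _ + X]big_ord_recl /= mul0n scale0r scaler0 add0r.
(* The last term has no partner, but one of its exponents is 0 and so is its factor. *)
have -> : ((q - M) * (p - M) = 0)%N by rewrite /M; nia.
rewrite scale0r scaler0 addr0 -big_split /= big1 // => i _.
have iM := ltn_ord i.
rewrite /bump /= add1n !scalerA zonal_c_rec //; [|lia|lia].
by rewrite -!subnS scaleNr addrN.
Qed.

Lemma meval_pairing_l (v : 'I_(n + n) -> F) :
  W.@[v] = \sum_(i < n) etab i * v (lshift n i).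
Proof. by rewrite /pairing_l meval_sum; apply: eq_bigr => i _; rewrite mevalZ mevalXU. Qed.

Lemma meval_pairing_r (v : 'I_(n + n) -> F) :
  Wb.@[v] = \sum_(i < n) eta i * v (rshift n i).
Proof. by rewrite /pairing_r meval_sum; apply: eq_bigr => i _; rewrite mevalZ mevalXU. Qed.

Lemma meval_normsq (v : 'I_(n + n) -> F) :
  normsq.@[v] = \sum_(i < n) v (lshift n i) * v (rshift n i).
Proof. by rewrite /normsq meval_sum; apply: eq_bigr => i _; rewrite mevalM !mevalXU. Qed.

Lemma mevalXn (v : 'I_(n + n) -> F) (P : Pol) k : (P ^+ k).@[v] = P.@[v] ^+ k.
Proof.
by elim: k => [|k IHk]; rewrite ?meval1 // !exprS mevalM IHk.
Qed.

Lemma meval_zonal_pol (v : 'I_(n + n) -> F) p q : normsq.@[v] = 1 ->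
  (zonal_pol p q).@[v] = zonal_profile n p q W.@[v] Wb.@[v].
Proof.
move=> h; rewrite /zonal_pol meval_sum; apply: eq_bigr => i _.
by rewrite mevalZ !mevalM !mevalXn h expr1n mul1r (mulrC (_ ^+ (q - i))) mulrA.
Qed.

Lemma ev_pole_zonal_pol p q : ev_pole eta etab (zonal_pol p q) = 1.
Proof.
rewrite /ev_pole meval_zonal_pol ?meval_normsq ?meval_pairing_l ?meval_pairing_r.
  rewrite -[RHS](zonal_profile11 F n_gt1 p q); congr (zonal_profile _ _ _ _ _).
    by rewrite -eta1; apply: eq_bigr => i _; rewrite split_l mulrC.
  by rewrite -eta1; apply: eq_bigr => i _; rewrite split_r.
by rewrite -eta1; apply: eq_bigr => i _; rewrite split_l split_r.
Qed.

(** The constant kappa of the reproducing property; [dimH_norm] shows that it is the inverse of the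
    dimension. *)
Definition zonal_norm p q : F := zonal_c F n p q 0 * pairing_coef F n p q 0.

Lemma zonal_norm_gt0 p q : 0 < zonal_norm p q.
Proof.
rewrite mulr_gt0 // ?zonal_c0 ?zonal_lead_gt0 // /pairing_coef.
by rewrite !(mulr_gt0, invr_gt0) ?ltr0n ?fact_gt0.
Qed.

Section Functional.
Variable I : Pol -> F.
Hypothesis ID : forall P Q, I (P + Q) = I P + I Q.
Hypothesis IZ : forall c P, I (c *: P) = c * I P.
Hypothesis IE : forall a b P, I (zv a * dz b P - zb b * dw a P) = 0.
Hypothesis IS : forall P, I (normsq * P) = I P.
Hypothesis I1 : I 1 = 1.

Let n_gt0 : (0 < n)%N := ltnW n_gt1.

(** The indices are swapped because [zonal_pol q p] plays the conjugate of the kernel of bidegree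
    (p, q). Under [I] the powers of |z|^2 disappear, and the terms with i > 0 then have too few
    pairing factors to contribute. *)
Lemma zonal_reproducing p q (h : Pol) : bideg p q h -> lap h = 0 ->
  I (h * zonal_pol q p) = zonal_norm p q * ev_pole eta etab h.
Proof.
move=> hb hh; rewrite /zonal_pol mulr_sumr (functional_sum ID IZ).
have drop i (G : Pol) : I (h * (normsq ^+ i * G)) = I (h * G).
  elim: i => [|i IHi]; first by rewrite mul1r.
  by rewrite exprS -mulrA mulrCA IS.
under eq_bigr do rewrite -scalerAr IZ drop.
rewrite big_ord_recl /= !subn0 big1 => [|i _].
  have := functional_pairing ID IZ IE IS n_gt0 eta1 I1 0 hb hh.
  rewrite addr0 !addn0 => ->; rewrite /zonal_norm mulrA; congr (_ * _ * _).
  by rewrite !zonal_c0 /zonal_lead addnC (mulrC (poch _ q)).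
have := ltn_ord i; rewrite /bump /= add1n => iM.
by rewrite (functional_pairing_low ID IZ IE IS n_gt0 eta1 hb hh) ?mulr0 //; lia.
Qed.

(** If the product is unbalanced, its integral vanishes. Otherwise p + q' = q + p', and then
    distinct pairs must differ in the first index, as [functional_harmonic_ortho] requires. *)
Lemma zonal_ortho p q p' q' (h : Pol) : bideg p q h -> lap h = 0 ->
  (p, q) != (p', q') -> I (h * zonal_pol q' p') = 0.
Proof.
move=> hb hh ne.
have hz := @bideg_zonal_pol q' p'.
have [e|ne'] := eqVneq (p + q')%N (q + p')%N; last first.
  exact: (functional_unbalanced ID IZ IE (bidegM hb hz)).
apply: (functional_harmonic_ortho ID IZ IE IS n_gt0 hb hz hh _ (erefl _) (esym e)).
  exact: lap_zonal_pol.
by apply: contraNneq ne => ep; rewrite -ep in e *; apply/eqP; congr pair; lia.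
Qed.

Lemma zonal_monomial p q r :
  I (zonal_pol q p * (Wb ^+ (q + r) * W ^+ (p + r))) = pairing_coef F n q p r.
Proof.
rewrite (functional_pairing ID IZ IE IS n_gt0 eta1 I1 _ (@bideg_zonal_pol q p)).
  by rewrite ev_pole_zonal_pol mulr1.
exact: lap_zonal_pol.
Qed.

End Functional.
End ZonalPol.

(** * Bihomogeneity of values and of coefficients *)

Section Components.
Variables (R : rcfType) (n : nat).
Local Notation C := R[i].
Local Notation Pol := {mpoly C[n + n]}.
Local Notation ezz := (@BihomPoly.eval_zzbar R n).

Lemma poly_roots_eq0 (F : fieldType) (P : {poly F}) (u : nat -> F) :
  injective u -> (forall k, root P (u k)) -> P = 0.
Proof.
move=> ui hP; apply: (@roots_geq_poly_eq0 _ _ [seq u k | k <- iota 0 (size P)]).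
- by apply/allP => _ /mapP[k _ ->].
- by rewrite map_inj_uniq // iota_uniq.
- by rewrite size_map size_iota.
Qed.

(* For l = t * u with t natural and |u| = 1, the coefficient of each power of t is,
   up to a power of u, a polynomial in u ^+ 2; the points u k provide infinitely
   many values of u. *)
Lemma conj_poly_eq0 (N : nat) (c : nat -> nat -> C) :
  (forall l : C, \sum_(a < N) \sum_(b < N) c a b * (l ^+ a * l^*%C ^+ b) = 0) ->
  forall a b, (a < N)%N -> (b < N)%N -> c a b = 0.
Proof.
move=> hc a0 b0 ha hb.
pose d (k : nat) : C := 1 - k%:R * 'i%C.
have conjd (k : nat) : (d k)^*%C = 1 + k%:R * 'i%C.
  by rewrite /d rmorphB rmorph1 rmorphM rmorph_nat [X in _ - _ * X]conjci mulrN opprK.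
have ii : 'i%C * 'i%C = -1 :> C by rewrite -expr2 sqr_i.
have d0 k : d k != 0.
  apply/eqP => e; have := congr1 (fun x => x * (1 + k%:R * 'i%C)) e.
  rewrite mul0r /d => /eqP; have -> : (1 - k%:R * 'i%C) * (1 + k%:R * 'i%C) = 1 - k%:R * k%:R * ('i%C * 'i%C) :> C by ring.
  by rewrite ii mulrN1 opprK -natrM nat1r pnatr_eq0.
pose u k := (d k)^*%C / d k.
have d0' k : (d k)^*%C != 0 by rewrite fmorph_eq0.
have uu k : (u k)^*%C * u k = 1.
  by rewrite /u rmorphM fmorphV /= conjcK mulrA divfK ?divff.
have u0 k : u k != 0 by rewrite /u mulf_neq0 // invr_neq0.
have u_inj : injective u.
  move=> k l; rewrite /u => /eqP; rewrite eqr_div // !conjd /d => /eqP e.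
  have : (k%:R - l%:R) * ('i%C *+ 2) = 0 :> C.
    have -> : (k%:R - l%:R) * ('i%C *+ 2) =
      (1 + k%:R * 'i%C) * (1 - l%:R * 'i%C) - (1 + l%:R * 'i%C) * (1 - k%:R * 'i%C) :> C by ring.
    by rewrite e subrr.
  move/eqP; rewrite mulf_eq0 subr_eq0 eqr_nat => /orP[/eqP //|].
  rewrite -mulr_natr mulf_eq0 pnatr_eq0 orbF => /eqP i0.
  by move: ii; rewrite i0 mul0r => /eqP; rewrite eq_sym oppr_eq0 oner_eq0.
pose T (s : nat) : {poly C} :=
  \sum_(a < N) \sum_(b < N | (a + b)%N == s) c a b *: 'X^(2 * a).
have T0 s : T s = 0.
  apply: (poly_roots_eq0 u_inj) => k.
  pose Q : {poly C} :=
    \sum_(a < N) \sum_(b < N) (c a b * ((u k) ^+ a * (u k)^*%C ^+ b)) *: 'X^(a + b).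
  have : Q = 0.
    apply: (@poly_roots_eq0 _ Q (fun t : nat => t%:R)) => [t t' /eqP|t].
      by rewrite eqr_nat => /eqP.
    have ct : (t%:R * u k)^*%C = t%:R * (u k)^*%C by rewrite rmorphM rmorph_nat.
    apply/eqP; rewrite -[RHS](hc (t%:R * u k)) ct /Q horner_sum; apply: eq_bigr => a _.
    rewrite horner_sum; apply: eq_bigr => b _.
    by rewrite hornerZ hornerXn !exprMn exprD; ring.
  move/(congr1 (fun Q : {poly C} => Q`_s * u k ^+ s)); rewrite coef0 mul0r => Qs.
  apply/eqP; rewrite -[RHS]Qs /T /Q horner_sum coef_sum mulr_suml; apply: eq_bigr => a _.
  rewrite horner_sum coef_sum mulr_suml big_mkcond /=; apply: eq_bigr => b _.
  rewrite coefZ coefXn [s == _]eq_sym; case: eqP => [<-|_]; last by rewrite mulr0 mul0r.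
  rewrite hornerZ hornerXn mulr1 -!mulrA; congr (_ * _).
  by rewrite exprD [X in _ = _ * X]mulrCA -exprMn uu expr1n mulr1 -exprD addnn mul2n.
have := congr1 (fun P : {poly C} => P`_(2 * a0)) (T0 (a0 + b0)%N).
rewrite coef0 /T coef_sum (bigD1 (Ordinal ha)) //= coef_sum (bigD1 (Ordinal hb)) //=.
rewrite coefZ coefXn eqxx mulr1 big1 => [|b /andP[/eqP /addnI e /eqP ne]]; last first.
  by case: ne; apply: val_inj.
rewrite addr0 big1 ?addr0 // => a ane; rewrite coef_sum big1 // => b _.
rewrite coefZ coefXn eqn_mul2l /= eq_sym; case: eqP => [e|]; last by rewrite mulr0.
by case/eqP: ane; apply: val_inj.
Qed.

Lemma ezz_mpolyE (P : Pol) z : ezz P z = \sum_(m <- msupp P) P@_m * ezz 'X_[m] z.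
Proof.
rewrite /BihomPoly.eval_zzbar {1}(mpolyE P) meval_sum.
by apply: eq_bigr => m _; rewrite mevalZ.
Qed.

Lemma ezz_monomialZ m (l : C) z :
  ezz 'X_[m] (l *: z) = l ^+ degl m * l^*%C ^+ degr m * ezz 'X_[m] z.
Proof.
rewrite /BihomPoly.eval_zzbar !mevalX !big_split_ord /= mulrACA.
congr (_ * _); rewrite -prodrXr -big_split /=; apply: eq_bigr => j _.
  by rewrite split_l mxE exprMn.
by rewrite split_r mxE rmorphM exprMn.
Qed.

Definition component (p q : nat) (P : Pol) : Pol :=
  \sum_(m <- msupp P | (degl m == p) && (degr m == q)) P@_m *: 'X_[m].

Lemma mcoeff_component p q P m :
  (component p q P)@_m = if (degl m == p) && (degr m == q) then P@_m else 0.
Proof.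
rewrite /component raddf_sum /=.
under eq_bigr do rewrite mcoeffZ mcoeffX.
have [mP|mP] := boolP (m \in msupp P); last first.
  rewrite (memN_msupp_eq0 mP) if_same big1_seq // => m' /andP[_ m'P].
  by case: eqP mP => [<-|]; [rewrite m'P|rewrite mulr0].
rewrite big_mkcond (bigD1_seq m) //= eqxx mulr1 big1 ?addr0 // => m' ne.
by rewrite (negbTE ne) mulr0 if_same.
Qed.

(** For fixed z both sides of the bihomogeneity condition are polynomials in l and its conjugate;
    [conj_poly_eq0] compares the coefficients at l^p conj(l)^q. *)
Lemma eval_zzbar_component p q (P : Pol) : BihomPoly.bihomogeneous p q P ->
  forall z, ezz (component p q P) z = ezz P z.
Proof.
move=> hP z.
(* [N] must exceed p and q as well, since that bidegree need not occur in [P]. *)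
pose N := (maxn (msize P) (maxn p q)).+1.
pose c a b := ezz (component a b P) z - (if (a == p) && (b == q) then ezz P z else 0).
have evC a b : ezz (component a b P) z =
    \sum_(m <- msupp P | (degl m == a) && (degr m == b)) P@_m * ezz 'X_[m] z.
  by rewrite /component /BihomPoly.eval_zzbar meval_sum; apply: eq_bigr => m _; rewrite mevalZ.
have := @conj_poly_eq0 N c _ p q; rewrite /c !eqxx /= => h.
apply/eqP; rewrite -subr_eq0; apply/eqP/h; last 2 first.
- by rewrite ltnS !leq_max leqnn orbT.
- by rewrite ltnS !leq_max leqnn !orbT.
move=> l.
under eq_bigr do under eq_bigr do rewrite mulrBl.
under eq_bigr do rewrite sumrB.
rewrite sumrB; apply/eqP; rewrite subr_eq0; apply/eqP.
have pN : (p < N)%N by rewrite ltnS !leq_max leqnn orbT.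
have qN : (q < N)%N by rewrite ltnS !leq_max leqnn !orbT.
rewrite [RHS](bigD1 (Ordinal pN)) //= [X in _ = X + _](bigD1 (Ordinal qN)) //= !eqxx /=.
rewrite [X in _ = _ + X + _]big1 ?addr0; last first.
  by move=> b ne; rewrite -[q]/(val (Ordinal qN)) val_eqE (negbTE ne) mul0r.
rewrite [X in _ = _ + X]big1 ?addr0; last first.
  move=> a ne; rewrite big1 // => b _.
  by rewrite -[p]/(val (Ordinal pN)) val_eqE (negbTE ne) mul0r.
rewrite mulrC -hP ezz_mpolyE.
transitivity (\sum_(m <- msupp P) \sum_(a < N) \sum_(b < N)
   (if (degl m == a) && (degr m == b) then P@_m * ezz 'X_[m] z * (l ^+ a * l^*%C ^+ b) else 0)).
  rewrite [RHS]exchange_big /=; apply: eq_bigr => a _; rewrite [RHS]exchange_big /=; apply: eq_bigr => b _.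
  by rewrite evC mulr_suml -big_mkcond.
apply: eq_big_seq => m mP; rewrite ezz_monomialZ.
have dm : (degl m + degr m < N)%N.
  by rewrite -mdeg_degl_degr ltnS leq_max (ltnW (msize_mdeg_lt mP)).
have al : (degl m < N)%N by rewrite (leq_ltn_trans _ dm) ?leq_addr.
have bl : (degr m < N)%N by rewrite (leq_ltn_trans _ dm) ?leq_addl.
rewrite (bigD1 (Ordinal al)) //= (bigD1 (Ordinal bl)) //= !eqxx /=.
rewrite [X in _ + X + _]big1 ?addr0; last first.
  by move=> b ne; rewrite -[degr m]/(val (Ordinal bl)) val_eqE eq_sym (negbTE ne).
rewrite big1 ?addr0; last first.
  move=> a ne; rewrite big1 // => b _.
  by rewrite -[degl m]/(val (Ordinal al)) val_eqE eq_sym (negbTE ne).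
by rewrite -mulrA; congr (_ * _); rewrite mulrC.
Qed.

(** The Laplacian lowers both degrees by exactly one, so a coefficient of the left side is either
    the corresponding coefficient of [lap P] or a sum of zeros. *)
Lemma lap_component p q (P : Pol) : lap P = 0 -> lap (component p q P) = 0.
Proof.
move=> hP; apply/mpolyP => m; rewrite mcoeff0.
have lapE (Q : Pol) : (lap Q)@_m = \sum_(j < n)
    Q@_(m + U_(lshift n j) + U_(rshift n j)) *+
      (((m + U_(lshift n j))%MM (rshift n j)).+1 * (m (lshift n j)).+1).
  rewrite /lap raddf_sum /=; apply: eq_bigr => j _.
  by rewrite /dz /dw !mcoeff_mderiv mulrnA.
rewrite lapE; have := congr1 (mcoeff m) hP; rewrite mcoeff0 lapE => h.
have [/andP[/eqP e1 /eqP e2]|ne] := boolP (((degl m).+1 == p) && ((degr m).+1 == q)).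
  rewrite -[RHS]h; apply: eq_bigr => j _; rewrite mcoeff_component.
  by rewrite !deglD !degrD deglUl deglUr degrUl degrUr !addn0 !addn1 e1 e2 !eqxx.
apply: big1 => j _; rewrite mcoeff_component.
by rewrite !deglD !degrD deglUl deglUr degrUl degrUr !addn0 !addn1 (negbTE ne) mul0rn.
Qed.

Lemma harmonic_bihomP p q (P : Pol) : BihomPoly.harmonic_bihom p q P ->
  exists2 Q : Pol, bideg p q Q /\ lap Q = 0 & forall z, ezz Q z = ezz P z.
Proof.
case=> hP hl; exists (component p q P); last exact: eval_zzbar_component.
split.
  move=> m; rewrite mcoeff_component; case: ifP => [/andP[/eqP -> /eqP ->] //|_].
  by rewrite eqxx.
apply: lap_component; move: hl; rewrite /BihomPoly.harmonic /BihomPoly.laplacian.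
move/eqP; rewrite -scaler_nat scaler_eq0 pnatr_eq0 /= => /eqP.
by [].
Qed.

Lemma bideg_harmonic_bihom p q (P : Pol) : bideg p q P -> lap P = 0 ->
  BihomPoly.harmonic_bihom p q P.
Proof.
move=> hb hl; split; last first.
  by rewrite /BihomPoly.harmonic /BihomPoly.laplacian -[X in X *+ 4]/(lap P) hl mul0rn.
move=> l z; rewrite !ezz_mpolyE mulr_sumr.
apply: eq_big_seq => m; rewrite mcoeff_msupp => /hb[<- <-].
by rewrite ezz_monomialZ mulrCA.
Qed.

End Components.
End ZonalPolynomials.

(** * Polynomials as functions on C^n and infinitesimal rotations *)

Module SphericalPolynomials.
Import mpoly SphereAlgebra ZonalPolynomials.

Section SphericalPolynomials.
Variables (R : rcfType) (n : nat).
Local Notation C := R[i].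
Local Notation Pol := {mpoly C[n + n]}.
Local Notation Cn := 'rV[R[i]]_n.
Local Notation ezz := (@BihomPoly.eval_zzbar R n).
Local Notation zv j := ('X_(lshift n j) : Pol).
Local Notation zb j := ('X_(rshift n j) : Pol).
Implicit Types (P Q h : Pol) (z v eta : Cn).

Lemma ezzD P Q z : ezz (P + Q) z = ezz P z + ezz Q z. Proof. exact: mevalD. Qed.
Lemma ezzM P Q z : ezz (P * Q) z = ezz P z * ezz Q z. Proof. exact: mevalM. Qed.
Lemma ezzZ c P z : ezz (c *: P) z = c * ezz P z. Proof. exact: mevalZ. Qed.
Lemma ezzC c z : ezz c%:MP z = c. Proof. exact: mevalC. Qed.
Lemma ezz1 z : ezz 1 z = 1. Proof. exact: meval1. Qed.
Lemma ezz_sum (I : Type) (r : seq I) (G : I -> Pol) z :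
  ezz (\sum_(i <- r) G i) z = \sum_(i <- r) ezz (G i) z.
Proof. exact: meval_sum. Qed.
Lemma ezz_zv j z : ezz (zv j) z = z 0 j.
Proof. by rewrite /BihomPoly.eval_zzbar mevalXU split_l. Qed.
Lemma ezz_zb j z : ezz (zb j) z = (z 0 j)^*%C.
Proof. by rewrite /BihomPoly.eval_zzbar mevalXU split_r. Qed.

Lemma ezz_closure (K : Pol -> Prop) :
  (forall c, K c%:MP) -> (forall j, K (zv j)) -> (forall j, K (zb j)) ->
  (forall P Q, K P -> K Q -> K (P + Q)) ->
  (forall P Q, K P -> K Q -> K (P * Q)) -> forall P, K P.
Proof.
move=> KC Kz Kb KD KM; apply: poly_closure => // i.
by rewrite -(splitK i); case: (split i) => j; [exact: Kz|exact: Kb].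
Qed.

Definition gl_action (a b : 'I_n) P : Pol := zv a * dz b P - zb b * dw a P.

Lemma gl_actionD a b P Q : gl_action a b (P + Q) = gl_action a b P + gl_action a b Q.
Proof. by rewrite /gl_action dzD dwD; ring. Qed.
Lemma gl_actionM a b P Q :
  gl_action a b (P * Q) = gl_action a b P * Q + P * gl_action a b Q.
Proof. by rewrite /gl_action dzM dwM; ring. Qed.
Lemma gl_actionC a b c : gl_action a b c%:MP = 0.
Proof. by rewrite /gl_action /dz /dw !mderivC !mulr0 subrr. Qed.

(** The derivation sending z_j to (z | v) v_j and its conjugate to minus the conjugate of this: the
    derivative along z + mu (z | v) v when mu is small and imaginary to first order. *)
Definition rotation_field v P : Pol :=
  \sum_(a < n) \sum_(b < n) ((v 0 a)^*%C * v 0 b) *: gl_action a b P.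

Lemma ezz_rotation_field v P z : ezz (rotation_field v P) z =
  \sum_(a < n) \sum_(b < n) ((v 0 a)^*%C * v 0 b) * ezz (gl_action a b P) z.
Proof.
rewrite ezz_sum; apply: eq_bigr => a _; rewrite ezz_sum.
by apply: eq_bigr => b _; rewrite ezzZ.
Qed.

Lemma rotation_fieldD v P Q :
  rotation_field v (P + Q) = rotation_field v P + rotation_field v Q.
Proof.
rewrite /rotation_field -big_split; apply: eq_bigr => a _ /=.
by rewrite -big_split; apply: eq_bigr => b _ /=; rewrite gl_actionD scalerDr.
Qed.

Lemma rotation_fieldM v P Q :
  rotation_field v (P * Q) = rotation_field v P * Q + P * rotation_field v Q.
Proof.
rewrite /rotation_field mulr_suml mulr_sumr -big_split; apply: eq_bigr => a _ /=.
rewrite mulr_suml mulr_sumr -big_split; apply: eq_bigr => b _ /=.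
by rewrite gl_actionM scalerDr scalerAl scalerAr.
Qed.

Lemma rotation_fieldC v c : rotation_field v c%:MP = 0.
Proof.
by rewrite /rotation_field big1 // => a _; rewrite big1 // => b _; rewrite gl_actionC scaler0.
Qed.

Lemma ezz_rotation_field_zv v j z : ezz (rotation_field v (zv j)) z =
  (\sum_(a < n) z 0 a * (v 0 a)^*%C) * v 0 j.
Proof.
rewrite ezz_sum mulr_suml; apply: eq_bigr => a _.
rewrite ezz_sum (bigD1 j) //= big1 ?addr0 => [|b bj].
  by rewrite ezzZ /gl_action dz_zv dw_zv eqxx mulr0 subr0 mulr1 ezz_zv mulrC mulrA.
by rewrite ezzZ /gl_action dz_zv dw_zv eq_sym (negbTE bj) !mulr0 subr0 /BihomPoly.eval_zzbar meval0 mulr0.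
Qed.

Lemma ezz_rotation_field_zb v j z : ezz (rotation_field v (zb j)) z =
  - (\sum_(a < n) (z 0 a)^*%C * v 0 a) * (v 0 j)^*%C.
Proof.
rewrite ezz_sum (bigD1 j) //= [X in _ + X]big1 ?addr0 => [|a aj].
  rewrite ezz_sum -sumrN mulr_suml; apply: eq_bigr => b _.
  rewrite ezzZ /gl_action dz_zb dw_zb eqxx mulr0 sub0r mulr1 -scaleN1r ezzZ ezz_zb; ring.
rewrite ezz_sum big1 // => b _.
by rewrite ezzZ /gl_action dz_zb dw_zb eq_sym (negbTE aj) !mulr0 subr0 /BihomPoly.eval_zzbar meval0 mulr0.
Qed.

Lemma ezz_normsq z : ezz (normsq C n) z = \sum_(j < n) z 0 j * (z 0 j)^*%C.
Proof. by rewrite ezz_sum; apply: eq_bigr => j _; rewrite ezzM ezz_zv ezz_zb. Qed.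

Definition harmonic_bideg p q h : Prop := bideg p q h /\ lap h = 0.

Lemma harmonic_bideg_sum (I : Type) (r : seq I) (c : I -> C) (h : I -> Pol) p q :
  (forall i, harmonic_bideg p q (h i)) ->
  exists2 P, harmonic_bideg p q P & forall z, ezz P z = \sum_(i <- r) c i * ezz (h i) z.
Proof.
move=> hh; exists (\sum_(i <- r) c i *: h i); last first.
  by move=> z; rewrite ezz_sum; apply: eq_bigr => i _; rewrite ezzZ.
split; first by apply: bideg_sum => i _; apply: bidegZ; case: (hh i).
by rewrite lap_sum big1 // => i _; rewrite lapZ; case: (hh i) => _ ->; rewrite scaler0.
Qed.

Definition sphere_functional (I : Pol -> C) : Prop :=
  [/\ forall P Q, I (P + Q) = I P + I Q,
      forall c P, I (c *: P) = c * I P,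
      forall a b P, I (gl_action a b P) = 0,
      forall P, I (normsq C n * P) = I P & I 1 = 1].

Definition zonal_poly eta p q : Pol :=
  zonal_pol (fun i => eta 0 i) (fun i => (eta 0 i)^*%C) p q.

Definition pairing_monomial eta j k : Pol :=
  pairing_r (fun i => eta 0 i) ^+ k * pairing_l (fun i => (eta 0 i)^*%C) ^+ j.

Lemma ezz_pairing_monomial eta j k z : ezz (pairing_monomial eta j k) z =
  (\sum_(a < n) z 0 a * (eta 0 a)^*%C) ^+ j * (\sum_(a < n) z 0 a * (eta 0 a)^*%C)^*%C ^+ k.
Proof.
rewrite /pairing_monomial ezzM /BihomPoly.eval_zzbar !mevalXn meval_pairing_l meval_pairing_r.
rewrite mulrC; congr (_ ^+ _ * _ ^+ _).
  by apply: eq_bigr => a _; rewrite split_l mulrC.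
rewrite rmorph_sum; apply: eq_bigr => a _; rewrite split_r rmorphM [X in _ = _ * X]conjcK.
by rewrite mulrC.
Qed.

Lemma ezz_zonal_poly eta p q z : \sum_(j < n) z 0 j * (z 0 j)^*%C = 1 ->
  ezz (zonal_poly eta p q) z = zonal_profile n p q
   (\sum_(a < n) z 0 a * (eta 0 a)^*%C) (\sum_(a < n) z 0 a * (eta 0 a)^*%C)^*%C.
Proof.
move=> z1; rewrite -[RHS]/(zonal_profile _ _ _ _ _) /BihomPoly.eval_zzbar meval_zonal_pol; last first.
  by rewrite -z1 -ezz_normsq.
have := ezz_pairing_monomial eta 1 0 z; have := ezz_pairing_monomial eta 0 1 z.
rewrite /pairing_monomial !expr0 !expr1 !mulr1 !mul1r /BihomPoly.eval_zzbar => -> -> //.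
Qed.

Lemma harmonic_zonal_poly eta p q : \sum_(j < n) eta 0 j * (eta 0 j)^*%C = 1 ->
  (1 < n)%N -> harmonic_bideg p q (zonal_poly eta p q).
Proof. by move=> e1 n1; split; [exact: bideg_zonal_pol|exact: lap_zonal_pol]. Qed.

Section Functional.
Variable I : Pol -> C.
Hypothesis hI : sphere_functional I.
Variable eta : Cn.
Hypothesis eta1 : \sum_(j < n) eta 0 j * (eta 0 j)^*%C = 1.
Hypothesis n_gt1 : (1 < n)%N.

Lemma zonal_poly_reproducing p q h : harmonic_bideg p q h ->
  I (h * zonal_poly eta q p) = zonal_norm C n p q * ezz h eta.
Proof.
case: hI => ID IZ IE IS I1 [hb hl].
exact: (zonal_reproducing n_gt1 eta1 ID IZ IE IS I1 hb hl).
Qed.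

Lemma zonal_poly_ortho p q p' q' h : harmonic_bideg p q h ->
  (p, q) != (p', q') -> I (h * zonal_poly eta q' p') = 0.
Proof.
case: hI => ID IZ IE IS I1 [hb hl].
exact: (zonal_ortho n_gt1 eta1 ID IZ IE IS hb hl).
Qed.

Lemma zonal_poly_monomial p q r :
  I (zonal_poly eta q p * pairing_monomial eta (p + r) (q + r)) = pairing_coef C n q p r.
Proof.
case: hI => ID IZ IE IS I1.
exact: (zonal_monomial n_gt1 eta1 ID IZ IE IS I1).
Qed.

End Functional.

(** The functions [e i] are the values of all monomials of degree at most p + q. They need not be
    harmonic; they only serve to bound the dimension. *)
Lemma bideg_finite_span (p q : nat) : exists (N : nat) (e : 'I_N -> Cn -> C),
  forall h, bideg p q h -> exists c : 'I_N -> C, forall z, ezz h z = \sum_(i < N) c i * e i z.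
Proof.
pose B : finType := 'X_{1.. (n + n)%N < (p + q).+1}.
exists #|{: B}|, (fun i => ezz 'X_[enum_val i : B]) => h hb.
exists (fun i => h@_(enum_val i : B)) => z.
have hs : (msize h <= (p + q).+1)%N.
  rewrite msizeE; apply/bigmax_leqP_seq => m; rewrite mcoeff_msupp => /hb[<- <-] _.
  by rewrite mdeg_degl_degr.
rewrite {1}(mpolywE hs) ezz_sum (reindex_onto (@enum_val _ {: B}) enum_rank) /=.
  by apply: eq_big => [i|i _]; rewrite ?enum_valK ?eqxx // ezzZ.
by move=> m _; rewrite enum_rankK.
Qed.

End SphericalPolynomials.
End SphericalPolynomials.

Import all_classical all_reals all_analysis measurable_realfun.
Import numFieldNormedType.Exports.
Import SphereAlgebra ZonalPolynomials SphericalPolynomials.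
Local Open Scope classical_set_scope.
#[local] Existing Instance summability.totally_filter.

(** * Unconditional summation *)

Section ComplexModulus.
Variable R : realType.
Local Notation C := R[i].
Implicit Types z w : C.

Lemma cabsE z : `|z| = (cabs z)%:C%C.
Proof. by []. Qed.

Lemma cabs_ge0 z : 0 <= cabs z.
Proof. by have := normr_ge0 z; rewrite cabsE (@lecR R 0). Qed.

Lemma cabs0 : cabs (0 : C) = 0.
Proof. by apply: complexI; rewrite -cabsE normr0. Qed.

Lemma cabs1 : cabs (1 : C) = 1.
Proof. by apply: complexI; rewrite -cabsE normr1. Qed.

Lemma cabs_eq0 z : (cabs z == 0) = (z == 0).
Proof.
by rewrite -[RHS]normr_eq0 cabsE eq_complex /= eqxx andbT.
Qed.

Lemma cabsD z w : cabs (z + w) <= cabs z + cabs w.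
Proof. by have := ler_normD z w; rewrite !cabsE -rmorphD lecR. Qed.

Lemma cabsM z w : cabs (z * w) = cabs z * cabs w.
Proof. by apply: complexI; rewrite rmorphM -!cabsE normrM. Qed.

Lemma cabsN z : cabs (- z) = cabs z.
Proof. by apply: complexI; rewrite -!cabsE normrN. Qed.

Lemma cabsB z w : cabs (z - w) = cabs (w - z).
Proof. by rewrite -cabsN opprB. Qed.

Lemma cabsX z k : cabs (z ^+ k) = cabs z ^+ k.
Proof. by apply: complexI; rewrite rmorphXn /= -!cabsE normrX. Qed.

Lemma cabsV z : cabs (z^-1) = (cabs z)^-1.
Proof. by apply: complexI; rewrite fmorphV /= -!cabsE normfV. Qed.

Lemma cabs_conj z : cabs (z^*%C) = cabs z.
Proof. by case: z => a b; rewrite /cabs /= sqrrN. Qed.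

Lemma cabsR (x : R) : cabs (x%:C%C) = `|x|.
Proof. by rewrite /cabs /= expr0n addr0 sqrtr_sqr. Qed.

Lemma cabs_nat (k : nat) : cabs (k%:R : C) = k%:R.
Proof. by apply: complexI; rewrite -cabsE normr_nat rmorph_nat. Qed.

Lemma cabsi : cabs ('i%C : C) = 1.
Proof. by rewrite /cabs /= expr0n add0r expr1n sqrtr1. Qed.

Lemma cabs_sum (I : Type) (r : seq I) (A : pred I) (G : I -> C) :
  cabs (\sum_(i <- r | A i) G i) <= \sum_(i <- r | A i) cabs (G i).
Proof.
elim/big_ind2 : _ => //; first by rewrite cabs0.
by move=> x1 x2 y1 y2 h1 h2; rewrite (le_trans (cabsD _ _)) // lerD.
Qed.

Lemma Re_le_cabs z : `|complex.Re z| <= cabs z.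
Proof.
case: z => a b; rewrite /cabs /= -sqrtr_sqr ler_wsqrtr //.
by rewrite lerDl sqr_ge0.
Qed.

Lemma Im_le_cabs z : `|complex.Im z| <= cabs z.
Proof.
case: z => a b; rewrite /cabs /= -sqrtr_sqr ler_wsqrtr //.
by rewrite lerDr sqr_ge0.
Qed.

Lemma cabs_le_ReIm z : cabs z <= `|complex.Re z| + `|complex.Im z|.
Proof.
have {1}-> : z = (complex.Re z)%:C%C + 'i%C * (complex.Im z)%:C%C.
  by case: z => a b; apply/eqP; rewrite eq_complex /=; apply/andP; split; apply/eqP; ring.
by rewrite (le_trans (cabsD _ _)) // cabsM cabsi mul1r !cabsR.
Qed.

Lemma mulr_conj z : z * z^*%C = (cabs z ^+ 2)%:C%C.
Proof. by rewrite rmorphXn /= -cabsE sqr_normc. Qed.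

Lemma cabs_le0P z : (forall e : R, 0 < e -> cabs z <= e) -> z = 0.
Proof.
move=> h; apply/eqP; rewrite -cabs_eq0 eq_le cabs_ge0 andbT.
by apply/ler_addgt0Pr => e e0; rewrite add0r; exact: h.
Qed.

End ComplexModulus.

Lemma sum_fibre (V : zmodType) (K I : eqType) (pi : K -> I) (s : seq K) (t : seq I)
    (u : K -> V) : uniq t -> {subset [seq pi k | k <- s] <= t} ->
  \sum_(k <- s) u k = \sum_(i <- t) \sum_(k <- s | pi k == i) u k.
Proof.
move=> ut st; under [RHS]eq_bigr do rewrite big_mkcond.
rewrite exchange_big /=; apply: eq_big_seq => k ks.
rewrite (bigD1_seq (pi k)) ?eqxx //=; last exact/st/map_f.
by rewrite big1 ?addr0 // => i; rewrite eq_sym => /negbTE ->.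
Qed.

Section RealFamilies.
Variable R : realType.

(** For nonnegative families this is summability with an explicit bound; carrying the bound [M]
    avoids naming the sum. *)
Definition rsum (I : choiceType) (a : I -> R) (M : R) : Prop :=
  forall s : seq I, uniq s -> \sum_(i <- s) a i <= M.

Lemma sum_uniq_subset (I : eqType) (a : I -> R) (r s : seq I) :
  (forall i, 0 <= a i) -> uniq r -> uniq s -> {subset r <= s} ->
  \sum_(i <- r) a i <= \sum_(i <- s) a i.
Proof.
move=> a0 ur us rs; rewrite [leRHS](bigID (mem r)) /=.
rewrite -[X in _ <= X + _]big_filter [X in _ <= X + _](perm_big r); first by rewrite lerDl sumr_ge0.
apply: uniq_perm; rewrite ?filter_uniq // => i.
by rewrite mem_filter; apply/andP/idP => [[]|ir]; last by split=> //; exact: rs.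
Qed.

Lemma rsum_ge0 (I : choiceType) (a : I -> R) M : rsum a M -> 0 <= M.
Proof. by move=> /(_ [::] isT); rewrite big_nil. Qed.

Lemma rsum_le (I : choiceType) (a b : I -> R) M :
  (forall i, a i <= b i) -> rsum b M -> rsum a M.
Proof. by move=> ab hb s us; rewrite (le_trans _ (hb s us)) // ler_sum. Qed.

Lemma rsumZ (I : choiceType) (a : I -> R) M c : 0 <= c ->
  rsum a M -> rsum (fun i => c * a i) (c * M).
Proof. by move=> c0 h s us; rewrite -mulr_sumr ler_wpM2l // h. Qed.

Lemma rsum_fibre (K I : choiceType) (pi : K -> I) (a : K -> R) (b : I -> R) M :
  (forall i s, uniq s -> (forall k, k \in s -> pi k = i) ->
     \sum_(k <- s) a k <= b i) ->
  rsum b M -> rsum a M.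
Proof.
move=> ab hb s us.
rewrite (@sum_fibre _ _ _ pi _ (undup [seq pi k | k <- s])) ?undup_uniq //; last first.
  by move=> i; rewrite mem_undup.
apply: (le_trans _ (hb _ (undup_uniq _))); apply: ler_sum => i _.
rewrite -big_filter; apply: ab; first exact: filter_uniq.
by move=> k; rewrite mem_filter => /andP[/eqP].
Qed.

Lemma rsum_prod (I J : choiceType) (a : I -> R) (b : J -> R) M N :
  (forall i, 0 <= a i) -> rsum a M -> rsum b N ->
  rsum (fun k : I * J => a k.1 * b k.2) (M * N).
Proof.
move=> a0 ha hb; have N0 := rsum_ge0 hb.
apply: (@rsum_fibre _ _ fst _ (fun i => a i * N)); last first.
  by move=> s us; rewrite -mulr_suml ler_wpM2r // ha.
move=> i s us si.
rewrite (eq_big_seq (fun k => a i * b k.2)) => [|k /si <- //].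
rewrite -mulr_sumr ler_wpM2l // -(big_map snd predT b) hb //.
rewrite map_inj_in_uniq // => -[x1 y1] [x2 y2] /si /= -> /si /= -> /= -> //.
Qed.

Lemma rsum_geometric (q : R) : 0 <= q < 1 -> rsum (fun i : nat => q ^+ i) (1 - q)^-1.
Proof.
move=> /andP[q0 q1] s us.
pose N := (\max_(i <- s) i).+1.
apply: (le_trans (@sum_uniq_subset _ _ _ (iota 0 N) _ us (iota_uniq _ _) _)).
- by move=> i; rewrite exprn_ge0.
- by move=> i si; rewrite mem_iota /= add0n ltnS (@leq_bigmax_seq _ _ xpredT (fun i : nat => i) _ si isT).
have q1' : 0 < 1 - q by rewrite subr_gt0.
have -> : \sum_(i <- iota 0 N) q ^+ i = \sum_(i < N) q ^+ i.
  by rewrite -(big_mkord xpredT (fun i => q ^+ i)) /index_iota subn0.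
rewrite -(ler_pM2l q1') divff ?gt_eqF // mulrC.
have -> : (\sum_(i < N) q ^+ i) * (1 - q) = 1 - q ^+ N.
  by rewrite mulrC -opprB mulNr -subrX1 opprB.
by rewrite lerBlDr lerDl exprn_ge0.
Qed.

(** Choose [F0] with partial sum within e of the supremum; a disjoint finite set cannot add more
    than e. *)
Lemma rsum_tail (I : choiceType) (a : I -> R) M e : (forall i, 0 <= a i) ->
  rsum a M -> 0 < e ->
  exists F0 : {fset I}, forall s : seq I, uniq s -> (forall i, i \in s -> i \notin F0) ->
    \sum_(i <- s) a i <= e.
Proof.
move=> a0 ha e0.
pose S := [set x | exists2 s : seq I, uniq s & x = \sum_(i <- s) a i].
have S0 : has_sup S.
  split; first by exists 0; exists [::] => //; rewrite big_nil.
  by exists M => _ [s us ->]; exact: ha.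
have [_ [s0 us0 ->] hs0] := sup_adherent e0 S0.
exists [fset i in s0]%fset => s us ds.
have : \sum_(i <- s0 ++ s) a i <= sup S.
  apply: ub_le_sup; first by case: S0.
  exists (s0 ++ s) => //; rewrite cat_uniq us0 us andbT /=.
  by apply/hasPn => i /ds; rewrite inE.
by rewrite big_cat /=; lra.
Qed.

End RealFamilies.

Section ComplexFamilies.
Variable R : realType.
Local Notation C := R[i].

(** Unconditional summation over any index type, as the triples of the final regrouping require; on
    pairs it is convergence along [summability.totally] by [cvg_totally_hasum]. *)
Definition hasum (I : choiceType) (u : I -> C) (s : C) : Prop :=
  forall e : R, 0 < e -> exists F0 : {fset I}, forall F : {fset I},
    (F0 `<=` F)%fset -> cabs (\sum_(i <- F) u i - s) <= e.

Definition bsum (I : choiceType) (u : I -> C) (M : R) : Prop :=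
  rsum (fun i => cabs (u i)) M.

Lemma hasum_unique (I : choiceType) (u : I -> C) s t :
  hasum u s -> hasum u t -> s = t.
Proof.
move=> hs ht; apply/eqP; rewrite -subr_eq0; apply/eqP/cabs_le0P => e e0.
have e2 : 0 < e / 2 by rewrite divr_gt0.
have [F1 h1] := hs _ e2; have [F2 h2] := ht _ e2.
have {}h1 := h1 _ (fsubsetUl F1 F2); have {}h2 := h2 _ (fsubsetUr F1 F2).
set x := \sum_(i <- _) _ in h1 h2.
have -> : s - t = (x - t) - (x - s) by ring.
by rewrite (le_trans (cabsD _ _)) // cabsN; lra.
Qed.

Lemma eq_hasum (I : choiceType) (u v : I -> C) s : u =1 v -> hasum u s -> hasum v s.
Proof.
move=> uv h e e0; have [F0 hF] := h _ e0; exists F0 => F /hF.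
by under eq_bigr do rewrite uv.
Qed.

Lemma hasumD (I : choiceType) (u v : I -> C) s t :
  hasum u s -> hasum v t -> hasum (fun i => u i + v i) (s + t).
Proof.
move=> hs ht e e0; have e2 : 0 < e / 2 by rewrite divr_gt0.
have [F1 h1] := hs _ e2; have [F2 h2] := ht _ e2.
exists (F1 `|` F2)%fset => F; rewrite fsubUset => /andP[/h1 {}h1 /h2 {}h2].
rewrite big_split /= opprD addrACA (le_trans (cabsD _ _)) //; lra.
Qed.

Lemma hasumZ (I : choiceType) (u : I -> C) s c :
  hasum u s -> hasum (fun i => c * u i) (c * s).
Proof.
move=> hs e e0; have c1 : 0 < cabs c + 1 by rewrite ltr_wpDl // cabs_ge0.
have [F0 h] := hs _ (divr_gt0 e0 c1); exists F0 => F /h {}h.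
rewrite -mulr_sumr -mulrBr cabsM.
rewrite (le_trans (ler_wpM2l (cabs_ge0 _) h)) // mulrA ler_pdivrMr // mulrC.
by rewrite ler_pM2l // lerDl.
Qed.

Lemma hasumB (I : choiceType) (u v : I -> C) s t :
  hasum u s -> hasum v t -> hasum (fun i => u i - v i) (s - t).
Proof.
move=> hs ht; have := hasumD hs (hasumZ (-1) ht); rewrite mulN1r.
by apply: eq_hasum => i; rewrite mulN1r.
Qed.

Lemma hasum_bound (I : choiceType) (u : I -> C) s M :
  (forall F : {fset I}, cabs (\sum_(i <- F) u i) <= M) -> hasum u s -> cabs s <= M.
Proof.
move=> hM hs; apply/ler_addgt0Pr => e e0.
have [F0 h] := hs _ e0; have {}h := h _ (fsubset_refl _).
have -> : s = \sum_(i <- F0) u i - (\sum_(i <- F0) u i - s) by rewrite opprB addrC subrK.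
by rewrite (le_trans (cabsD _ _)) // cabsN lerD.
Qed.

Lemma bsum_hasum_bound (I : choiceType) (u : I -> C) s M :
  bsum u M -> hasum u s -> cabs s <= M.
Proof.
move=> hM; apply: hasum_bound => F.
by rewrite (le_trans (cabs_sum _ _ _)) // hM // fset_uniq.
Qed.

Lemma hasum_fin (I : choiceType) (u : I -> C) (F : {fset I}) :
  (forall i, i \notin F -> u i = 0) -> hasum u (\sum_(i <- F) u i).
Proof.
move=> h e e0; exists F => G FG; rewrite (big_fset_incl _ FG).
  by rewrite subrr cabs0 ltW.
by move=> i _ /h.
Qed.

Lemma hasum_seq (I : choiceType) (u : I -> C) (r : seq I) : uniq r ->
  (forall i, i \notin r -> u i = 0) -> hasum u (\sum_(i <- r) u i).
Proof.
move=> ur h.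
have -> : \sum_(i <- r) u i = \sum_(i <- [fset i in r]%fset) u i.
  apply: perm_big; apply: uniq_perm; rewrite ?fset_uniq // => i.
  by rewrite inE.
by apply: hasum_fin => i; rewrite inE; exact: h.
Qed.

(** A nonnegative family sums to its supremum of finite sums; a real one is (|a| + a) - |a|, and a
    complex one is treated by real and imaginary parts. *)
Lemma bsum_hasum (I : choiceType) (u : I -> C) M : bsum u M -> exists s, hasum u s.
Proof.
have pos (a : I -> R) N : (forall i, 0 <= a i) -> rsum a N ->
    exists s, hasum (fun i => (a i)%:C%C) s.
  move=> a0 ha.
  pose S := [set x | exists F : {fset I}, x = \sum_(i <- F) a i].
  have S0 : has_sup S.
    split; first by exists (\sum_(i <- fset0) a i); exists fset0.
    by exists N => _ [F ->]; rewrite ha // fset_uniq.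
  exists (sup S)%:C%C => e e0.
  have [_ [F0 ->] hF0] := sup_adherent e0 S0; exists F0 => F FF.
  rewrite -rmorph_sum -rmorphB cabsR distrC ger0_norm.
    have : \sum_(i <- F0) a i <= \sum_(i <- F) a i.
      by apply: sum_uniq_subset; rewrite ?fset_uniq //; exact/fsubsetP.
    by move=> h; rewrite lerBlDr -lerBlDl ltW // (lt_le_trans hF0).
  by rewrite subr_ge0; apply: ub_le_sup; [case: S0|exists F].
have real (a : I -> R) N : rsum (fun i => `|a i|) N ->
    exists s, hasum (fun i => (a i)%:C%C) s.
  move=> ha; have [s hs] := pos _ _ (fun=> normr_ge0 _) ha.
  have [||t ht] := pos (fun i => `|a i| + a i) (2 * N).
  - by move=> i; have := ler_norm (- a i); rewrite normrN; lra.
  - apply: (@rsum_le _ _ _ (fun i => 2 * `|a i|)); last exact: rsumZ.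
    by move=> i; have := ler_norm (a i); lra.
  exists (t - s); apply: eq_hasum (hasumB ht hs) => i.
  by rewrite -rmorphB; congr (_%:C%C); ring.
move=> hu.
have [s hs] := real (fun i => complex.Re (u i)) M (rsum_le (fun=> Re_le_cabs _) hu).
have [t ht] := real (fun i => complex.Im (u i)) M (rsum_le (fun=> Im_le_cabs _) hu).
exists (s + 'i%C * t); apply: eq_hasum (hasumD hs (hasumZ _ ht)) => i.
by case: (u i) => a b; apply/eqP; rewrite eq_complex /=; apply/andP; split; apply/eqP; ring.
Qed.

Lemma bsum_le (I : choiceType) (u v : I -> C) M :
  (forall i, cabs (u i) <= cabs (v i)) -> bsum v M -> bsum u M.
Proof. exact: rsum_le. Qed.

Lemma hasum_sum (I : choiceType) (J : Type) (r : seq J) (u : J -> I -> C) (s : J -> C) :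
  (forall j, hasum (u j) (s j)) ->
  hasum (fun i => \sum_(j <- r) u j i) (\sum_(j <- r) s j).
Proof.
move=> h; elim: r => [|j r IHr].
  rewrite big_nil; apply: (@eq_hasum _ (fun=> 0)) => [i|]; first by rewrite big_nil.
  by move=> e e0; exists fset0 => F _; rewrite big1 // subrr cabs0 ltW.
rewrite big_cons; apply: eq_hasum (hasumD (h j) IHr) => i; by rewrite big_cons.
Qed.

Section Partition.
Variables (K I : choiceType) (pi : K -> I) (u : K -> C) (s : C) (v : I -> C) (M : R).
Hypothesis hu : bsum u M.
Hypothesis hs : hasum u s.
Hypothesis hv : forall i, hasum (fun k => if pi k == i then u k else 0) (v i).

(** Summation by fibres. The difference between a finite sum of fibre sums and [s] is a sum of [u]
    over indices whose image lies outside [F]; once [F] contains the image of [K0], all of them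
    avoid [K0] and form a small tail. *)
Lemma hasum_partition : hasum v s.
Proof.
move=> e e0; have [K0 hK0] := rsum_tail (fun=> cabs_ge0 _) hu e0.
exists [fset pi k | k in K0]%fset => F KF.
have h := hasumB (hasum_sum (enum_fset F) hv) hs.
apply: hasum_bound h => G.
have e1 k : \sum_(j <- F) (if pi k == j then u k else 0) - u k =
    if pi k \in F then 0 else - u k.
  case: ifPn => kF.
    rewrite (bigD1_seq (pi k)) ?fset_uniq //= eqxx big1 ?addr0 ?subrr // => i.
    by rewrite eq_sym => /negbTE ->.
  rewrite big1_seq ?sub0r // => i /andP[_ iF].
  by case: eqP kF => // ->; rewrite iF.
under eq_bigr do rewrite e1.
rewrite (bigID (fun k => pi k \in F)) /= big1 ?add0r => [|k ->//].
under eq_bigr => k kF do rewrite (negbTE kF).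
rewrite -big_filter (le_trans (cabs_sum _ _ _)) //.
under eq_bigr do rewrite cabsN.
apply: hK0; first by rewrite filter_uniq ?fset_uniq.
move=> k; rewrite mem_filter => /andP[kF _]; apply: contraNN kF => kK.
by apply: (fsubsetP KF); apply/imfsetP; exists k.
Qed.

(** Each fibre sum is approximated by a finite part of its fibre, with the allowed error halved at
    each step; finite parts of different fibres are disjoint, so together they still obey the bound
    for [u]. *)
Lemma bsum_partition : bsum v M.
Proof.
move=> t ut; apply/ler_addgt0Pr => e e0.
suff [G [uG Gt hG]] : exists G : seq K, [/\ uniq G, forall k, k \in G -> pi k \in t &
    \sum_(i <- t) cabs (v i) <= \sum_(k <- G) cabs (u k) + e].
  by rewrite (le_trans hG) // lerD2r hu.
elim: t ut e e0 => [_ e e0|i t IHt /= /andP[it ut] e e0].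
  by exists [::]; split => //; rewrite !big_nil add0r ltW.
have e2 : 0 < e / 2 by rewrite divr_gt0.
have [G [uG Gt hG]] := IHt ut _ e2.
have [F0 hF0] := hv i e2; have {}hF0 := hF0 _ (fsubset_refl _).
pose H := [seq k <- enum_fset F0 | pi k == i].
exists (H ++ G); split.
- rewrite cat_uniq uG andbT filter_uniq ?fset_uniq //=.
  apply/hasPn => k kG; rewrite mem_filter negb_and; apply/orP; left.
  by apply: contraNneq it => <-; exact: Gt.
- move=> k; rewrite mem_cat in_cons => /orP[|/Gt ->]; last by rewrite orbT.
  by rewrite mem_filter => /andP[-> _].
rewrite big_cons big_cat /=.
have : cabs (v i) <= \sum_(k <- H) cabs (u k) + e / 2.
  have -> : v i = (\sum_(k <- F0) (if pi k == i then u k else 0))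
     - (\sum_(k <- F0) (if pi k == i then u k else 0) - v i) by rewrite opprB addrC subrK.
  rewrite (le_trans (cabsD _ _)) // cabsN lerD // -big_mkcond -big_filter.
  exact: cabs_sum.
by move: hG; lra.
Qed.

End Partition.

Lemma cvg_totally_hasum (u : nat -> nat -> C) s :
  (dsum u @ summability.totally --> s) <-> hasum (fun i => u i.1 i.2) s.
Proof.
split=> [/cvgrPdist_le h e e0|h].
  have /h : 0 < e%:C%C by rewrite ltcR.
  case=> F0 _ hF; exists F0 => F FF.
  by have := hF F FF; rewrite /= cabsE lecR -cabsB.
apply/cvgrPdist_le => e e0.
(* Positivity in [R[i]] forces [e] to be real. *)
have eE : e = (complex.Re e)%:C%C by rewrite RRe_real // gtr0_real.
have [|F0 hF] := h (complex.Re e); first by rewrite -ltcR -eE.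
exists F0 => // F FF /=; rewrite eE cabsE lecR cabsB; exact: hF.
Qed.

Lemma cvg_series_hasum (u : nat -> C) s : hasum u s -> series u @ \oo --> s.
Proof.
move=> h; apply/cvgrPdist_le => e e0.
have eE : e = (complex.Re e)%:C%C by rewrite RRe_real // gtr0_real.
have [|F0 hF] := h (complex.Re e); first by rewrite -ltcR -eE.
exists (\max_(i <- F0) i).+1 => // N /= FN.
rewrite eE cabsE lecR cabsB.
have := hF [fset i in iota 0 N]%fset; rewrite /series /=.
have -> : \sum_(i <- [fset i in iota 0 N]%fset) u i = \sum_(0 <= i < N) u i.
  apply: perm_big; apply: uniq_perm; rewrite ?fset_uniq ?iota_uniq // => i.
  by rewrite inE mem_index_iota mem_iota.
apply; apply/fsubsetP => i iF; rewrite inE mem_iota /= add0n.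
by apply: leq_ltn_trans FN; exact: (@leq_bigmax_seq _ _ xpredT (fun i : nat => i) _ iF isT).
Qed.

Lemma abs_summableP (u : nat -> nat -> C) :
  abs_summable u <-> exists M, bsum (fun i => u i.1 i.2) M.
Proof.
have nneg (i : nat * nat) : (0 <= (cabs (u i.1 i.2))%:E)%E by rewrite lee_fin cabs_ge0.
split=> [h|[M hM]].
  exists (fine (\esum_(i in [set: nat * nat]) (cabs (u i.1 i.2))%:E)%E) => s us.
  have fin : (\esum_(i in [set: nat * nat]) (cabs (u i.1 i.2))%:E)%E \is a fin_num.
    by rewrite ge0_fin_numE // esum_ge0.
  rewrite -lee_fin fineK //; apply: ereal_sup_ubound.
  exists [set` s]; first by split => //; exact: finite_seq.
  by rewrite -fsbig_seq // sumEFin.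
rewrite /abs_summable; apply: (@le_lt_trans _ _ M%:E); last exact: ltry.
apply: ge_ereal_sup => _ [X [finX _] <-].
rewrite fsbig_finite //= sumEFin lee_fin; exact/hM/fset_uniq.
Qed.

End ComplexFamilies.

(** * Power series in w and its conjugate *)

Local Notation power_terms c x y :=
  (fun i : nat * nat => c i.1 i.2 * x ^+ i.1 * y ^+ i.2).

Section PowerSeries.
Variable R : realType.
Local Notation C := R[i].

Lemma rsum_geometric2 (q : R) : 0 <= q < 1 ->
  rsum (fun i : nat * nat => q ^+ (i.1 + i.2)) ((1 - q)^-1 * (1 - q)^-1).
Proof.
move=> q01; have := rsum_geometric q01 => h.
apply: rsum_le (rsum_prod _ h h) => [i|i]; first by rewrite exprD.
by case/andP: q01 => q0 _; rewrite exprn_ge0.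
Qed.

Lemma rsum_half : rsum (fun i : nat => 2^-1 ^+ i : R) 2.
Proof.
have := @rsum_geometric R 2^-1; rewrite (_ : (1 - 2^-1)^-1 = 2); last by field.
by apply; lra.
Qed.

Lemma rsum_half2 : rsum (fun i : nat * nat => 2^-1 ^+ (i.1 + i.2) : R) 4.
Proof.
have := @rsum_geometric2 2^-1; rewrite (_ : (1 - 2^-1)^-1 = 2); last by field.
by rewrite (_ : 2 * 2 = 4 :> R) => [|]; [apply; lra|ring].
Qed.

(** Outside [F0] a term is the difference of two partial sums that are both within 1 of [s]. *)
Lemma hasum_bounded (I : choiceType) (u : I -> C) s :
  hasum u s -> exists M, forall i, cabs (u i) <= M.
Proof.
move=> /(_ 1 ltr01)[F0 hF0].
exists (2 + \sum_(i <- F0) cabs (u i)) => i.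
have S0 : 0 <= \sum_(i <- F0) cabs (u i) by rewrite sumr_ge0 // => j _; exact: cabs_ge0.
have [iF|iF] := boolP (i \in F0).
  rewrite (bigD1_seq i) ?fset_uniq //= addrCA lerDl addr_ge0 // sumr_ge0 // => j _.
  exact: cabs_ge0.
have h1 := hF0 _ (fsubset_refl _).
have h2 := hF0 _ (fsubsetU1 i F0); move: h2; rewrite big_fsetU1 //= => h2.
have -> : u i = (u i + \sum_(i0 <- F0) u i0 - s) - (\sum_(i0 <- F0) u i0 - s) by ring.
rewrite (le_trans (cabsD _ _)) // cabsN; lra.
Qed.

(** The partition of the pairs by total degree. *)
Lemma diag_bsum (u : nat * nat -> C) s M : bsum u M -> hasum u s ->
  hasum (fun N => \sum_(i < N.+1) u (i : nat, (N - i)%N)) s /\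
  bsum (fun N => \sum_(i < N.+1) u (i : nat, (N - i)%N)) M.
Proof.
move=> hu hs.
have hv N : hasum (fun k : nat * nat => if (k.1 + k.2)%N == N then u k else 0)
    (\sum_(i < N.+1) u (i : nat, (N - i)%N)).
  have -> : \sum_(i < N.+1) u (i : nat, (N - i)%N) =
      \sum_(k <- [seq (i, (N - i)%N) | i <- iota 0 N.+1])
         (if (k.1 + k.2)%N == N then u k else 0).
    rewrite big_map -(big_mkord xpredT (fun i => u (i, (N - i)%N))) /index_iota subn0.
    apply: eq_big_seq => i; rewrite mem_iota add0n ltnS => /andP[_ iN] /=.
    by rewrite subnKC // eqxx.
  apply: hasum_seq; first by rewrite map_inj_uniq ?iota_uniq // => i j [].
  move=> [i j] ij; case: eqP => //= e; case/negP: ij.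
  apply/mapP; exists i; last by rewrite -e addKn.
  by rewrite mem_iota add0n ltnS -e leq_addr.
split; [exact: (hasum_partition hu hs hv)|exact: (bsum_partition hu hv)].
Qed.

(** Cauchy estimates at radius [rho]. They are easier to transport through changes of variables and
    derivatives than summability, which returns at half the radius by [coef_bound_bsum]. *)
Definition coef_bound (c : nat -> nat -> C) (rho M : R) : Prop :=
  forall j k, cabs (c j k) * rho ^+ (j + k) <= M.

(** The constant 4 is the square of the sum of the powers of 1/2. *)
Lemma coef_bound_bsum (c : nat -> nat -> C) rho M (x y : C) :
  0 < rho -> coef_bound c rho M -> cabs x <= rho / 2 -> cabs y <= rho / 2 ->
  bsum (power_terms c x y) (M * 4).
Proof.
move=> r0 hc hx hy.
have M0 : 0 <= M by rewrite (le_trans _ (hc 0%N 0%N)) // mulr_ge0 ?cabs_ge0 ?exprn_ge0 // ltW.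
apply: rsum_le (rsumZ M0 rsum_half2) => -[j k] /=.
rewrite !cabsM !cabsX -mulrA.
apply: (@le_trans _ _ (cabs (c j k) * ((rho / 2) ^+ j * (rho / 2) ^+ k))).
  rewrite ler_wpM2l ?cabs_ge0 // ler_pM ?exprn_ge0 ?cabs_ge0 //;
    by rewrite lerXn2r ?nnegrE ?cabs_ge0 // divr_ge0 // ltW.
by rewrite -exprD exprMn mulrA ler_wpM2r // exprn_ge0.
Qed.

Lemma natrS_le_exp2 (k : nat) : k.+1%:R <= 2 ^+ k :> R.
Proof. by rewrite -natrX ler_nat ltn_expl. Qed.

(** A diagonal has N + 1 terms; halving the radius gains 2^N, which absorbs this number. *)
Lemma diag_coef_bound (c : nat -> nat -> C) rho M (e : nat -> C) N : 0 < rho ->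
  coef_bound c rho M -> (forall j, (j <= N)%N -> cabs (e j) <= 1) ->
  cabs (\sum_(j < N.+1) c j (N - j)%N * e j) * (rho / 2) ^+ N <= M.
Proof.
move=> rho0 hM he.
have M0 : 0 <= M by rewrite (le_trans _ (hM 0%N 0%N)) // mulr_ge0 ?cabs_ge0 ?exprn_ge0 // ltW.
have : cabs (\sum_(j < N.+1) c j (N - j)%N * e j) <= N.+1%:R * (M / rho ^+ N).
  rewrite (le_trans (cabs_sum _ _ _)) //.
  rewrite -[N.+1 in leRHS]card_ord mulr_natl -sumr_const; apply: ler_sum => j _.
  have jN : (j <= N)%N by rewrite -ltnS.
  rewrite cabsM (le_trans (y := cabs (c j (N - j)%N))) //.
    by rewrite ler_piMr ?cabs_ge0 // he.
  by rewrite ler_pdivlMr ?exprn_gt0 //; have := hM j (N - j)%N; rewrite subnKC.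
move=> h; rewrite exprMn (le_trans (ler_wpM2r _ h)) //.
  by rewrite mulr_ge0 ?exprn_ge0 ?invr_ge0 ?(ltW rho0).
have -> : N.+1%:R * (M / rho ^+ N) * (rho ^+ N * 2^-1 ^+ N) = M * (N.+1%:R / 2 ^+ N).
  by rewrite exprVn; field; rewrite !expf_neq0 ?gt_eqF ?pnatr_eq0.
by rewrite ler_piMr // ler_pdivrMr ?exprn_gt0 // mul1r natrS_le_exp2.
Qed.

Definition subunit_hom (N : nat) (g : C -> C) : Prop :=
  exists e : nat -> C, \sum_(i < N.+1) cabs (e i) <= 1 /\
    forall w, g w = \sum_(i < N.+1) e i * w ^+ i * w^*%C ^+ (N - i).

Lemma subunit_homS N g (a b : C) : cabs a + cabs b <= 1 -> subunit_hom N g ->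
  subunit_hom N.+1 (fun w => (a * w + b * w^*%C) * g w).
Proof.
move=> ab [e [he hg]].
pose l i := if i is i'.+1 then a * e i' else 0.
pose r i := if (i < N.+1)%N then b * e i else 0.
have rN : r N.+1 = 0 by rewrite /r ltnn.
exists (fun i => l i + r i); split.
  apply: (@le_trans _ _ (\sum_(i < N.+2) cabs (l i) + \sum_(i < N.+2) cabs (r i))).
    by rewrite -big_split; apply: ler_sum => i _; exact: cabsD.
  rewrite big_ord_recl [X in _ + X <= _]big_ord_recr /= cabs0 add0r rN cabs0 addr0.
  under eq_bigr do rewrite /bump /= add0n cabsM.
  under [X in _ + X]eq_bigr => i _ do rewrite /r ltn_ord cabsM.
  rewrite -!mulr_sumr -mulrDl.
  by rewrite (le_trans _ ab) // ler_piMr // addr_ge0 ?cabs_ge0.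
move=> w; rewrite hg.
under [RHS]eq_bigr do rewrite -mulrA mulrDl.
rewrite big_split /= mulrDl; congr (_ + _).
  rewrite [RHS]big_ord_recl /= mul0r add0r mulr_sumr; apply: eq_bigr => i _.
  by rewrite /bump /= add1n subSS exprS; ring.
rewrite [RHS]big_ord_recr /= rN mul0r addr0 mulr_sumr; apply: eq_bigr => i _.
rewrite /r ltn_ord subSn; last by rewrite -ltnS.
by rewrite exprS; ring.
Qed.

Lemma subunit_hom_monomial j k : subunit_hom (j + k)
  (fun w => (complex.Re w)%:C%C ^+ j * (complex.Im w)%:C%C ^+ k).
Proof.
have ReE w : (complex.Re w)%:C%C = 2^-1 * w + 2^-1 * w^*%C :> C.
  case: w => x y; apply/eqP.
  by rewrite -mulrDr (_ : _ + _ = (2 * x)%:C%C) ?rmorphM ?rmorph_nat ?mulKf ?pnatr_eq0 //;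
    apply/eqP; rewrite eq_complex /=; apply/andP; split; apply/eqP; ring.
have i2 : 'i%C ^+ 2 = -1 :> C by rewrite sqr_i.
have i0 : 'i%C != 0 :> C by apply/eqP => e; move: i2; rewrite e expr0n /= => /eqP; rewrite eq_sym oppr_eq0 oner_eq0.
have ImE w : (complex.Im w)%:C%C = - (2^-1 * 'i%C) * w + (2^-1 * 'i%C) * w^*%C :> C.
  case: w => x y.
  have -> : - (2^-1 * 'i%C) * Complex x y + 2^-1 * 'i%C * (Complex x y)^*%C
      = 2^-1 * ('i%C * ((Complex x y)^*%C - Complex x y)) :> C by ring.
  by rewrite (_ : 'i%C * _ = (2 * y)%:C%C) ?rmorphM ?rmorph_nat ?mulKf ?pnatr_eq0 //;
    apply/eqP; rewrite eq_complex /=; apply/andP; split; apply/eqP; ring.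
have c2 : cabs (2^-1 : C) = 2^-1 by rewrite cabsV cabs_nat.
elim: j => [|j [e [he hg]]].
  elim: k => [|k IHk].
    exists (fun=> 1); rewrite big_ord1 cabs1; split=> // w.
    by rewrite big_ord1 !expr0 !mulr1.
  have := subunit_homS (a := - (2^-1 * 'i%C)) (b := 2^-1 * 'i%C) _ IHk.
  rewrite cabsN cabsM cabsi c2 mulr1 => /(_ _)[|e [he hg]]; first lra.
  exists e; split=> // w; rewrite -hg -ImE exprS; ring.
have IHj : subunit_hom (j + k) (fun w => (complex.Re w)%:C%C ^+ j * (complex.Im w)%:C%C ^+ k).
  by exists e.
have := subunit_homS (a := 2^-1) (b := 2^-1) _ IHj.
rewrite c2 => /(_ _)[|e' [he' hg']]; first lra.
exists e'; split=> // w; rewrite -hg' -ReE exprS; ring.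
Qed.

Definition conj_series (g : C -> C) (b : nat -> nat -> C) : Prop :=
  exists rho M : R, [/\ 0 < rho, coef_bound b rho M &
    forall w, cabs w < rho ->
      hasum (power_terms b w w^*%C) (g w)].

Lemma hasum_coef_bound (c : nat -> nat -> C) (rho : R) s : 0 <= rho ->
  hasum (power_terms c rho%:C%C rho%:C%C) s ->
  exists M, coef_bound c rho M.
Proof.
move=> r0 /hasum_bounded[M hM]; exists M => j k; have := hM (j, k).
by rewrite /= !cabsM !cabsX !cabsR ger0_norm // exprD mulrA.
Qed.

Lemma coef_boundS c rho rho' M : 0 < rho' <= rho -> coef_bound c rho M ->
  coef_bound c rho' M.
Proof.
move=> /andP[r0 rr] h j k; apply: le_trans (h j k).
by rewrite ler_wpM2l ?cabs_ge0 // lerXn2r ?nnegrE // ltW // (lt_le_trans r0).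
Qed.

(* Re w and Im w are linear forms in w and its conjugate whose coefficients have
   l1-norm 1, so rewriting a monomial in (x, y) does not increase the l1-norm of the
   coefficients and the radius of convergence only shrinks by a constant factor. *)
Lemma conj_series_of_xy (g : C -> C) (c : nat -> nat -> C) (r : R) : 0 < r ->
  (forall x y : R, `|x| < r -> `|y| < r ->
     hasum (power_terms c x%:C%C y%:C%C)
       (g (Complex x y))) ->
  exists b, conj_series g b.
Proof.
move=> r0 hg.
pose rho := r / 2; have rho0 : 0 < rho by rewrite divr_gt0.
have rhor : `|rho| < r by rewrite gtr0_norm // /rho; lra.
have [M hM] := hasum_coef_bound (ltW rho0) (hg rho rho rhor rhor).
have M0 : 0 <= M by rewrite (le_trans _ (hM 0%N 0%N)) // mulr_ge0 ?cabs_ge0 ?exprn_ge0 // ltW.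
have /choice[e he] : forall jk : nat * nat, exists e : nat -> C,
    \sum_(i < (jk.1 + jk.2).+1) cabs (e i) <= 1 /\
    forall w, (complex.Re w)%:C%C ^+ jk.1 * (complex.Im w)%:C%C ^+ jk.2 =
      \sum_(i < (jk.1 + jk.2).+1) e i * w ^+ i * w^*%C ^+ (jk.1 + jk.2 - i).
  by move=> [j k]; exact: subunit_hom_monomial.
pose b i l := \sum_(j < (i + l).+1) c j (i + l - j)%N * e (j : nat, (i + l - j)%N) i.
have eb j N i : (j <= N)%N -> (i < N.+1)%N -> cabs (e (j, (N - j)%N) i) <= 1.
  move=> jN iN; have [h _] := he (j, (N - j)%N); move: h; rewrite /= subnKC // => h.
  rewrite (le_trans _ h) // (bigD1 (Ordinal iN)) //= lerDl sumr_ge0 // => *; exact: cabs_ge0.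
have hb : coef_bound b (rho / 2) M.
  move=> i l; rewrite /b; set N := (i + l)%N.
  by apply: (diag_coef_bound (e := fun j => e (j, (N - j)%N) i) rho0 hM) => j jN; rewrite eb // ltnS leq_addr.
exists b, (rho / 4), M; split; first by rewrite divr_gt0.
  by apply: coef_boundS hb; apply/andP; split; lra.
move=> w wr.
have w2 : cabs w <= rho / 2 / 2 by lra.
have rho2 : 0 < rho / 2 by lra.
have cw2 : cabs (w^*%C) <= rho / 2 / 2 by rewrite cabs_conj.
have bs := coef_bound_bsum rho2 hb w2 cw2.
have [s' hs'] := bsum_hasum bs.
have [+ _] := diag_bsum bs hs'.
have xr : `|complex.Re w| <= rho / 2 by rewrite (le_trans (Re_le_cabs _)) //; lra.
have yr : `|complex.Im w| <= rho / 2 by rewrite (le_trans (Im_le_cabs _)) //; lra.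
have bc : bsum (power_terms c (complex.Re w)%:C%C (complex.Im w)%:C%C) (M * 4).
  by apply: (coef_bound_bsum rho0 hM); rewrite cabsR.
have wE : w = Complex (complex.Re w) (complex.Im w) by case: (w).
have hgw : hasum (power_terms c (complex.Re w)%:C%C (complex.Im w)%:C%C) (g w).
  by rewrite {3}wE; apply: hg; rewrite (le_lt_trans _ rhor) // (ger0_norm (ltW rho0)); lra.
have [+ _] := diag_bsum bc hgw => h1 h2.
suff -> : g w = s' by [].
apply: (hasum_unique h1); apply: eq_hasum h2 => N /=.
under eq_bigr => i _.
  rewrite /b subnKC; last by rewrite -ltnS.
  rewrite !mulr_suml; over.
rewrite exchange_big /=; apply: eq_bigr => j _.
have jN : (j <= N)%N by rewrite -ltnS.
have [_] := he (j : nat, (N - j)%N); rewrite /= subnKC // => /(_ w) hw.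
rewrite -mulrA hw mulr_sumr; apply: eq_bigr => i _; ring.
Qed.

Section Derivative.

(** The induction step for [monomial_remainder]: [P] is a perturbed product, [X] its unperturbed
    value and [L] its linear part. Size, first difference and second-order remainder must be
    propagated together when a factor x + h is added. *)
Lemma mul_remainder (A eta d T : R) (P X L x h : C) : 0 <= A -> 0 < eta ->
  0 <= T -> cabs x <= A -> cabs h <= d -> 0 <= d <= eta ->
  cabs P <= T -> cabs (P - X) <= d / eta * T ->
  cabs (P - X - L) <= (d / eta) ^+ 2 * T ->
  [/\ cabs (P * (x + h)) <= T * (A + eta),
      cabs (P * (x + h) - X * x) <= d / eta * (T * (A + eta)) &
      cabs (P * (x + h) - X * x - (L * x + X * h)) <= (d / eta) ^+ 2 * (T * (A + eta))].
Proof.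
move=> A0 e0 T0 xA hd /andP[d0 de] hP hPX hPXL.
have q0 : 0 <= d / eta by rewrite divr_ge0 // ltW.
have dE : d = d / eta * eta by rewrite divfK // gt_eqF.
have h0 := cabs_ge0 h; have x0 := cabs_ge0 x.
split.
- rewrite cabsM ler_pM ?cabs_ge0 // (le_trans (cabsD _ _)) //; lra.
- have -> : P * (x + h) - X * x = (P - X) * x + P * h by ring.
  rewrite (le_trans (cabsD _ _)) // !cabsM.
  apply: (@le_trans _ _ (d / eta * T * A + T * d)).
    by rewrite lerD // ler_pM ?cabs_ge0.
  rewrite {2}dE; set q := d / eta; rewrite le_eqVlt; apply/orP; left; apply/eqP; ring.
- have -> : P * (x + h) - X * x - (L * x + X * h) = (P - X - L) * x + (P - X) * h by ring.
  rewrite (le_trans (cabsD _ _)) // !cabsM.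
  apply: (@le_trans _ _ ((d / eta) ^+ 2 * T * A + d / eta * T * d)).
    by rewrite lerD // ler_pM ?cabs_ge0.
  rewrite {3}dE; set q := d / eta; rewrite le_eqVlt; apply/orP; left; apply/eqP; ring.
Qed.

(** The bound is geometric in j + k, with no further factor depending on the degree, and can thus be
    summed directly against a Cauchy estimate. *)
Lemma monomial_remainder (A eta d : R) (w h : C) j k : 0 <= A -> 0 < eta ->
  cabs w <= A -> cabs h <= d -> 0 <= d <= eta ->
  cabs ((w + h) ^+ j * (w + h)^*%C ^+ k - w ^+ j * w^*%C ^+ k
     - (j%:R * w ^+ j.-1 * w^*%C ^+ k * h + k%:R * w ^+ j * w^*%C ^+ k.-1 * h^*%C))
  <= (d / eta) ^+ 2 * (A + eta) ^+ (j + k).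
Proof.
move=> A0 e0 wA hd de.
have Ae : 0 <= A + eta by rewrite addr_ge0 // ltW.
have dd : 0 <= d by case/andP: de.
have q0 : 0 <= d / eta by rewrite divr_ge0 // ltW.
suff [] : [/\ cabs ((w + h) ^+ j * (w + h)^*%C ^+ k) <= (A + eta) ^+ (j + k),
   cabs ((w + h) ^+ j * (w + h)^*%C ^+ k - w ^+ j * w^*%C ^+ k)
     <= d / eta * (A + eta) ^+ (j + k) &
   cabs ((w + h) ^+ j * (w + h)^*%C ^+ k - w ^+ j * w^*%C ^+ k
     - (j%:R * w ^+ j.-1 * w^*%C ^+ k * h + k%:R * w ^+ j * w^*%C ^+ k.-1 * h^*%C))
  <= (d / eta) ^+ 2 * (A + eta) ^+ (j + k)] by [].
elim: k => [|k [h1 h2 h3]].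
  elim: j => [|j [h1 h2 h3]].
    by rewrite !expr0 !mul0r !mulr1 subrr addr0 subr0 cabs0 cabs1; split=> //; exact: exprn_ge0.
  rewrite ?(expr0, mulr1, mul0r, addr0, addn0) in h1 h2 h3 *.
  have [] := mul_remainder A0 e0 (exprn_ge0 j Ae) wA hd de h1 h2 h3.
  rewrite -!exprSr => g1 g2 g3; split => //.
  rewrite (_ : j.+1%:R * w ^+ j.+1.-1 * h = j%:R * w ^+ j.-1 * h * w + w ^+ j * h) //.
  case: j {h1 h2 h3 g1 g2 g3} => [|j]; first by rewrite !mul0r add0r expr0 !mul1r.
  by rewrite /= -[in LHS]natr1 exprSr; ring.
have [] := mul_remainder A0 e0 (exprn_ge0 (j + k) Ae) _ _ de h1 h2 h3 (x := w^*%C) (h := h^*%C);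
  rewrite ?cabs_conj //.
rewrite -!mulrA -rmorphD /= -!exprSr -addnS => g1 g2 g3; split => //.
rewrite (_ : j%:R * (w ^+ j.-1 * (w^*%C ^+ k.+1 * h)) + k.+1%:R * (w ^+ j * (w^*%C ^+ k * h^*%C))
  = (j%:R * (w ^+ j.-1 * (w^*%C ^+ k * h)) + k%:R * (w ^+ j * (w^*%C ^+ k.-1 * h^*%C))) * w^*%C
    + w ^+ j * (w^*%C ^+ k * h^*%C)) //.
case: k {h1 h2 h3 g1 g2 g3} => [|k]; first by rewrite !mul0r /= !expr0; ring.
by rewrite /= -[in LHS]natr1 !exprSr; ring.
Qed.

End Derivative.

End PowerSeries.

(** * Termwise Wirtinger derivatives *)

Section Wirtinger.
Variable R : realType.
Local Notation C := R[i].

Lemma derive1_quadratic (f : R -> R) (l K delta : R) : 0 < delta ->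
  (forall t, `|t| < delta -> `|f t - f 0 - t * l| <= K * t ^+ 2) -> derive1 f 0 = l.
Proof.
move=> d0 h; rewrite /derive1; apply: cvg_lim => //.
apply/cvgrPdist_le => e e0.
have K1 : 0 < `|K| + 1 by rewrite ltr_wpDl.
near=> t.
have t0 : t != 0 by near: t; exact: nbhs_dnbhs_neq.
have td : `|t| < Num.min delta (e / (`|K| + 1)).
  near: t; apply: dnbhs0_lt; rewrite lt_min d0 divr_gt0 //.
move: td; rewrite lt_min => /andP[td te].
have {}h := h _ td.
rewrite addr0 distrC.
have -> : t^-1 *: (f t - f 0) - l = t^-1 * (f t - f 0 - t * l).
  by rewrite /GRing.scale /= [RHS]mulrBr mulKf.
rewrite normrM normfV ler_pdivrMl ?normr_gt0 // (le_trans h) // -[t ^+ 2]ger0_norm ?sqr_ge0 //.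
rewrite normrX expr2 mulrCA ler_wpM2l //.
rewrite (@le_trans _ _ ((`|K| + 1) * `|t|)) //.
  by rewrite ler_wpM2r // (le_trans (ler_norm _)) // lerDl.
by rewrite mulrC -ler_pdivlMr // ltW.
Unshelve. all: by end_near. Qed.

Lemma dir_derive_quadratic (g : C -> C) (w v L : C) (K delta : R) : 0 < delta ->
  (forall t : R, `|t| < delta ->
     cabs (g (w + t%:C%C * v) - g w - t%:C%C * L) <= K * t ^+ 2) ->
  dir_derive v g w = L.
Proof.
move=> d0 h; have g0 : g (w + 0%:C%C * v) = g w by rewrite mul0r addr0.
have ReZ (t : R) (z : C) : complex.Re (t%:C%C * z) = t * complex.Re z.
  by case: z => a b /=; ring.
have ImZ (t : R) (z : C) : complex.Im (t%:C%C * z) = t * complex.Im z.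
  by case: z => a b /=; ring.
have ReB (x y : C) : complex.Re (x - y) = complex.Re x - complex.Re y by case: x; case: y.
have ImB (x y : C) : complex.Im (x - y) = complex.Im x - complex.Im y by case: x; case: y.
rewrite /dir_derive; case: L h => a b h; congr Complex.
  apply: (derive1_quadratic d0 (K := K)) => t td; rewrite g0.
  apply: le_trans (h _ td); rewrite (le_trans _ (Re_le_cabs _)) //.
  by rewrite !ReB ReZ.
apply: (derive1_quadratic d0 (K := K)) => t td; rewrite g0.
apply: le_trans (h _ td); rewrite (le_trans _ (Im_le_cabs _)) //.
by rewrite !ImB ImZ.
Qed.

Definition coef_dz (b : nat -> nat -> C) j k : C := j.+1%:R * b j.+1 k.
Definition coef_dzb (b : nat -> nat -> C) j k : C := k.+1%:R * b j k.+1.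

Implicit Types (b : nat -> nat -> C) (rho M : R) (g : C -> C).

Lemma coef_bound_ge0 b rho M : 0 < rho -> coef_bound b rho M -> 0 <= M.
Proof.
move=> rho0 hb.
by rewrite (le_trans _ (hb 0%N 0%N)) // mulr_ge0 ?cabs_ge0 ?exprn_ge0 // ltW.
Qed.

Lemma coef_boundE b rho M j k : 0 < rho -> coef_bound b rho M ->
  cabs (b j k) <= M * rho^-1 ^+ (j + k).
Proof. by move=> rho0 hb; rewrite exprVn ler_pdivlMr ?exprn_gt0 // hb. Qed.

(** The factor j + 1 of differentiation is at most 2^j and is absorbed by the smaller radius. *)
Lemma coef_bound_dz b rho M : 0 < rho -> coef_bound b rho M ->
  coef_bound (coef_dz b) (rho / 4) (M / rho).
Proof.
move=> rho0 hb; have M0 := coef_bound_ge0 rho0 hb; have bE j k := coef_boundE j k rho0 hb.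
move=> j k; rewrite /coef_dz cabsM cabs_nat.
apply: (@le_trans _ _ (2 ^+ j * (M * rho^-1 ^+ (j.+1 + k)) * (rho / 4) ^+ (j + k))).
  rewrite ler_wpM2r ?exprn_ge0 ?divr_ge0 ?(ltW rho0) //.
  by rewrite ler_pM ?cabs_ge0 // natrS_le_exp2.
have -> : 2 ^+ j * (M * rho^-1 ^+ (j.+1 + k)) * (rho / 4) ^+ (j + k)
    = M / rho * (2 ^+ j / 4 ^+ (j + k)).
  rewrite addSn exprS !exprMn !exprVn; field.
  by rewrite !expf_neq0 ?pnatr_eq0 // gt_eqF.
rewrite ler_piMr ?divr_ge0 ?(ltW rho0) // ler_pdivrMr ?exprn_gt0 // mul1r.
rewrite exprD (le_trans (y := 4 ^+ j)) //; first by rewrite lerXn2r ?nnegrE //; lra.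
by rewrite ler_peMr ?exprn_ge0 // exprn_ege1 //; lra.
Qed.

Lemma coef_bound_dzb b rho M : 0 < rho -> coef_bound b rho M ->
  coef_bound (coef_dzb b) (rho / 4) (M / rho).
Proof.
move=> rho0 hb j k; rewrite addnC.
apply: (@coef_bound_dz (fun j k => b k j) rho M rho0 _ k j) => j' k'.
by rewrite addnC hb.
Qed.

(** Reindexing by (j, k) -> (j + 1, k); the missing terms with exponent 0 have the factor 0. *)
Lemma hasum_shift1 b rho M (w : C) A : 0 < rho -> coef_bound b rho M ->
  cabs w < rho / 8 ->
  hasum (power_terms (coef_dz b) w w^*%C) A ->
  hasum (fun i : nat * nat => b i.1 i.2 * (i.1%:R * w ^+ i.1.-1 * w^*%C ^+ i.2)) A.
Proof.
move=> rho0 hb; have M0 := coef_bound_ge0 rho0 hb; have bE j k := coef_boundE j k rho0 hb.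
move=> wr hA.
have r4 : 0 < rho / 4 by lra.
have w8 : cabs w <= rho / 4 / 2 by lra.
have cw8 : cabs (w^*%C) <= rho / 4 / 2 by rewrite cabs_conj.
have bs := coef_bound_bsum r4 (coef_bound_dz rho0 hb) w8 cw8.
apply: (hasum_partition (pi := fun i : nat * nat => (i.1.+1, i.2)) bs hA) => -[j k].
case: j => [|j].
  rewrite /= !mul0r mulr0; have := @hasum_fin R _ (fun=> 0) (@fset0 (nat * nat)%type) (fun _ _ => erefl).
  rewrite big_seq_fset0; apply: eq_hasum => -[j' k'] //.
have := @hasum_seq R _ (fun i : nat * nat => if (i.1.+1, i.2) == (j.+1, k)
   then coef_dz b i.1 i.2 * w ^+ i.1 * w^*%C ^+ i.2 else 0) [:: (j, k)] isT.
rewrite big_seq1 /= eqxx /coef_dz => h.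
rewrite (_ : b j.+1 k * _ = j.+1%:R * b j.+1 k * w ^+ j * w^*%C ^+ k); last by ring.
by apply: h => -[j' k']; rewrite inE !xpair_eqE ?eqSS => /negbTE ->.
Qed.

Lemma hasum_shift2 b rho M (w : C) A : 0 < rho -> coef_bound b rho M ->
  cabs w < rho / 8 ->
  hasum (power_terms (coef_dzb b) w w^*%C) A ->
  hasum (fun i : nat * nat => b i.1 i.2 * (i.2%:R * w ^+ i.1 * w^*%C ^+ i.2.-1)) A.
Proof.
move=> rho0 hb; have M0 := coef_bound_ge0 rho0 hb; have bE j k := coef_boundE j k rho0 hb.
move=> wr hA.
have r4 : 0 < rho / 4 by lra.
have w8 : cabs w <= rho / 4 / 2 by lra.
have cw8 : cabs (w^*%C) <= rho / 4 / 2 by rewrite cabs_conj.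
have bs := coef_bound_bsum r4 (coef_bound_dzb rho0 hb) w8 cw8.
apply: (hasum_partition (pi := fun i : nat * nat => (i.1, i.2.+1)) bs hA) => -[j k].
case: k => [|k].
  rewrite /= !mul0r mulr0; have := @hasum_fin R _ (fun=> 0) (@fset0 (nat * nat)%type) (fun _ _ => erefl).
  rewrite big_seq_fset0; apply: eq_hasum => -[j' k'].
  by rewrite xpair_eqE andbF.
have := @hasum_seq R _ (fun i : nat * nat => if (i.1, i.2.+1) == (j, k.+1)
   then coef_dzb b i.1 i.2 * w ^+ i.1 * w^*%C ^+ i.2 else 0) [:: (j, k)] isT.
rewrite big_seq1 /= eqxx /coef_dzb => h.
rewrite (_ : b j k.+1 * _ = k.+1%:R * b j k.+1 * w ^+ j * w^*%C ^+ k); last by ring.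
by apply: h => -[j' k']; rewrite inE !xpair_eqE ?eqSS => /negbTE ->.
Qed.

(** The difference quotient is handled term by term with [monomial_remainder], both [A] and [eta]
    there being rho / 4; powers of (rho / 2) / rho remain, and these are summable. *)
Lemma dir_derive_conj_series b rho M g (w v A B : C) : 0 < rho -> coef_bound b rho M ->
  (forall w, cabs w < rho ->
    hasum (power_terms b w w^*%C) (g w)) ->
  cabs w < rho / 8 -> cabs v <= 1 ->
  hasum (power_terms (coef_dz b) w w^*%C) A ->
  hasum (power_terms (coef_dzb b) w w^*%C) B ->
  dir_derive v g w = v * A + v^*%C * B.
Proof.
move=> rho0 hb; have M0 := coef_bound_ge0 rho0 hb; have bE j k := coef_boundE j k rho0 hb.
move=> hg wr v1 /(hasum_shift1 rho0 hb wr) hA /(hasum_shift2 rho0 hb wr) hB.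
have r4 : 0 < rho / 4 by lra.
(* The 4 after [M] is the double geometric sum; (rho / 4)^2 is the scale of the quadratic
   remainder. *)
apply: (@dir_derive_quadratic _ _ _ _ (M * 4 / (rho / 4) ^+ 2) (rho / 4)) => // t tr.
have hv : cabs (t%:C%C * v) <= `|t| by rewrite cabsM cabsR ler_piMr.
have wt : cabs (w + t%:C%C * v) < rho by rewrite (le_lt_trans (cabsD _ _)) //; lra.
have wr' : cabs w < rho by lra.
have h := hasumB (hasumB (hg _ wt) (hg _ wr'))
  (hasumD (hasumZ (t%:C%C * v) hA) (hasumZ ((t%:C%C * v)^*%C) hB)).
rewrite (_ : t%:C%C * (_ + _) = t%:C%C * v * A + (t%:C%C * v)^*%C * B); last first.
  have -> : (t%:C%C * v)^*%C = t%:C%C * v^*%C by rewrite rmorphM [X in X * _ = _]conjc_real.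
  ring.
apply: bsum_hasum_bound h.
have -> : M * 4 / (rho / 4) ^+ 2 * t ^+ 2 = (`|t| / (rho / 4)) ^+ 2 * (M * 4).
  by rewrite -(real_normK (num_real t)) [in RHS]exprMn exprVn; ring.
apply: (@rsum_le _ _ _ (fun i => (`|t| / (rho / 4)) ^+ 2 * (M * 2^-1 ^+ (i.1 + i.2)))); last first.
  by apply: rsumZ; [rewrite sqr_ge0|apply: rsumZ; [|exact: rsum_half2]].
move=> [j k] /=; set h' := t%:C%C * v.
rewrite (_ : _ - _ - _ = b j k * ((w + h') ^+ j * (w + h')^*%C ^+ k - w ^+ j * w^*%C ^+ k
     - (j%:R * w ^+ j.-1 * w^*%C ^+ k * h' + k%:R * w ^+ j * w^*%C ^+ k.-1 * h'^*%C))); last by ring.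
rewrite cabsM.
have wr4 : cabs w <= rho / 4 by lra.
have td : 0 <= `|t| <= rho / 4 by rewrite normr_ge0 ltW.
have := monomial_remainder j k (ltW r4) r4 wr4 hv td.
rewrite (_ : rho / 4 + rho / 4 = rho / 2); last by field.
move=> /(ler_pM (cabs_ge0 _) (cabs_ge0 _) (bE j k)) /le_trans; apply.
move: (`|t| / (rho / 4)) => q; rewrite exprMn !exprVn le_eqVlt; apply/orP; left; apply/eqP.
by field; rewrite !expf_neq0 ?pnatr_eq0 // gt_eqF.
Qed.

(** The derivatives along 1 and i are A + B and i (A - B); the Wirtinger combinations isolate A and
    B. *)
Lemma conj_series_wirtinger g b : conj_series g b ->
  conj_series (wirtinger g) (coef_dz b) /\ conj_series (wirtinger_bar g) (coef_dzb b).
Proof.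
case=> rho [M [rho0 hb hg]].
have r4 : 0 < rho / 4 by lra.
have key w : cabs w < rho / 8 -> exists A B : C,
   [/\ hasum (power_terms (coef_dz b) w w^*%C) A,
    hasum (power_terms (coef_dzb b) w w^*%C) B,
    wirtinger g w = A & wirtinger_bar g w = B].
  move=> wr; have w8 : cabs w <= rho / 4 / 2 by lra.
  have cw8 : cabs (w^*%C) <= rho / 4 / 2 by rewrite cabs_conj.
  have [A hA] := bsum_hasum (coef_bound_bsum r4 (coef_bound_dz rho0 hb) w8 cw8).
  have [B hB] := bsum_hasum (coef_bound_bsum r4 (coef_bound_dzb rho0 hb) w8 cw8).
  exists A, B; rewrite /wirtinger /wirtinger_bar.
  rewrite !(dir_derive_conj_series rho0 hb hg wr _ hA hB) ?cabs1 ?cabsi //.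
  have ii : 'i%C * 'i%C = -1 :> C by rewrite -expr2 sqr_i.
  have -> : 'i%C * ('i%C * A + ('i%C)^*%C * B) = B - A.
    by rewrite conjci (_ : _ * _ = ('i%C * 'i%C) * (A - B)); [rewrite ii; ring|ring].
  by rewrite rmorph1; split=> //; field.
split.
  exists (rho / 8), (M / rho); split; first by lra.
    by apply: coef_boundS (coef_bound_dz rho0 hb); apply/andP; split; lra.
  by move=> w /key[A [B [hA _ -> _]]].
exists (rho / 8), (M / rho); split; first by lra.
  by apply: coef_boundS (coef_bound_dzb rho0 hb); apply/andP; split; lra.
by move=> w /key[A [B [_ hB _ ->]]].
Qed.

Lemma conj_series0 g b : conj_series g b -> g 0 = b 0%N 0%N.
Proof.
case=> rho [M [rho0 hb hg]]; have := hg 0; rewrite cabs0 => /(_ rho0) h.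
have c0 : (0 : C)^*%C = 0 by exact: rmorph0.
rewrite c0 in h; apply: (hasum_unique h).
have := @hasum_seq R _ (power_terms b 0 0) [:: (0, 0)%N] isT.
rewrite big_seq1 /= !expr0 !mulr1; apply=> -[[|j] [|k]] //=.
- by rewrite exprS mul0r mulr0.
- by rewrite exprS !mul0r mulr0 mul0r.
- by rewrite exprS !mul0r mulr0 mul0r.
Qed.

(** Termwise differentiation followed by evaluation at 0. It makes the coefficients of any such
    expansion the Taylor coefficients. *)
Lemma wirtinger_iter_conj_series g b j k : conj_series g b ->
  wirtinger_iter j k g 0 = j`!%:R * k`!%:R * b j k.
Proof.
move=> h.
have h1 : conj_series (iter k (@wirtinger_bar R) g) (iter k coef_dzb b).
  by elim: k => //= k /conj_series_wirtinger[].
have h2 : conj_series (wirtinger_iter j k g) (iter j coef_dz (iter k coef_dzb b)).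
  by rewrite /wirtinger_iter; elim: j => //= j /conj_series_wirtinger[].
rewrite (conj_series0 h2).
have e1 c m l : (iter j coef_dz c) m l * m`!%:R = (m + j)`!%:R * c (m + j)%N l.
  elim: j m {h2} => [|j IHj] m /=; first by rewrite addn0 mulrC.
  by rewrite /coef_dz mulrAC -natrM -factS mulrC IHj addSnnS.
have e2 c m l : (iter k coef_dzb c) m l * l`!%:R = (l + k)`!%:R * c m (l + k)%N.
  elim: k l {h1 h2} => [|k IHk] l /=; first by rewrite addn0 mulrC.
  by rewrite /coef_dzb mulrAC -natrM -factS mulrC IHk addSnnS.
have := e1 (iter k coef_dzb b) 0%N 0%N; rewrite fact0 mulr1 => ->.
by have := e2 b j 0%N; rewrite fact0 mulr1 add0n => ->; rewrite add0n mulrA.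
Qed.

End Wirtinger.

(** * Identity theorem in one real variable *)

Section IdentityTheorem.
Variable R : realType.
Local Notation C := R[i].
Implicit Types (g : R -> C).

Definition analytic_at g (t0 : R) : Prop :=
  exists (c : nat -> C) (rho M : R), [/\ 0 < rho,
    forall n, cabs (c n) * rho ^+ n <= M &
    forall s, `|s| < rho -> hasum (fun n => c n * s%:C%C ^+ n) (g (t0 + s))].

Lemma analytic_at_sub g1 g2 t0 : analytic_at g1 t0 -> analytic_at g2 t0 ->
  analytic_at (fun t => g1 t - g2 t) t0.
Proof.
move=> [c1 [r1 [M1 [r10 h1 s1]]]] [c2 [r2 [M2 [r20 h2 s2]]]].
have r0 : 0 < Num.min r1 r2 by rewrite lt_min r10.
exists (fun n => c1 n - c2 n), (Num.min r1 r2), (M1 + M2); split => // [n|s].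
  have le1 : Num.min r1 r2 ^+ n <= r1 ^+ n.
    by rewrite lerXn2r ?nnegrE ?(ltW r0) ?(ltW r10) // ge_min lexx.
  have le2 : Num.min r1 r2 ^+ n <= r2 ^+ n.
    by rewrite lerXn2r ?nnegrE ?(ltW r0) ?(ltW r20) // ge_min lexx orbT.
  apply: (@le_trans _ _ ((cabs (c1 n) + cabs (c2 n)) * Num.min r1 r2 ^+ n)).
    rewrite ler_wpM2r ?exprn_ge0 ?(ltW r0) //.
    by rewrite (le_trans (cabsD _ _)) // cabsN.
  rewrite mulrDl lerD //.
    by apply: le_trans (h1 n); rewrite ler_wpM2l ?cabs_ge0.
  by apply: le_trans (h2 n); rewrite ler_wpM2l ?cabs_ge0.
rewrite lt_min => /andP[/s1 {}s1 /s2 {}s2].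
by apply: eq_hasum (hasumB s1 s2) => n; rewrite mulrBl.
Qed.

(** Strong induction: with the earlier coefficients gone, dividing by s^n bounds [c n] by a multiple
    of s. Vanishing is assumed to the left of the centre only, because the identity theorem applies
    this at the supremum of the points reached so far. *)
Lemma power_series_coef_eq0 (c : nat -> C) (rho M delta : R) :
  0 < rho -> 0 < delta -> (forall n, cabs (c n) * rho ^+ n <= M) ->
  (forall s : R, - delta < s < 0 -> hasum (fun n => c n * s%:C%C ^+ n) 0) ->
  forall n, c n = 0.
Proof.
move=> rho0 d0 hM hs n; have [m] := ubnP n; elim: m n => // m IHm n nm.
have lown i : (i < n)%N -> c i = 0 by move=> iN; apply: IHm; exact: leq_trans iN _.
have M0 : 0 <= M by rewrite (le_trans _ (hM 0%N)) // mulr_ge0 ?cabs_ge0 ?exprn_ge0 // ltW.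
have cE i : cabs (c i) <= M * rho^-1 ^+ i by rewrite exprVn ler_pdivlMr ?exprn_gt0.
(* The tail from n + 1 on is compared with the full series of powers of 1/2, of sum 2, which costs
   another factor 2^(n+1). *)
pose K := M * rho^-1 ^+ n.+1 * 2 ^+ n.+2.
have ri0 : 0 <= rho^-1 by rewrite invr_ge0 ltW.
have K0 : 0 <= K.
  by apply: mulr_ge0; [apply: mulr_ge0|]; rewrite ?exprn_ge0.
have main s : 0 < s -> s < delta -> s <= rho / 2 -> cabs (c n) <= s * K.
  move=> s0 sd sr.
  have /hs h : - delta < - s < 0 by rewrite ltrN2 sd oppr_lt0.
  have := @hasum_seq R _ (fun i => if i == n then c n * (- s)%:C%C ^+ n else 0) [:: n] isT.
  rewrite big_seq1 eqxx => hn.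
  have {}hn : hasum (fun i => if i == n then c n * (- s)%:C%C ^+ n else 0) (c n * (- s)%:C%C ^+ n).
    by apply: hn => i; rewrite inE => /negbTE ->.
  have := bsum_hasum_bound _ (hasumB hn h).
  rewrite subr0 cabsM cabsX cabsR normrN gtr0_norm // => hb.
  rewrite -(ler_pM2r (exprn_gt0 n s0)).
  rewrite (_ : s * K * s ^+ n = (s * rho^-1) ^+ n.+1 * (2 ^+ n.+1 * (M * 2))); last first.
    by rewrite exprMn /K [2 ^+ n.+2]exprSr [s ^+ n.+1]exprS; ring.
  apply: hb.
  apply: (@rsum_le _ _ _ (fun i => (s * rho^-1) ^+ n.+1 * (2 ^+ n.+1 * (M * 2^-1 ^+ i)))); last first.
    have sr0 : 0 <= s * rho^-1 by rewrite mulr_ge0 // ltW.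
    apply: rsumZ; first exact: exprn_ge0.
    by apply: rsumZ; [exact: exprn_ge0|apply: rsumZ => //; exact: rsum_half].
  move=> i; have sr0 : 0 <= s * rho^-1 by rewrite mulr_ge0 // ltW.
  have rhs0 : 0 <= (s * rho^-1) ^+ n.+1 * (2 ^+ n.+1 * (M * 2^-1 ^+ i)).
    apply: mulr_ge0; first exact: exprn_ge0.
    apply: mulr_ge0; first exact: exprn_ge0.
    by apply: mulr_ge0 => //; rewrite exprn_ge0 // invr_ge0.
  have [ni|ni|e] := ltngtP i n; last by move: rhs0; rewrite e subrr cabs0.
    by rewrite (lown _ ni) mul0r subr0 cabs0.
  rewrite sub0r cabsN cabsM cabsX cabsR normrN gtr0_norm //.
  apply: (@le_trans _ _ (M * (s * rho^-1) ^+ i)).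
    by rewrite exprMn (mulrC (s ^+ i)) mulrA ler_wpM2r // exprn_ge0 // ltW.
  rewrite -(subnKC ni) !exprD.
  have hh : s * rho^-1 <= 2^-1 by rewrite ler_pdivrMr //; lra.
  have -> : (s * rho^-1) ^+ n.+1 * (2 ^+ n.+1 * (M * (2^-1 ^+ n.+1 * 2^-1 ^+ (i - n.+1))))
     = M * ((s * rho^-1) ^+ n.+1 * 2^-1 ^+ (i - n.+1)).
    by rewrite [2^-1 ^+ n.+1]exprVn; field; rewrite !expf_neq0 ?pnatr_eq0 // gt_eqF.
  rewrite !ler_wpM2l ?exprn_ge0 // lerXn2r ?nnegrE // invr_ge0; lra.
apply/cabs_le0P => e e0.
pose s := Num.min (delta / 2) (Num.min (rho / 2) (e / (K + 1))).
have K1 : 0 < K + 1 by rewrite ltr_wpDl.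
have s0 : 0 < s by rewrite !lt_min !divr_gt0.
have [s1 s2 s3] : [/\ s <= delta / 2, s <= rho / 2 & s <= e / (K + 1)].
  by split; rewrite !ge_min lexx ?orbT.
have sd : s < delta by lra.
rewrite (le_trans (main s s0 sd s2)) // (@le_trans _ _ (s * (K + 1))) //.
  by rewrite ler_wpM2l ?(ltW s0) // lerDl.
by rewrite -ler_pdivlMr.
Qed.

Lemma analytic_at_eq0 g (t0 delta : R) : analytic_at g t0 -> 0 < delta ->
  (forall t : R, t0 - delta < t < t0 -> g t = 0) ->
  exists2 r : R, 0 < r & forall t : R, t0 - r < t < t0 + r -> g t = 0.
Proof.
move=> [c [rho [M [rho0 hM hs]]]] d0 h.
have dr0 : 0 < Num.min delta rho by rewrite lt_min d0.
have c0 := power_series_coef_eq0 rho0 dr0 hM.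
have {}c0 n : c n = 0.
  apply: c0 => s /andP[s1 s2].
  have /andP[sd sr] : (- delta < s) && (- rho < s).
    have m1 : Num.min delta rho <= delta by rewrite ge_min lexx.
    have m2 : Num.min delta rho <= rho by rewrite ge_min lexx orbT.
    by apply/andP; split; lra.
  have <- : g (t0 + s) = 0 by apply: h; apply/andP; split; lra.
  by apply: hs; rewrite ltr_norml; apply/andP; split; lra.
exists rho => // t /andP[t1 t2].
have tr : `|t - t0| < rho by rewrite ltr_norml; apply/andP; split; lra.
have tE : t0 + (t - t0) = t by rewrite addrC subrK.
have := hs _ tr; rewrite tE => ht.
apply: (hasum_unique ht); have := @hasum_fin R _ (fun=> 0) (@fset0 nat) (fun _ _ => erefl).
by rewrite big_seq_fset0; apply: eq_hasum => n; rewrite c0 mul0r.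
Qed.

Lemma identity_theorem g (delta : R) : (forall t : R, 0 <= t < 1 -> analytic_at g t) ->
  0 < delta -> (forall t : R, 0 <= t < delta -> g t = 0) ->
  forall t : R, 0 <= t < 1 -> g t = 0.
Proof.
move=> ha d0 h0 t /andP[t0 t1].
pose S := [set x : R | 0 <= x < 1 /\ forall y : R, 0 <= y <= x -> g y = 0].
have S1 : has_ubound S by exists 1 => x [/andP[_ /ltW]].
have d'0 : 0 < Num.min (delta / 2) 2^-1 by rewrite lt_min divr_gt0 //= invr_gt0.
have d'1 : Num.min (delta / 2) 2^-1 <= 2^-1 by rewrite ge_min lexx orbT.
have d'2 : Num.min (delta / 2) 2^-1 <= delta / 2 by rewrite ge_min lexx.
have Sd : S (Num.min (delta / 2) 2^-1).
  split; first by apply/andP; split; lra.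
  by move=> y /andP[y0 yd]; apply: h0; apply/andP; split; lra.
have Ss : has_sup S by split => //; exists (Num.min (delta / 2) 2^-1).
have supd : Num.min (delta / 2) 2^-1 <= sup S by exact: ub_le_sup.
have below (x : R) : 0 <= x < sup S -> g x = 0.
  move=> /andP[x0 xs].
  have e0 : 0 < sup S - x by rewrite subr_gt0.
  have [y [_ hy] yx] := sup_adherent e0 Ss.
  by apply: hy; apply/andP; split => //; apply: ltW; move: yx; rewrite opprB addrC subrK.
have [s1|s1] := leP 1 (sup S); first by apply: below; rewrite t0 (lt_le_trans t1).
have s01 : 0 <= sup S < 1 by apply/andP; split => //; lra.
have [|r r0 hr] := analytic_at_eq0 (ha _ s01) d'0.
  by move=> x /andP[x1 x2]; apply: below; rewrite x2 andbT; lra.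
(* If the supremum were below 1, analyticity there would push the vanishing to its right, up to this
   point. *)
pose x := sup S + Num.min (r / 2) ((1 - sup S) / 2).
have m0 : 0 < Num.min (r / 2) ((1 - sup S) / 2) by rewrite lt_min !divr_gt0 // subr_gt0.
have m1 : Num.min (r / 2) ((1 - sup S) / 2) <= r / 2 by rewrite ge_min lexx.
have m2 : Num.min (r / 2) ((1 - sup S) / 2) <= (1 - sup S) / 2 by rewrite ge_min lexx orbT.
have : S x.
  split; first by rewrite /x; apply/andP; split; lra.
  move=> y /andP[y0 yx]; have [ys|ys] := ltP y (sup S); first by apply: below; rewrite y0.
  by apply: hr; move: yx; rewrite /x => yx; apply/andP; split; lra.
by move=> /(ub_le_sup S1); rewrite /x gerDl leNgt m0.
Qed.

(** Recentring at t. The binomial expansion gives a family over pairs (N, i), absolutely summable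
    for |s| < 1 - t; grouping by N returns the value at t + s, and grouping by i gives the power
    series in s. *)
Lemma analytic_at_sum (b : nat -> C) A g : bsum b A ->
  (forall t : R, `|t| <= 1 -> hasum (fun N => b N * t%:C%C ^+ N) (g t)) ->
  forall t : R, 0 <= t < 1 -> analytic_at g t.
Proof.
move=> hA hg t /andP[t0 t1].
pose rho := 1 - t; have rho0 : 0 < rho by rewrite subr_gt0.
pose a (k : nat * nat) : C := b k.1 * 'C(k.1, k.2)%:R * t%:C%C ^+ (k.1 - k.2).
have [u uE] : exists u : R -> nat * nat -> C, forall s k,
    u s k = if (k.2 <= k.1)%N then a k * s%:C%C ^+ k.2 else 0 by eexists.
have fib s N : \sum_(k <- [seq (N, i) | i <- iota 0 N.+1]) u s k = b N * (t + s)%:C%C ^+ N.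
  rewrite big_map rmorphD exprDn -(big_mkord xpredT (fun i =>
    t%:C%C ^+ (N - i) * s%:C%C ^+ i *+ 'C(N, i))) /index_iota subn0 mulr_sumr.
  apply: eq_big_seq => i; rewrite mem_iota add0n ltnS uE /= => iN; rewrite iN.
  by rewrite /a -mulr_natr; ring.
have fibabs s N : 0 <= s ->
   \sum_(k <- [seq (N, i) | i <- iota 0 N.+1]) cabs (u s k) = cabs (b N) * (t + s) ^+ N.
  move=> s0; rewrite big_map exprDn -(big_mkord xpredT (fun i =>
    t ^+ (N - i) * s ^+ i *+ 'C(N, i))) /index_iota subn0 mulr_sumr.
  apply: eq_big_seq => i; rewrite mem_iota add0n ltnS uE /= => iN; rewrite iN.
  rewrite cabsM /a (cabsM (b N * _)) (cabsM (b N)) cabs_nat !cabsX !cabsR !ger0_norm //.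
  by rewrite -mulr_natr; ring.
clearbody a.
have uabs s : 0 <= s <= rho -> bsum (u s) A.
  move=> /andP[s0 sr]; apply: (rsum_fibre (pi := fst) _ hA) => N r ur hr.
  apply: (@le_trans _ _ (\sum_(k <- [seq (N, i) | i <- iota 0 N.+1]) cabs (u s k))).
    set T := [seq _ | i <- _].
    rewrite (bigID (fun k : nat * nat => (k.2 <= k.1)%N)) /=.
    rewrite [X in _ + X]big1 ?addr0 => [|k /negbTE]; last by rewrite uE => ->; rewrite cabs0.
    rewrite -big_filter; apply: sum_uniq_subset.
    - by move=> k; exact: cabs_ge0.
    - exact: filter_uniq.
    - by rewrite /T map_inj_uniq ?iota_uniq // => i j [].
    move=> [N' i]; rewrite /T mem_filter => /andP[iN /hr N'N]; rewrite /= in iN N'N.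
    by apply/mapP; exists i; rewrite ?mem_iota ?add0n ?ltnS -?N'N.
  rewrite fibabs // ler_piMr ?cabs_ge0 // exprn_ile1 ?addr_ge0 //.
  by move: sr; rewrite /rho; lra.
have uN s k : cabs (u s k) = cabs (u `|s| k).
  by rewrite !uE; case: (k.2 <= k.1)%N; [rewrite !(cabsM (a k)) !cabsX !cabsR normr_id|].
have uabs' s : `|s| < rho -> bsum (u s) A.
  move=> sr; apply: (@bsum_le R _ (u s) (u `|s|)) => [k|]; first by rewrite uN.
  by apply: uabs; rewrite normr_ge0 ltW.
(* At s = 1 the power of s disappears, so [w] holds the coefficients of the recentred family. *)
have [w wE] : exists w : nat * nat -> C, forall k, w k = u 1 k by eexists.
have wrho k : cabs (u rho k) = cabs (w k) * rho ^+ k.2.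
  rewrite wE !uE; case: (k.2 <= k.1)%N; last by rewrite cabs0 mul0r.
  by rewrite !(cabsM (a k)) !cabsX !cabsR normr1 expr1n mulr1 (gtr0_norm rho0).
have hrho : bsum (u rho) A by apply: uabs; rewrite ltW /=.
have wfib i : bsum (fun k : nat * nat => if k.2 == i then w k else 0) (A / rho ^+ i).
  move=> r ur; rewrite ler_pdivlMr ?exprn_gt0 // mulr_suml.
  apply: (le_trans _ (hrho r ur)); apply: ler_sum => k _; rewrite wrho.
  case: eqP => [<- //|_]; rewrite cabs0 mul0r mulr_ge0 ?cabs_ge0 ?exprn_ge0 //; exact: ltW.
have /choice[c hc] : forall i, exists ci, hasum (fun k : nat * nat => if k.2 == i then w k else 0) ci.
  by move=> i; exact: bsum_hasum (wfib i).
exists c, rho, A; split => // [i|s sr].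
  by rewrite -ler_pdivlMr ?exprn_gt0 //; exact: bsum_hasum_bound (wfib i) (hc i).
have [S hS] := bsum_hasum (uabs' s sr).
have us k : u s k = w k * s%:C%C ^+ k.2.
  by rewrite wE !uE; case: (k.2 <= k.1)%N; rewrite ?mul0r // expr1n mulr1.
have h1 : hasum (fun N => b N * (t + s)%:C%C ^+ N) S.
  apply: (hasum_partition (pi := fst) (uabs' s sr) hS) => N.
  have := @hasum_seq R _ (fun k => if k.1 == N then u s k else 0) [seq (N, i) | i <- iota 0 N.+1].
  rewrite -fib (eq_big_seq (u s)) => [|k /mapP[i _ ->] /=]; last by rewrite eqxx.
  apply; first by rewrite map_inj_uniq ?iota_uniq // => i j [].
  move=> [N' i] hN; case: eqP hN => // <- /negP hN; rewrite uE; case: ifP => // iN.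
  by case: hN; apply/mapP; exists i => //; rewrite mem_iota add0n ltnS.
have h2 : hasum (fun i => c i * s%:C%C ^+ i) S.
  apply: (hasum_partition (pi := snd) (uabs' s sr) hS) => i.
  rewrite mulrC; apply: eq_hasum (hasumZ (s%:C%C ^+ i) (hc i)) => k.
  by case: eqP => [<-|_]; rewrite ?mulr0 // us mulrC.
rewrite (hasum_unique (hg (t + s) _) h1) //.
move: sr; rewrite ltr_norml /rho => /andP[s1 s2].
by rewrite ler_norml; apply/andP; split; lra.
Qed.

End IdentityTheorem.

(** * The Taylor series of the profile *)

Section Taylor.
Variable R : realType.
Local Notation C := R[i].

Lemma nbhs_complexP (w : C) (P : set C) :
  nbhs w P <-> exists2 d : R, 0 < d & forall x, cabs (x - w) < d -> P x.
Proof.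
rewrite -nbhs_nbhs_norm; split=> [[e /= e0 h]|[d d0 h]].
  have eE : e = (complex.Re e)%:C%C by rewrite RRe_real // gtr0_real.
  exists (complex.Re e); first by rewrite -ltcR -eE.
  by move=> x xw; apply: h; rewrite /= eE cabsE ltcR cabsB.
exists d%:C%C; first by rewrite /= ltcR.
by move=> x /=; rewrite cabsE ltcR cabsB; exact: h.
Qed.

Lemma interior_unit_disc (w : C) : (unit_disc R)° w <-> cabs w < 1.
Proof.
rewrite /interior; split=> [/nbhs_complexP[d d0 h]|w1].
  rewrite ltNge; apply/negP => w1.
  have w0 : 0 < cabs w by apply: lt_le_trans w1.
  pose t := d / (2 * cabs w).
  have t0 : 0 < t by rewrite divr_gt0 // mulr_gt0.
  have /h : cabs (w + t%:C%C * w - w) < d.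
    rewrite addrC addKr cabsM cabsR gtr0_norm //.
    rewrite (_ : t * cabs w = d / 2); last by rewrite /t; field; rewrite gt_eqF.
    by rewrite ltr_pdivrMr // ltr_pMr // ltr1n.
  rewrite /unit_disc /= -{1}[w]mul1r -mulrDl -[1]/(1%:C%C) -rmorphD cabsM cabsR.
  rewrite gtr0_norm ?addr_gt0 // leNgt => /negP; apply.
  by rewrite mulrDl mul1r ltr_pwDr // mulr_gt0.
apply/nbhs_complexP; exists (1 - cabs w); first by rewrite subr_gt0.
move=> x; rewrite /unit_disc /= ltrBrDr => /ltW h.
by rewrite (le_trans _ h) // -{1}[x](subrK w) cabsD.
Qed.

Variable phi : C -> C.
Hypothesis hphi : real_analytic_on (unit_disc R)° phi.
Hypothesis htaylor : forall w, cabs w = 1 -> abs_summable (taylor_term phi w).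

Definition taylor_coef j k : C := wirtinger_iter j k phi 0 / (j`!%:R * k`!%:R).

Lemma real_analytic_xy (w0 : C) : cabs w0 < 1 -> exists (c : nat -> nat -> C) (r : R),
  0 < r /\ forall x y : R, `|x| < r -> `|y| < r ->
     hasum (power_terms c x%:C%C y%:C%C)
       (phi (w0 + Complex x y)).
Proof.
move=> /interior_unit_disc /hphi[c [r [r0 h]]]; exists c, r; split=> // x y xr yr.
have /cvg_totally_hasum := h x y xr yr.
by apply: eq_hasum => -[j k]; rewrite /= !rmorphXn.
Qed.

Lemma taylor_coef_bsum : exists A, bsum (fun i : nat * nat => taylor_coef i.1 i.2) A.
Proof.
have /htaylor/abs_summableP[A hA] : cabs (1 : C) = 1 by rewrite cabs1.
exists A; apply: bsum_le hA => -[j k] /=.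
by rewrite /taylor_term rmorph1 !expr1n !mulr1.
Qed.

(** Real analyticity supplies some expansion in x and y; rewritten in w and its conjugate, its
    coefficients are forced by [wirtinger_iter_conj_series]. *)
Lemma taylor_conj_series : conj_series phi taylor_coef.
Proof.
have [|c [r [r0 h]]] := @real_analytic_xy 0; first by rewrite cabs0.
have [|b hb] := @conj_series_of_xy _ phi c r r0.
  by move=> x y xr yr; have := h x y xr yr; rewrite add0r.
have E : b = taylor_coef.
  apply/funext => j; apply/funext => k; rewrite /taylor_coef (wirtinger_iter_conj_series _ _ hb).
  by rewrite mulrC mulKf // mulf_neq0 // pnatr_eq0 -lt0n fact_gt0.
by rewrite -E.
Qed.

Lemma taylor_bsum A (w : C) : bsum (fun i : nat * nat => taylor_coef i.1 i.2) A ->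
  cabs w <= 1 -> bsum (power_terms taylor_coef w w^*%C) A.
Proof.
move=> hA w1; apply: bsum_le hA => -[j k] /=; move: (taylor_coef j k) => c.
rewrite !cabsM !cabsX cabs_conj -mulrA ler_piMr ?cabs_ge0 //.
by rewrite mulr_ile1 ?exprn_ge0 ?cabs_ge0 // exprn_ile1 ?cabs_ge0.
Qed.

Lemma taylor_fun_exists : exists T : C -> C, forall w, cabs w <= 1 ->
  hasum (power_terms taylor_coef w w^*%C) (T w).
Proof.
have [A hA] := taylor_coef_bsum.
have /choice[T hT] : forall w : C, exists s, cabs w <= 1 ->
  hasum (power_terms taylor_coef w w^*%C) s.
  move=> w; have [w1|w1] := leP (cabs w) 1; last by exists 0.
  by have [s hs] := bsum_hasum (taylor_bsum hA w1); exists s.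
by exists T.
Qed.

Variable T : C -> C.
Hypothesis hT : forall w, cabs w <= 1 ->
  hasum (power_terms taylor_coef w w^*%C) (T w).

Lemma ray_sum (u : C) : cabs u = 1 -> exists (b : nat -> C) (A : R),
  bsum b A /\ forall t : R, `|t| <= 1 ->
    hasum (fun N => b N * t%:C%C ^+ N) (T (t%:C%C * u)).
Proof.
move=> u1; have [A hA] := taylor_coef_bsum.
have u1' : cabs u <= 1 by rewrite u1.
have [_ hb] := diag_bsum (taylor_bsum hA u1') (hT u1').
eexists; exists A; split; first exact: hb.
move=> t t1; have tu : cabs (t%:C%C * u) <= 1 by rewrite cabsM cabsR u1 mulr1.
have [+ _] := diag_bsum (taylor_bsum hA tu) (hT tu); apply: eq_hasum => N /=.
rewrite mulr_suml; apply: eq_bigr => i _.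
have -> : (t%:C%C * u)^*%C = t%:C%C * u^*%C by rewrite rmorphM [X in X * _ = _]conjc_real.
have -> : t%:C%C ^+ N = t%:C%C ^+ i * t%:C%C ^+ (N - i) by rewrite -exprD subnKC // -ltnS.
by rewrite !exprMn; ring.
Qed.

(** Along the ray the increments are (s x0, s y0); grouping the double series by total degree gives
    a power series in s. *)
Lemma phi_ray_analytic (u : C) : cabs u = 1 ->
  forall t : R, 0 <= t < 1 -> analytic_at (fun t : R => phi (t%:C%C * u)) t.
Proof.
move=> u1 t /andP[t0 t1].
have [|c [r [r0 h]]] := @real_analytic_xy (t%:C%C * u).
  by rewrite cabsM u1 mulr1 cabsR ger0_norm.
pose rho := r / 2; have rho0 : 0 < rho by rewrite divr_gt0.
have rr : `|rho| < r by rewrite gtr0_norm // /rho; lra.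
have [M hM] := hasum_coef_bound (ltW rho0) (h rho rho rr rr).
pose x0 := complex.Re u; pose y0 := complex.Im u.
have x1 : `|x0| <= 1 by rewrite -u1 Re_le_cabs.
have y1 : `|y0| <= 1 by rewrite -u1 Im_le_cabs.
have uE : u = Complex x0 y0 by rewrite /x0 /y0; case: (u).
have M0 := coef_bound_ge0 rho0 hM.
exists (fun N => \sum_(i < N.+1) c i (N - i)%N * x0%:C%C ^+ i * y0%:C%C ^+ (N - i)), (rho / 2), M.
split; first by rewrite divr_gt0.
  move=> N; under eq_bigr => i _ do rewrite -mulrA.
  apply: (diag_coef_bound (e := fun i => x0%:C%C ^+ i * y0%:C%C ^+ (N - i)) rho0 hM) => i _.
  by rewrite cabsM !cabsX !cabsR mulr_ile1 ?exprn_ge0 // exprn_ile1.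
move=> s sr.
have sx : `|s * x0| <= rho / 2.
  by rewrite normrM (le_trans (y := `|s|)) ?(ltW sr) // ler_piMr.
have sy : `|s * y0| <= rho / 2.
  by rewrite normrM (le_trans (y := `|s|)) ?(ltW sr) // ler_piMr.
have rhor : rho / 2 < r by rewrite /rho; lra.
have hs := h _ _ (le_lt_trans sx rhor) (le_lt_trans sy rhor).
have bs : bsum (power_terms c (s * x0)%:C%C (s * y0)%:C%C) (M * 4).
  by apply: (coef_bound_bsum rho0 hM); rewrite cabsR.
have E : (t + s)%:C%C * u = t%:C%C * u + Complex (s * x0) (s * y0).
  rewrite rmorphD mulrDl; congr (_ + _); rewrite uE.
  by apply/eqP; rewrite eq_complex /=; apply/andP; split; apply/eqP; ring.
rewrite E; have [+ _] := diag_bsum bs hs; apply: eq_hasum => N /=.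
rewrite mulr_suml; apply: eq_bigr => i _.
have -> : s%:C%C ^+ N = s%:C%C ^+ i * s%:C%C ^+ (N - i) by rewrite -exprD subnKC // -ltnS.
by rewrite !rmorphM !exprMn; ring.
Qed.

(** The local expansion gives equality near 0 only. On the ray through w both sides are analytic on
    [0, 1), which carries it to w. *)
Lemma phi_taylor (w : C) : cabs w < 1 -> phi w = T w.
Proof.
have [rho [M [rho0 hM hs]]] := taylor_conj_series.
have near0 z : cabs z < rho -> cabs z <= 1 -> phi z = T z.
  by move=> z1 z2; exact: hasum_unique (hs z z1) (hT z2).
move=> w1; have [w0|w0] := eqVneq w 0.
  by rewrite w0 near0 ?cabs0.
have cw0 : cabs w != 0 by rewrite cabs_eq0.
have cwp : 0 < cabs w by rewrite lt0r cw0 cabs_ge0.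
pose u := w / (cabs w)%:C%C.
have u1 : cabs u = 1 by rewrite cabsM cabsV cabsR gtr0_norm // divff.
have [b [A [hA hb]]] := ray_sum u1.
have d0 : 0 < Num.min rho 1 by rewrite lt_min rho0 ltr01.
have := @identity_theorem _ (fun t : R => phi (t%:C%C * u) - T (t%:C%C * u)) _ _ d0 _ (cabs w).
have -> : (cabs w)%:C%C * u = w.
  rewrite /u mulrC divfK //; apply/eqP => e.
  by move/eqP: cw0; apply; exact: (complexI e).
move=> hh; apply/eqP; rewrite -subr_eq0; apply/eqP/hh; rewrite ?cabs_ge0 //.
  move=> t ht; apply: analytic_at_sub; first exact: phi_ray_analytic.
  exact: (analytic_at_sum hA hb).
move=> t /andP[t0]; rewrite lt_min => /andP[tr t1].
by rewrite near0 ?subrr // cabsM u1 mulr1 cabsR ger0_norm // ltW.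
Qed.

(** Radial continuity up to the circle from absolute summability: the tail is small uniformly in t,
    and for the finitely many other terms 1 - t^i <= N (1 - t). *)
Lemma taylor_radial (u : C) (e : R) : cabs u = 1 -> 0 < e ->
  exists2 d : R, 0 < d & forall t : R, 1 - d < t < 1 -> 0 <= t ->
    cabs (T (t%:C%C * u) - T u) <= e.
Proof.
move=> u1 e0; have [b [A [hA hb]]] := ray_sum u1.
have A0 := rsum_ge0 hA.
have e2 : 0 < e / 2 by rewrite divr_gt0.
have [F0 hF0] := rsum_tail (fun=> cabs_ge0 _) hA e2.
pose N := (\max_(i <- F0) i)%N.
have K0 : 0 < A * N%:R + 1 by rewrite ltr_wpDl // mulr_ge0.
exists (e / 2 / (A * N%:R + 1)); first by rewrite divr_gt0.
move=> t /andP[td t1] t0.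
have h1 := hb 1; rewrite normr1 mul1r in h1; have {}h1 := h1 (lexx _).
have h2 := hb t; rewrite ger0_norm // in h2; have {}h2 := h2 (ltW t1).
apply: hasum_bound (hasumB h2 h1) => F.
rewrite (le_trans (cabs_sum _ _ _)) //.
rewrite (_ : e = e / 2 + e / 2); last by field.
have term i : cabs (b i * t%:C%C ^+ i - b i * 1%:C%C ^+ i) = cabs (b i) * (1 - t ^+ i).
  rewrite expr1n -mulrBr cabsM -rmorphXn -[1]/(1%:C%C) -rmorphB cabsR distrC ger0_norm //.
  by rewrite subr_ge0 exprn_ile1 // ltW.
under eq_bigr do rewrite term.
rewrite (bigID (fun i => i \in F0)) /= lerD //.
  apply: (@le_trans _ _ (A * (N%:R * (1 - t)))).
    apply: (@le_trans _ _ (\sum_(i <- F | i \in F0) cabs (b i) * (N%:R * (1 - t)))).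
      apply: ler_sum => i iF; rewrite ler_wpM2l ?cabs_ge0 //.
      apply: (@le_trans _ _ (i%:R * (1 - t))); last first.
        rewrite ler_wpM2r ?subr_ge0 ?(ltW t1) // ler_nat.
        exact: (@leq_bigmax_seq _ _ xpredT (fun i : nat => i)).
      elim: (i) => [|k IHk]; first by rewrite expr0 subrr mul0r.
      rewrite exprS -natr1 mulrDl mul1r.
      have : t * t ^+ k >= t ^+ k - (1 - t).
        have tk : t ^+ k <= 1 by rewrite exprn_ile1 // ltW.
        have : (1 - t) * (1 - t ^+ k) >= 0 by rewrite mulr_ge0 // subr_ge0 // ltW.
        by move: (t ^+ k) tk => x xk; lra.
      by move: (k%:R * (1 - t)) (t * t ^+ k) (t ^+ k) IHk => x y z h3 h4; lra.
    rewrite -mulr_suml ler_wpM2r //; last by rewrite -big_filter; apply: hA; rewrite filter_uniq ?fset_uniq.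
    by rewrite mulr_ge0 // subr_ge0 ltW.
  rewrite mulrA (@le_trans _ _ ((A * N%:R + 1) * (1 - t))) //.
    by rewrite ler_wpM2r ?subr_ge0 ?(ltW t1) // lerDl.
  by rewrite mulrC -ler_pdivlMr //; lra.
rewrite -big_filter.
apply: (@le_trans _ _ (\sum_(i <- [seq i <- F | i \notin F0]) cabs (b i))).
  by apply: ler_sum => i _; rewrite ler_piMr ?cabs_ge0 // gerBl exprn_ge0.
apply: hF0; first by rewrite filter_uniq ?fset_uniq.
by move=> i; rewrite mem_filter => /andP[].
Qed.

(** Both functions are followed along the radius to w, where they agree before the endpoint. *)
Lemma phi_taylor_boundary (w : C) : cabs w = 1 ->
  phi x @[x --> within (unit_disc R) (nbhs w)] --> phi w -> phi w = T w.
Proof.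
move=> w1 /cvgrPdist_le hc; apply/eqP; rewrite -subr_eq0; apply/eqP/cabs_le0P => e e0.
have e2 : 0 < e / 2 by rewrite divr_gt0.
have [d1 d10 h1] := taylor_radial w1 e2.
have e2C : 0 < (e / 2)%:C%C :> C by rewrite ltcR.
have /nbhs_complexP[d2 d20 h2] := hc _ e2C.
pose d := Num.min (Num.min d1 d2) 1.
have d0 : 0 < d by rewrite !lt_min d10 d20 ltr01.
have [dd1 dd2 dd3] : [/\ d <= d1, d <= d2 & d <= 1] by split; rewrite !ge_min lexx ?orbT.
pose t := 1 - d / 2.
have t01 : 0 <= t < 1 by rewrite /t; apply/andP; split; lra.
have /andP[t0 t1] := t01.
have tw : cabs (t%:C%C * w) = t by rewrite cabsM w1 mulr1 cabsR ger0_norm.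
have {}h2 : cabs (phi w - phi (t%:C%C * w)) <= e / 2.
  rewrite -lecR -cabsE; apply: h2; last by rewrite /unit_disc /= tw ltW.
  rewrite -[X in _ - X]mul1r -[1]/(1%:C%C) -mulrBl -rmorphB cabsM w1 mulr1 cabsR distrC ger0_norm /t; lra.
have {}h1 := h1 t _ t0; rewrite -(phi_taylor (w := t%:C%C * w)) ?tw // in h1.
have {}h1 : cabs (phi (t%:C%C * w) - T w) <= e / 2 by apply: h1; rewrite /t; apply/andP; split; lra.
rewrite (_ : phi w - T w = (phi w - phi (t%:C%C * w)) + (phi (t%:C%C * w) - T w)); last by ring.
by rewrite (le_trans (cabsD _ _)) //; lra.
Qed.

End Taylor.

(** * The surface measure *)

Local Notation unitary_rotation mu v := (mu + mu^*%C + mu * mu^*%C * cdot v v = 0).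

Section HermitianSpace.
Variables (R : realType) (n : nat).
Local Notation C := R[i].
Local Notation Cn := 'rV[R[i]]_n.
Implicit Types (x y z v : Cn).

Lemma cdotDl x y v : cdot (x + y) v = cdot x v + cdot y v.
Proof. by rewrite /cdot -big_split; apply: eq_bigr => j _; rewrite mxE mulrDl. Qed.

Lemma cdotZl (a : C) x v : cdot (a *: x) v = a * cdot x v.
Proof. by rewrite /cdot mulr_sumr; apply: eq_bigr => j _; rewrite mxE mulrA. Qed.

Lemma cdotNl x v : cdot (- x) v = - cdot x v.
Proof. by rewrite -scaleN1r cdotZl mulN1r. Qed.

Lemma cdot_conj x y : (cdot x y)^*%C = cdot y x.
Proof.
rewrite /cdot rmorph_sum; apply: eq_bigr => j _.
by rewrite rmorphM [X in _ * X]conjcK mulrC.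
Qed.

Lemma cdotDr x y v : cdot v (x + y) = cdot v x + cdot v y.
Proof. by rewrite -cdot_conj cdotDl rmorphD [X in X + _]cdot_conj [X in _ + X]cdot_conj. Qed.

Lemma cdotZr (a : C) x v : cdot v (a *: x) = a^*%C * cdot v x.
Proof. by rewrite -cdot_conj cdotZl rmorphM [X in _ * X]cdot_conj. Qed.

Lemma cdotE z : cdot z z = (\sum_(j < n) cabs (z 0 j) ^+ 2)%:C%C.
Proof. by rewrite rmorph_sum; apply: eq_bigr => j _; rewrite mulr_conj. Qed.

Lemma enormE z : enorm z = Num.sqrt (\sum_(j < n) cabs (z 0 j) ^+ 2).
Proof. by rewrite /enorm cdotE. Qed.

Lemma enorm_sqr z : (enorm z ^+ 2)%:C%C = cdot z z.
Proof.
rewrite enormE sqr_sqrtr ?cdotE // sumr_ge0 // => j _; exact: sqr_ge0.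
Qed.

Lemma sphereP z : sphere R n z <-> cdot z z = 1.
Proof.
rewrite /sphere /= -enorm_sqr; split=> [->|/complexI /eqP]; first by rewrite expr1n.
by rewrite sqrf_eq1 => /orP[/eqP //|/eqP e]; have := sqrtr_ge0 (complex.Re (cdot z z));
  rewrite -/(enorm z) e oppr_ge0 ler10.
Qed.

Lemma cabs_le_enorm z j : cabs (z 0 j) <= enorm z.
Proof.
rewrite enormE -[leLHS]ger0_norm ?cabs_ge0 // -sqrtr_sqr ler_wsqrtr //.
by rewrite (bigD1 j) //= lerDl sumr_ge0 // => i _; exact: sqr_ge0.
Qed.

Lemma enorm_le_sum z : enorm z <= \sum_(j < n) cabs (z 0 j).
Proof.
have s0 : 0 <= \sum_(j < n) cabs (z 0 j) by rewrite sumr_ge0 // => j _; exact: cabs_ge0.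
rewrite enormE -[leRHS]ger0_norm // -sqrtr_sqr ler_wsqrtr // expr2 mulr_suml.
apply: ler_sum => j _; rewrite expr2 ler_wpM2l ?cabs_ge0 //.
by rewrite (bigD1 j) //= lerDl sumr_ge0 // => i _; exact: cabs_ge0.
Qed.

Lemma nbhs_rowP z (P : set Cn) :
  nbhs z P <-> exists2 d : R, 0 < d & forall y, enorm (y - z) < d -> P y.
Proof.
split=> [/nbhs_ballP[e /= e0 h]|[d d0 h]].
  have eE : e = (complex.Re e)%:C%C by rewrite RRe_real // gtr0_real.
  exists (complex.Re e); first by rewrite -ltcR -eE.
  move=> y yz; apply: h; split => // i j; rewrite -ball_normE /= eE cabsE ltcR cabsB.
  apply: le_lt_trans yz; rewrite (ord1 i).
  by have := cabs_le_enorm (y - z) j; rewrite !mxE.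
apply/nbhs_ballP; exists (d / n.+1%:R)%:C%C; first by rewrite /= ltcR divr_gt0.
move=> y [_ hy]; apply: h; apply: (le_lt_trans (enorm_le_sum _)).
apply: (@le_lt_trans _ _ (\sum_(j < n) d / n.+1%:R)).
  apply: ler_sum => j _; rewrite !mxE.
  have := hy 0 j; rewrite -ball_normE /= cabsE ltcR cabsB => /ltW; exact.
rewrite sumr_const card_ord -[X in X < _]mulr_natr mulrAC ltr_pdivrMr //.
by rewrite ltr_pM2l // ltr_nat.
Qed.

(* Under unitary_rotation this is the unitary map that multiplies v by
   1 + mu * cdot v v and fixes the orthogonal complement of v. *)
Definition rotation (mu : C) v z : Cn := z + (mu * cdot z v) *: v.

Section Rotation.
Variables (mu : C) (v : Cn).
Hypothesis hmu : unitary_rotation mu v.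

Lemma rotationB x y : rotation mu v x - rotation mu v y = rotation mu v (x - y).
Proof.
by rewrite /rotation cdotDl cdotNl opprD addrACA -scalerBl -mulrBr.
Qed.

Lemma cdot_rotation z : cdot (rotation mu v z) (rotation mu v z) = cdot z z.
Proof.
rewrite /rotation cdotDl !cdotDr !cdotZl !cdotZr -(cdot_conj z v).
have -> : (mu * cdot z v)^*%C = mu^*%C * (cdot z v)^*%C by rewrite rmorphM.
set c := cdot z v.
rewrite (_ : _ + _ = cdot z z + c * c^*%C * (mu + mu^*%C + mu * mu^*%C * cdot v v)); last by ring.
by rewrite hmu mulr0 addr0.
Qed.

Lemma enorm_rotation z : enorm (rotation mu v z) = enorm z.
Proof. by rewrite /enorm cdot_rotation. Qed.

Lemma sphere_rotation z : sphere R n (rotation mu v z) <-> sphere R n z.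
Proof. by rewrite /sphere /= enorm_rotation. Qed.

End Rotation.

Lemma rotationK (mu : C) v : unitary_rotation mu v ->
  cancel (rotation mu v) (rotation (mu^*%C) v).
Proof.
move=> hmu z; rewrite /rotation cdotDl cdotZl -addrA -scalerDl.
rewrite (_ : _ + _ = cdot z v * (mu + mu^*%C + mu * mu^*%C * cdot v v)); last by ring.
by rewrite hmu mulr0 scale0r addr0.
Qed.

Lemma rotation_conj_cond (mu : C) v : unitary_rotation mu v ->
  mu^*%C + mu^*%C^*%C + mu^*%C * mu^*%C^*%C * cdot v v = 0.
Proof. by move=> h; rewrite conjcK [mu^*%C + mu]addrC [mu^*%C * mu]mulrC. Qed.

Lemma rotationVK (mu : C) v : unitary_rotation mu v ->
  cancel (rotation (mu^*%C) v) (rotation mu v).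
Proof.
by move=> /rotation_conj_cond/rotationK; rewrite conjcK.
Qed.

Section Hausdorff.
Local Open Scope ereal_scope.
Variables (U V : Cn -> Cn).
Hypothesis UK : cancel U V.
Hypothesis U_isom : forall x y, enorm (U x - U y) = enorm (x - y).

Lemma ediam_isom (A : set Cn) : ediam (U @` A) = ediam A.
Proof.
rewrite /ediam; congr (maxe _ (ereal_sup _)); apply/seteqP; split=> r /=.
  by move=> [_ [x Ax <-]] [_ [y Ay <-]] <-; exists x => //; exists y => //; rewrite U_isom.
move=> [x Ax] [y Ay] <-; exists (U x); first by exists x.
by exists (U y); [exists y|rewrite U_isom].
Qed.

(** The images of a cover form a cover of the image with the same diameters. *)
Lemma hausdorff_pre_isom m delta (A : set Cn) :
  hausdorff_pre m delta (U @` A) <= hausdorff_pre m delta A.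
Proof.
apply: le_ereal_inf => r [W [AW Wd] <-]; exists (fun i => U @` (W i)).
  split=> [_ [x Ax <-]|i]; last by rewrite ediam_isom.
  by have [i _ Wx] := AW x Ax; exists i => //; exists x.
by apply: eq_eseriesr => i _; rewrite ediam_isom.
Qed.

Lemma hausdorff_isom_le m (A : set Cn) : hausdorff m (U @` A) <= hausdorff m A.
Proof.
apply: ge_ereal_sup => r [delta d0 <-].
apply: (le_trans (hausdorff_pre_isom _ _ _)).
by apply: ereal_sup_ubound; exists delta.
Qed.

End Hausdorff.

Lemma hausdorff_isom (U V : Cn -> Cn) m (A : set Cn) : cancel U V ->
  (forall x y, enorm (U x - U y) = enorm (x - y)) ->
  (forall x y, enorm (V x - V y) = enorm (x - y)) ->
  hausdorff m (U @` A) = hausdorff m A.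
Proof.
move=> UK hU hV; apply/eqP; rewrite eq_le hausdorff_isom_le //=.
have {1}<- : V @` (U @` A) = A; last exact: hausdorff_isom_le.
apply/seteqP; split=> [_ [_ [x Ax <-] <-]|x Ax]; first by rewrite UK.
by exists (U x); [exists x|rewrite UK].
Qed.

End HermitianSpace.

(** * Integrals of functions that are not assumed measurable *)

Section NullSets.
Local Open Scope ereal_scope.
Context d (T : measurableType d) (R : realType).
Variable mu : {measure set T -> \bar R}.

Import HBNNSimple.

(** The integral of a nonnegative function is a supremum over simple functions below it, which is
    monotone in the function. *)
Lemma ge0_le_integral_nomeas (D : set T) (f g : T -> \bar R) :
  (forall x, D x -> 0 <= f x) -> (forall x, D x -> f x <= g x) ->
  \int[mu]_(x in D) f x <= \int[mu]_(x in D) g x.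
Proof.
move=> f0 fg; have g0 x : D x -> 0 <= g x by move=> Dx; exact: le_trans (f0 x Dx) (fg x Dx).
rewrite !ge0_integralE //; apply: le_ereal_sup => _ [h /= hf <-]; exists h => //= x.
apply: le_trans (hf x) _; rewrite /patch; case: ifPn => // xD.
by apply: fg; rewrite inE in xD.
Qed.

(* f need not be measurable: the profile of a zonal function is arbitrary on the
   unit circle. *)
Lemma ge0_integral_null (D N : set T) (f g : T -> \bar R) :
  measurable D -> measurable N -> mu N = 0 -> measurable_fun D g ->
  (forall x, D x -> 0 <= f x) -> (forall x, D x -> 0 <= g x) ->
  (forall x, (D `\` N) x -> f x = g x) ->
  \int[mu]_(x in D) f x = \int[mu]_(x in D) g x.
Proof.
move=> mD mN N0 mg f0 g0 fg.
have mDN : measurable (D `\` N) by exact: measurableD.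
apply/eqP; rewrite eq_le; apply/andP; split; last first.
  rewrite (ge0_negligible_integral mN mD mg g0 N0).
  rewrite (eq_integral f); last by move=> x; rewrite inE => /fg.
  rewrite integral_mkcond [leRHS]integral_mkcond.
  apply: ge0_le_integral_nomeas => x _; rewrite /patch.
    by case: ifPn => //; rewrite inE => -[Dx _]; exact: f0.
  case: ifPn => [|_]; first by rewrite inE => -[Dx _]; rewrite ifT // inE.
  by case: ifPn => //; rewrite inE; exact: f0.
rewrite {1}ge0_integralE //; apply: ge_ereal_sup => _ [h /= hf <-].
rewrite -integralT_nnsfun (ge0_negligible_integral mN measurableT _ _ N0) //; last 2 first.
- exact/measurable_EFinP/measurable_funP.
- by move=> x _; rewrite lee_fin.
rewrite [leRHS]integral_mkcond.
apply: (@le_trans _ _ (\int[mu]_(x in setT `\` N) (g \_ D) x)); last first.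
  rewrite integral_mkcond [leRHS]integral_mkcond.
  apply: ge0_le_integral_nomeas => x _; rewrite {1}/patch.
    case: ifPn => // _; rewrite /patch; case: ifPn => //; rewrite inE; exact: g0.
  case: ifPn => [_|_]; first by rewrite /patch in_setT.
  rewrite /patch in_setT; case: ifPn => //; rewrite inE; exact: g0.
apply: ge0_le_integral_nomeas => x [_ Nx]; first by rewrite lee_fin.
apply: le_trans (hf x) _; rewrite /patch; case: ifPn => //; rewrite inE => Dx.
by rewrite fg.
Qed.

Lemma Rintegral_null (D N : set T) (f g : T -> R) :
  measurable D -> measurable N -> mu N = 0 -> measurable_fun D g ->
  (forall x, (D `\` N) x -> f x = g x) ->
  Rintegral mu D f = Rintegral mu D g.
Proof.
move=> mD mN N0 mg fg; congr fine; rewrite integralE [RHS]integralE.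
have mEg : measurable_fun D (EFin \o g) by exact/measurable_EFinP.
congr (_ - _); apply: (ge0_integral_null mD mN N0) => //.
- exact: measurable_funepos.
- by move=> x Dx; rewrite !funeposE /= fg.
- exact: measurable_funeneg.
- by move=> x Dx; rewrite !funenegE /= fg.
Qed.

End NullSets.

Section SurfaceMeasure.
Variables (R : realType) (n : nat).
Local Notation C := R[i].
Local Notation Cn := 'rV[R[i]]_n.
Local Notation T := (borel R n).

Lemma open_row_measurable (A : set Cn) : open A -> measurable (A : set T).
Proof. by move=> oA; exact: sub_sigma_algebra. Qed.

Lemma lipschitz_measurable (h : Cn -> R) :
  (forall x y, `|h x - h y| <= enorm (x - y)) -> measurable_fun [set: T] (h : T -> R).
Proof.
move=> hl; apply: (measurability _ (RGenOInfty.measurableE R)) => _ [_ [a ->] <-].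
rewrite setTI; apply: open_row_measurable; rewrite openE => z /=; rewrite in_itv /= andbT => az.
apply/nbhs_rowP; exists (h z - a); first by rewrite subr_gt0.
move=> y yz; rewrite /= in_itv /= andbT.
have := le_lt_trans (hl y z) yz; rewrite distrC ltr_norml => /andP[_]; lra.
Qed.

Lemma measurable_Re_coord (j : 'I_n) : measurable_fun [set: T] (fun z : T => complex.Re ((z : Cn) 0 j)).
Proof.
apply: (@lipschitz_measurable (fun z => complex.Re (z 0 j))) => x y.
apply: le_trans (cabs_le_enorm (x - y) j); rewrite !mxE.
apply: le_trans (Re_le_cabs _); by case: (x 0 j) => ? ?; case: (y 0 j).
Qed.

Lemma measurable_Im_coord (j : 'I_n) : measurable_fun [set: T] (fun z : T => complex.Im ((z : Cn) 0 j)).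
Proof.
apply: (@lipschitz_measurable (fun z => complex.Im (z 0 j))) => x y.
apply: le_trans (cabs_le_enorm (x - y) j); rewrite !mxE.
apply: le_trans (Im_le_cabs _); by case: (x 0 j) => ? ?; case: (y 0 j).
Qed.

Definition cmeasurable (h : Cn -> C) : Prop :=
  measurable_fun [set: T] (fun z : T => complex.Re (h z)) /\
  measurable_fun [set: T] (fun z : T => complex.Im (h z)).

Lemma ReD (x y : C) : complex.Re (x + y) = complex.Re x + complex.Re y.
Proof. by case: x; case: y. Qed.
Lemma ImD (x y : C) : complex.Im (x + y) = complex.Im x + complex.Im y.
Proof. by case: x; case: y. Qed.
Lemma ReM (x y : C) : complex.Re (x * y) =
  complex.Re x * complex.Re y - complex.Im x * complex.Im y.
Proof. by case: x; case: y. Qed.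
Lemma ImM (x y : C) : complex.Im (x * y) =
  complex.Re x * complex.Im y + complex.Im x * complex.Re y.
Proof. by case: x => a b; case: y => c e /=; rewrite addrC. Qed.
Lemma Re_conj (x : C) : complex.Re (x^*%C) = complex.Re x.
Proof. by case: x. Qed.
Lemma Im_conj (x : C) : complex.Im (x^*%C) = - complex.Im x.
Proof. by case: x. Qed.

Lemma cmeasurable_cst c : cmeasurable (fun=> c).
Proof. by split; exact: measurable_cst. Qed.

Lemma cmeasurableD h k : cmeasurable h -> cmeasurable k -> cmeasurable (fun z => h z + k z).
Proof.
move=> [h1 h2] [k1 k2]; split.
  under eq_fun do rewrite ReD; exact: measurable_funD.
under eq_fun do rewrite ImD; exact: measurable_funD.
Qed.

Lemma cmeasurableM h k : cmeasurable h -> cmeasurable k -> cmeasurable (fun z => h z * k z).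
Proof.
move=> [h1 h2] [k1 k2]; split.
  under eq_fun do rewrite ReM; apply: measurable_funB; exact: measurable_funM.
under eq_fun do rewrite ImM; apply: measurable_funD; exact: measurable_funM.
Qed.

Lemma cmeasurable_conj h : cmeasurable h -> cmeasurable (fun z => (h z)^*%C).
Proof.
move=> [h1 h2]; split; first by under eq_fun do rewrite Re_conj.
by under eq_fun do rewrite Im_conj; exact: measurable_funN.
Qed.

Lemma cmeasurable_coord j : cmeasurable (fun z => z 0 j).
Proof. by split; [exact: measurable_Re_coord|exact: measurable_Im_coord]. Qed.

Lemma cmeasurable_sum (I : Type) (r : seq I) (h : I -> Cn -> C) :
  (forall i, cmeasurable (h i)) -> cmeasurable (fun z => \sum_(i <- r) h i z).
Proof.
move=> hm; elim: r => [|i r IHr].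
  under eq_fun do rewrite big_nil; exact: cmeasurable_cst.
under eq_fun do rewrite big_cons; exact: cmeasurableD.
Qed.

Lemma sphere_measurable : measurable (sphere R n : set T).
Proof.
have -> : sphere R n = (fun z => complex.Re (cdot z z)) @^-1` [set 1].
  apply/seteqP; split=> z /=; first by move/sphereP => ->.
  by move=> h; apply/sphereP; move: h; rewrite cdotE /= => ->.
have [mR _] : cmeasurable (fun z => cdot z z).
  apply: cmeasurable_sum => j; apply: cmeasurableM; first exact: cmeasurable_coord.
  exact/cmeasurable_conj/cmeasurable_coord.
by have := mR measurableT [set 1] (measurable_set1 1); rewrite setTI.
Qed.

Lemma rotation_measurable mu v : unitary_rotation mu v ->
  measurable_fun [set: T] (rotation mu v : T -> T).
Proof.
move=> hmu; apply: (@measurability _ _ T T setT _ (@open Cn) (erefl _)) => _ [A oA <-].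
rewrite setTI; apply: open_row_measurable; rewrite openE => z Az.
have : nbhs (rotation mu v z) A by exact: open_nbhs_nbhs.
move=> /nbhs_rowP[d d0 h]; apply/nbhs_rowP; exists d => // y yz.
by apply: h; rewrite rotationB enorm_rotation.
Qed.

Variable sigma : probability T R.
Hypothesis hsigma : normalized_surface_measure sigma.

(** The defining quotient is the same for the sphere and for the whole space. *)
Lemma sigma_sphere : sigma (sphere R n) = 1%E.
Proof.
rewrite -(@probability_setT _ _ _ sigma) (hsigma sphere_measurable) (hsigma measurableT).
by rewrite setIid setTI.
Qed.

(** A preimage under the rotation is an image under its inverse, an isometry that preserves the
    sphere and hence the Hausdorff measure. *)
Lemma sigma_rotation mu v (A : set T) : unitary_rotation mu v ->
  measurable A -> sigma (rotation mu v @^-1` A) = sigma A.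
Proof.
move=> hmu mA.
have mUA : measurable ((rotation mu v : T -> T) @^-1` A).
  by have := rotation_measurable hmu measurableT mA; rewrite setTI.
rewrite (hsigma mUA) (hsigma mA); congr (_ / _)%E.
have hmu' := rotation_conj_cond hmu.
rewrite -[in RHS](@hausdorff_isom R n (rotation (mu^*%C) v) (rotation mu v)).
- congr hausdorff; apply/seteqP; split=> [x [Ax Sx]|_ [x [Ax Sx] <-]].
    exists (rotation mu v x); last by rewrite rotationK.
    by split => //; exact/sphere_rotation.
  by split; [rewrite /= rotationVK|exact/sphere_rotation].
- exact: rotationVK.
- by move=> x y; rewrite rotationB enorm_rotation.
- by move=> x y; rewrite rotationB enorm_rotation.
Qed.

Local Notation S := (sphere R n).

(** A class closed under ring operations, conjugation and rotations, all of whose members are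
    integrable on the sphere; it settles the integrability conditions once and for all. *)
Definition nice (h : Cn -> C) : Prop :=
  cmeasurable h /\ exists M, forall z, S z -> cabs (h z) <= M.

Lemma nice_cst c : nice (fun=> c).
Proof. by split; [exact: cmeasurable_cst|exists (cabs c)]. Qed.

Lemma niceD h k : nice h -> nice k -> nice (fun z => h z + k z).
Proof.
move=> [mh [M hM]] [mk [N kN]]; split; first exact: cmeasurableD.
by exists (M + N) => z Sz; rewrite (le_trans (cabsD _ _)) // lerD ?hM ?kN.
Qed.

Lemma niceM h k : nice h -> nice k -> nice (fun z => h z * k z).
Proof.
move=> [mh [M hM]] [mk [N kN]]; split; first exact: cmeasurableM.
by exists (M * N) => z Sz; rewrite cabsM ler_pM ?cabs_ge0 ?hM ?kN.
Qed.

Lemma nice_conj h : nice h -> nice (fun z => (h z)^*%C).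
Proof.
move=> [mh [M hM]]; split; first exact: cmeasurable_conj.
by exists M => z Sz; rewrite cabs_conj hM.
Qed.

Lemma nice_coord j : nice (fun z => z 0 j).
Proof.
split; first exact: cmeasurable_coord.
by exists 1 => z Sz; rewrite (le_trans (cabs_le_enorm _ _)) // Sz.
Qed.

Lemma nice_sum (I : Type) (r : seq I) (h : I -> Cn -> C) :
  (forall i, nice (h i)) -> nice (fun z => \sum_(i <- r) h i z).
Proof.
move=> hm; elim: r => [|i r IHr].
  by under eq_fun do rewrite big_nil; exact: nice_cst.
by under eq_fun do rewrite big_cons; exact: niceD.
Qed.

Lemma nice_rotation mu v h : unitary_rotation mu v ->
  nice h -> nice (fun z => h (rotation mu v z)).
Proof.
move=> hmu [[m1 m2] [M hM]]; split.
  by split; [exact: (measurableT_comp m1 (rotation_measurable hmu))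
            |exact: (measurableT_comp m2 (rotation_measurable hmu))].
by exists M => z Sz; apply: hM; exact/sphere_rotation.
Qed.

Lemma bounded_integrable (h : T -> R) M : measurable_fun [set: T] h ->
  (forall z, S z -> `|h z| <= M) -> sigma.-integrable S (EFin \o h).
Proof.
move=> mh hM; apply: measurable_bounded_integrable.
- exact: sphere_measurable.
- by rewrite (_ : _ S = 1%E) ?ltry //; exact: sigma_sphere.
- exact: measurable_funTS.
exists M; split; first by rewrite num_real.
by move=> x Mx z Sz /=; rewrite (le_trans (hM z Sz)) // ltW.
Qed.

Lemma nice_integrable h : nice h ->
  sigma.-integrable S (EFin \o (fun z : T => complex.Re (h z))) /\
  sigma.-integrable S (EFin \o (fun z : T => complex.Im (h z))).
Proof.
move=> [[m1 m2] [M hM]]; split.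
  by apply: (bounded_integrable (M := M)) => // z Sz; rewrite (le_trans (Re_le_cabs _)) // hM.
by apply: (bounded_integrable (M := M)) => // z Sz; rewrite (le_trans (Im_le_cabs _)) // hM.
Qed.

Local Notation cint := (sphere_int sigma).

Lemma eq_cint h k : (forall z, S z -> h z = k z) -> cint h = cint k.
Proof.
move=> hk; rewrite /sphere_int; congr Complex; apply: eq_Rintegral => z; rewrite inE => Sz /=;
  by rewrite hk.
Qed.

Lemma cintD h k : nice h -> nice k -> cint (fun z => h z + k z) = cint h + cint k.
Proof.
move=> /nice_integrable[h1 h2] /nice_integrable[k1 k2].
rewrite /sphere_int; apply/eqP; rewrite eq_complex /=; apply/andP; split; apply/eqP.
  by under eq_Rintegral do rewrite ReD; apply: RintegralD => //; exact: sphere_measurable.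
by under eq_Rintegral do rewrite ImD; apply: RintegralD => //; exact: sphere_measurable.
Qed.

Lemma cintZ c h : nice h -> cint (fun z => c * h z) = c * cint h.
Proof.
move=> /nice_integrable[h1 h2]; have mS := sphere_measurable.
have i1 (a : R) : sigma.-integrable S (EFin \o (fun z : T => a * complex.Re (h z))).
  have -> : (EFin \o (fun z : T => a * complex.Re (h z))) =
      (fun z => (a%:E * (EFin \o (fun z : T => complex.Re (h z))) z)%E) by [].
  exact: integrableZl.
have i2 (a : R) : sigma.-integrable S (EFin \o (fun z : T => a * complex.Im (h z))).
  have -> : (EFin \o (fun z : T => a * complex.Im (h z))) =
      (fun z => (a%:E * (EFin \o (fun z : T => complex.Im (h z))) z)%E) by [].
  exact: integrableZl.
rewrite /sphere_int; apply/eqP; rewrite eq_complex ReM ImM /=; apply/andP; split; apply/eqP.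
  under eq_Rintegral do rewrite ReM.
  by rewrite RintegralB // !RintegralZl.
under eq_Rintegral do rewrite ImM.
by rewrite RintegralD // !RintegralZl.
Qed.

Lemma Rintegral_sphere_cst (c : R) : Rintegral sigma S (fun=> c) = c.
Proof.
rewrite Rintegral_cst; last exact: sphere_measurable.
rewrite [X in _ * fine X](_ : _ = 1%E) ?mulr1 //; exact: sigma_sphere.
Qed.

Lemma cint_cst c : cint (fun=> c) = c.
Proof. by rewrite /sphere_int /= !Rintegral_sphere_cst; case: c. Qed.

Lemma cint_sum (I : Type) (r : seq I) (h : I -> Cn -> C) : (forall i, nice (h i)) ->
  cint (fun z => \sum_(i <- r) h i z) = \sum_(i <- r) cint (h i).
Proof.
move=> hm; elim: r => [|i r IHr].
  rewrite big_nil -[RHS](cint_cst 0); apply: eq_cint => z _; by rewrite big_nil.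
rewrite big_cons -IHr -cintD //; last exact: nice_sum.
by apply: eq_cint => z _; rewrite big_cons.
Qed.

Lemma cint_conj h : nice h -> cint (fun z => (h z)^*%C) = (cint h)^*%C.
Proof.
move=> /nice_integrable[h1 h2].
rewrite /sphere_int; apply/eqP; rewrite eq_complex Re_conj Im_conj /=; apply/andP; split; apply/eqP.
  by under eq_Rintegral do rewrite Re_conj.
under eq_Rintegral do rewrite Im_conj -mulN1r.
by rewrite RintegralZl ?mulN1r //; exact: sphere_measurable.
Qed.

Lemma Rintegral_sphere_bound (h : T -> R) M : measurable_fun [set: T] h ->
  (forall z, S z -> `|h z| <= M) -> `|Rintegral sigma S h| <= M.
Proof.
move=> mh hM; have ih := bounded_integrable mh hM; have mS := sphere_measurable.
apply: (le_trans (le_normr_Rintegral mS ih)).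
have -> : M = Rintegral sigma S (fun=> M).
  by rewrite Rintegral_sphere_cst.
apply: le_Rintegral => //.
- apply: (bounded_integrable (M := M)) => [|z Sz]; last by rewrite normr_id hM.
  exact: measurableT_comp.
- by apply: (bounded_integrable (M := `|M|)) => //; exact: measurable_cst.
Qed.

(** The factor 2 comes from bounding the real and imaginary parts separately. *)
Lemma cint_bound h M : cmeasurable h -> (forall z, S z -> cabs (h z) <= M) ->
  cabs (cint h) <= 2 * M.
Proof.
move=> [m1 m2] hM; rewrite (le_trans (cabs_le_ReIm _)) // mulr_natl mulr2n.
rewrite lerD // /sphere_int /=; apply: Rintegral_sphere_bound => // z Sz.
  by rewrite (le_trans (Re_le_cabs _)) // hM.
by rewrite (le_trans (Im_le_cabs _)) // hM.
Qed.

Lemma cint_rotation mu v h : unitary_rotation mu v ->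
  nice h -> cint (fun z => h (rotation mu v z)) = cint h.
Proof.
move=> hmu nh; have mS := sphere_measurable; have mU := rotation_measurable hmu.
have key (g : T -> R) : measurable_fun [set: T] g ->
    (exists M, forall z, S z -> `|g z| <= M) ->
    Rintegral sigma S (fun z => g (rotation mu v z)) = Rintegral sigma S g.
  move=> mg [M gM]; rewrite /Rintegral; congr fine.
  have SE : (rotation mu v : T -> T) @^-1` S = S.
    by apply/seteqP; split=> z /=; rewrite sphere_rotation.
  have mEg : measurable_fun [set: T] (EFin \o g) by exact/measurable_EFinP.
  have := @integral_pushforward _ _ T T R (rotation mu v) mU sigma S (EFin \o g) mEg.
  rewrite SE => /(_ _ mS) <-.
    apply: eq_measure_integral => A mA _; rewrite /pushforward; exact: sigma_rotation.
  apply: (@bounded_integrable (g \o rotation mu v) M) => [|z Sz]; first exact: (measurableT_comp mg mU).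
  by apply: gM; exact/sphere_rotation.
case: nh => [[m1 m2] [M hM]]; rewrite /sphere_int; congr Complex.
  by apply: (key (fun z => complex.Re (h z))) => //; exists M => z Sz; rewrite (le_trans (Re_le_cabs _)) // hM.
by apply: (key (fun z => complex.Im (h z))) => //; exists M => z Sz; rewrite (le_trans (Im_le_cabs _)) // hM.
Qed.

Lemma cint_null (N : set T) h k : measurable N -> sigma N = 0%E -> cmeasurable k ->
  (forall z, S z -> ~ N z -> h z = k z) -> cint h = cint k.
Proof.
move=> mN N0 [m1 m2] hk; rewrite /sphere_int; congr Complex;
  apply: (Rintegral_null sphere_measurable mN N0); try exact: measurable_funTS.
  by move=> z [Sz Nz]; rewrite hk.
by move=> z [Sz Nz]; rewrite hk.
Qed.

Lemma cint_sqr_ge0 h : nice h -> 0 <= complex.Re (cint (fun z => h z * (h z)^*%C)).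
Proof.
move=> nh; apply: Rintegral_ge0 => z _.
by rewrite mulr_conj /= sqr_ge0.
Qed.

End SurfaceMeasure.

(** * First-order expansion along a family of rotations *)

Section RotationDerivative.
Variables (R : realType) (n : nat).
Local Notation C := R[i].
Local Notation Cn := 'rV[R[i]]_n.
Local Notation ezz := (@BihomPoly.eval_zzbar R n).
Local Notation S := (sphere R n).
Local Notation Pol := (mpoly.mpoly (n + n) R[i]).

Lemma conjc_mul (x y : C) : (x * y)^*%C = x^*%C * y^*%C. Proof. exact: rmorphM. Qed.
Lemma conjc_add (x y : C) : (x + y)^*%C = x^*%C + y^*%C. Proof. exact: rmorphD. Qed.
Lemma conjc_sub (x y : C) : (x - y)^*%C = x^*%C - y^*%C. Proof. exact: rmorphB. Qed.

Lemma eq_nice (h k : Cn -> C) : h =1 k -> nice h -> nice k.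
Proof. by move=> /funext ->. Qed.

Lemma nice_ezz (P : Pol) : nice (ezz P).
Proof.
elim/ezz_closure: P => [c|j|j|P Q hP hQ|P Q hP hQ].
- by apply: (eq_nice _ (nice_cst n c)) => z; rewrite ezzC.
- by apply: (eq_nice _ (nice_coord R j)) => z; rewrite ezz_zv.
- by apply: (eq_nice _ (nice_conj (nice_coord R j))) => z; rewrite ezz_zb.
- by apply: (eq_nice _ (niceD hP hQ)) => z; rewrite ezzD.
- by apply: (eq_nice _ (niceM hP hQ)) => z; rewrite ezzM.
Qed.

Variable v : Cn.
Hypothesis v0 : cdot v v != 0.

(* With mu = cayley_coef t, the eigenvalue 1 + mu * cdot v v of rotation mu v is
   the Cayley transform (1 + i t) / (1 - i t). *)
Definition cayley_step (t : R) : C := 2 * t%:C%C * 'i%C / cdot v v.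
Definition cayley_coef (t : R) : C := cayley_step t / (1 - t%:C%C * 'i%C).

Let ii : 'i%C * 'i%C = -1 :> C. Proof. by rewrite -expr2 sqr_i. Qed.
Let ct (t : R) : (t%:C%C)^*%C = t%:C%C :> C. Proof. exact: conjc_real. Qed.
Let cv : (cdot v v)^*%C = cdot v v. Proof. exact: cdot_conj. Qed.
Let den1 (t : R) : (1 - t%:C%C * 'i%C) * (1 + t%:C%C * 'i%C) = (1 + t ^+ 2)%:C%C :> C.
Proof.
have -> : (1 - t%:C%C * 'i%C) * (1 + t%:C%C * 'i%C) = 1 - t%:C%C ^+ 2 * ('i%C * 'i%C) :> C by ring.
by rewrite ii mulrN1 opprK rmorphD rmorphXn.
Qed.
Let den2 (t : R) : (1 + t ^+ 2)%:C%C != 0 :> C.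
Proof. by rewrite eq_complex /= eqxx andbT gt_eqF // ltr_pwDl // sqr_ge0. Qed.
Let denm (t : R) : 1 - t%:C%C * 'i%C != 0 :> C.
Proof. by apply: contraNneq (den2 t) => e; rewrite -den1 e mul0r. Qed.
Let denp (t : R) : 1 + t%:C%C * 'i%C != 0 :> C.
Proof. by apply: contraNneq (den2 t) => e; rewrite -den1 e mulr0. Qed.

Lemma cayley_stepC t : (cayley_step t)^*%C = - cayley_step t.
Proof.
rewrite /cayley_step rmorphM fmorphV [X in _ / X]cv !rmorphM rmorph_nat.
by rewrite [X in _ * X * _ * _ = _]ct [X in _ * X / _ = _]conjci mulrN mulNr.
Qed.

Lemma cayley_coefC t : (cayley_coef t)^*%C = - cayley_step t / (1 + t%:C%C * 'i%C).
Proof.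
rewrite /cayley_coef rmorphM fmorphV [X in X / _]cayley_stepC; congr (_ / _).
by rewrite rmorphB rmorph1 rmorphM [X in _ - X * _]ct [X in _ - _ * X]conjci mulrN opprK.
Qed.

Lemma cayley_coef_cond t : cayley_coef t + (cayley_coef t)^*%C
  + cayley_coef t * (cayley_coef t)^*%C * cdot v v = 0.
Proof.
rewrite cayley_coefC /cayley_coef.
have -> : cayley_step t = 2 * t%:C%C * 'i%C / cdot v v by [].
by field; rewrite denp denm v0.
Qed.

Lemma cayley_step_cabs (t : R) : cabs (cayley_step t) = `|t| * (2 / cabs (cdot v v)).
Proof. by rewrite /cayley_step !cabsM cabsV cabsR cabsi cabs_nat; ring. Qed.

Lemma cayley_coef_sub t : cabs (cayley_coef t - cayley_step t)
  <= 2 / cabs (cdot v v) * t ^+ 2.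
Proof.
have -> : cayley_coef t - cayley_step t = cayley_step t * (t%:C%C * 'i%C) / (1 - t%:C%C * 'i%C).
  by rewrite /cayley_coef; field; rewrite denm.
rewrite (cabsM _ (_^-1)) (cabsM (cayley_step t)) cabsV cayley_step_cabs (cabsM t%:C%C) cabsR cabsi mulr1.
have d1 : 1 <= cabs (1 - t%:C%C * 'i%C).
  apply: le_trans (Re_le_cabs _).
  by rewrite (_ : complex.Re _ = 1) ?normr1 //=; ring.
have t2 : t ^+ 2 = `|t| * `|t| by rewrite -expr2 real_normK // num_real.
rewrite t2 (_ : _ * _ * _ / _ = 2 / cabs (cdot v v) * (`|t| * `|t|) / cabs (1 - t%:C%C * 'i%C)); last by ring.
by rewrite ler_pdivrMr ?(lt_le_trans ltr01) // ler_peMr // !mulr_ge0 ?invr_ge0 ?cabs_ge0.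
Qed.

(** Induction on the construction of P, with bounds uniform on the sphere. The step is imaginary, so
    that conjugation changes its sign; this matches the minus sign with which [rotation_field] acts
    on the conjugate variables. *)
Lemma rotation_derivative (P : Pol) : exists B K : R, [/\ 0 <= B, 0 <= K,
  forall z, S z -> cabs (ezz P z) <= B /\ cabs (ezz (rotation_field v P) z) <= B &
  forall (t : R) z, `|t| <= 1 -> S z ->
    cabs (ezz P (rotation (cayley_coef t) v z) - ezz P z
      - cayley_step t * ezz (rotation_field v P) z) <= K * t ^+ 2].
Proof.
have [_ [M0 hM0]] := nice_sum (index_enum 'I_n) (fun a => niceM (nice_coord R a) (nice_cst n ((v 0 a)^*%C))).
have M1 : exists2 M, 0 <= M & forall z, S z -> cabs (cdot z v) <= M.
  exists `|M0| => // z Sz; exact: le_trans (hM0 z Sz) (ler_norm _).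
case: M1 => M M1 hM.
have sum_id (a b c d x y s : C) :
    (a + b) - (c + d) - s * (x + y) = (a - c - s * x) + (b - d - s * y) by ring.
(* Leibniz rule with remainder: the last summand is of order s^2 and explains the term q^2 in the
   constant for products. *)
have prod_id (a b c d x y s : C) : a * b - c * d - s * (x * d + c * y) =
    (a - c - s * x) * b + (c + s * x) * (b - d - s * y) + s ^+ 2 * (x * y) by ring.
have [q [q0 qE]] : exists q : R, 0 <= q /\ q = 2 / cabs (cdot v v).
  by eexists; split; last reflexivity; rewrite divr_ge0 // cabs_ge0.
have qsub t : cabs (cayley_coef t - cayley_step t) <= q * t ^+ 2.
  by rewrite qE cayley_coef_sub.
elim/ezz_closure: P => [c|j|j|P Q|P Q].
- exists (cabs c), 0; split => // [|z Sz|t z t1 Sz]; first exact: cabs_ge0.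
    by rewrite rotation_fieldC -[0]/(mpoly.mpolyC _ 0) !ezzC cabs0 cabs_ge0.
  by rewrite rotation_fieldC -[0 in X in cabs X](mpoly.mpolyC0) !ezzC mulr0 subr0 subrr cabs0 mul0r.
- exists (1 + M * cabs (v 0 j)), (q * M * cabs (v 0 j)); split.
  + by rewrite addr_ge0 // mulr_ge0 // cabs_ge0.
  + by apply: mulr_ge0; [exact: mulr_ge0|exact: cabs_ge0].
  + move=> z Sz; rewrite ezz_zv ezz_rotation_field_zv -/(cdot z v) cabsM; split.
      by rewrite (le_trans (cabs_le_enorm _ _)) // Sz lerDl mulr_ge0 // cabs_ge0.
    by rewrite (le_trans (ler_wpM2r (cabs_ge0 _) (hM z Sz))) // lerDr.
  + move=> t z t1 Sz; rewrite !ezz_zv ezz_rotation_field_zv -/(cdot z v) !mxE.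
    rewrite (_ : _ - _ = (cayley_coef t - cayley_step t) * cdot z v * v 0 j); last by ring.
    rewrite !cabsM (_ : q * M * _ * _ = q * t ^+ 2 * M * cabs (v 0 j)); last by ring.
    rewrite ler_wpM2r ?cabs_ge0 // ler_pM ?cabs_ge0 ?hM //; exact: qsub.
- exists (1 + M * cabs (v 0 j)), (q * M * cabs (v 0 j)); split.
  + by rewrite addr_ge0 // mulr_ge0 // cabs_ge0.
  + by apply: mulr_ge0; [exact: mulr_ge0|exact: cabs_ge0].
  + move=> z Sz; have e : \sum_(a < n) (z 0 a)^*%C * v 0 a = (cdot z v)^*%C.
      by rewrite cdot_conj; apply: eq_bigr => a _; rewrite mulrC.
    rewrite ezz_zb ezz_rotation_field_zb e cabsM cabsN !cabs_conj; split.
      by rewrite (le_trans (cabs_le_enorm _ _)) // Sz lerDl mulr_ge0 // cabs_ge0.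
    by rewrite (le_trans (ler_wpM2r (cabs_ge0 _) (hM z Sz))) // lerDr.
  + move=> t z t1 Sz; have e : \sum_(a < n) (z 0 a)^*%C * v 0 a = (cdot z v)^*%C.
      by rewrite cdot_conj; apply: eq_bigr => a _; rewrite mulrC.
    rewrite !ezz_zb ezz_rotation_field_zb e !mxE.
    rewrite (_ : _ - _ = ((cayley_coef t - cayley_step t) * cdot z v * v 0 j)^*%C); last first.
      by rewrite conjc_add !(conjc_mul _ (v 0 j)) !(conjc_mul _ (cdot z v)) conjc_sub cayley_stepC; ring.
    rewrite cabs_conj !cabsM (_ : q * M * _ * _ = q * t ^+ 2 * M * cabs (v 0 j)); last by ring.
    rewrite ler_wpM2r ?cabs_ge0 // ler_pM ?cabs_ge0 ?hM //; exact: qsub.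
- move=> [B1 [K1 [B10 K10 b1 k1]]] [B2 [K2 [B20 K20 b2 k2]]].
  exists (B1 + B2), (K1 + K2); split; rewrite ?addr_ge0 //.
    move=> z Sz; rewrite rotation_fieldD !ezzD; have [? ?] := b1 z Sz; have [? ?] := b2 z Sz.
    by split; rewrite (le_trans (cabsD _ _)) // lerD.
  move=> t z t1 Sz; rewrite rotation_fieldD !ezzD.
  rewrite sum_id.
  by rewrite (le_trans (cabsD _ _)) // mulrDl lerD ?k1 ?k2.
move=> [B1 [K1 [B10 K10 b1 k1]]] [B2 [K2 [B20 K20 b2 k2]]].
exists (2 * (B1 * B2)), (K1 * B2 + (B1 + q * B1) * K2 + q ^+ 2 * (B1 * B2)); split.
- by rewrite !mulr_ge0.
- by rewrite !addr_ge0 // ?mulr_ge0 ?addr_ge0 ?mulr_ge0 ?exprn_ge0.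
- move=> z Sz; have [x1 x2] := b1 z Sz; have [y1 y2] := b2 z Sz.
  rewrite rotation_fieldM ezzD !ezzM; split.
    by rewrite cabsM mulr_natl mulr2n ler_wpDl ?mulr_ge0 // ler_pM ?cabs_ge0.
  by rewrite (le_trans (cabsD _ _)) // !cabsM mulr_natl mulr2n lerD // ler_pM ?cabs_ge0.
move=> t z t1 Sz; have [x1 x2] := b1 z Sz; have [y1 y2] := b2 z Sz.
have SU : S (rotation (cayley_coef t) v z) by apply/sphere_rotation => //; exact: cayley_coef_cond.
have [u1 _] := b2 _ SU.
rewrite rotation_fieldM ezzD !ezzM.
have hr := k1 t z t1 Sz; have hs := k2 t z t1 Sz.
have ts : cabs (cayley_step t) = `|t| * q by rewrite cayley_step_cabs qE.
rewrite prod_id.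
apply: (le_trans (cabsD _ _)); rewrite [leRHS]mulrDl; apply: lerD.
  apply: (le_trans (cabsD _ _)); rewrite [leRHS]mulrDl; apply: lerD.
    by rewrite cabsM [leRHS]mulrAC ler_pM ?cabs_ge0.
  rewrite cabsM -[leRHS]mulrA ler_pM ?cabs_ge0 //.
  apply: (le_trans (cabsD _ _)); apply: lerD => //; rewrite cabsM ts.
  by rewrite ler_pM ?mulr_ge0 ?cabs_ge0 // ler_piMl.
rewrite cabsM cabsX ts exprMn real_normK ?num_real // -[leLHS]mulrA [leRHS]mulrC.
rewrite ler_wpM2l ?sqr_ge0 // ler_wpM2l ?sqr_ge0 // cabsM.
by rewrite ler_pM ?cabs_ge0.
Qed.

End RotationDerivative.

Lemma sum_delta2 (F : comNzRingType) n (T : 'I_n -> 'I_n -> F) i j :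
  \sum_(x < n) \sum_(y < n) ((x == i)%:R * (y == j)%:R) * T x y = T i j.
Proof.
rewrite (bigD1 i) //= [X in _ + X]big1 => [|x xi]; last first.
  by rewrite big1 // => y _; rewrite (negbTE xi) !mul0r.
rewrite (bigD1 j) //= [X in _ + X + _]big1 => [|y yj]; last first.
  by rewrite (negbTE yj) mulr0 mul0r.
by rewrite !eqxx !mul1r !addr0.
Qed.

(** Polarization: test on e_a + c e_b with c = 1 and c = i. *)
Lemma sesquilinear_polarization (R : realType) n (T : 'I_n -> 'I_n -> R[i]) a b :
  (forall v : 'I_n -> R[i], \sum_(x < n) \sum_(y < n) ((v x)^*%C * v y) * T x y = 0) ->
  T a b = 0.
Proof.
move=> Bvv.
have BD (c : R[i]) : T a a + c * T a b + c^*%C * T b a + c^*%C * c * T b b = 0.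
  rewrite -[RHS](Bvv (fun j => (j == a)%:R + c * (j == b)%:R)).
  rewrite -(sum_delta2 T a a) -(sum_delta2 T a b) -(sum_delta2 T b a) -(sum_delta2 T b b).
  rewrite !mulr_sumr -!big_split /=; apply: eq_bigr => x _.
  rewrite !mulr_sumr -!big_split /=; apply: eq_bigr => y _.
  have -> : (((x == a)%:R + c * (x == b)%:R)^*)%C = (x == a)%:R + c^*%C * (x == b)%:R :> R[i].
    by rewrite conjc_add conjc_mul; congr (_ + _ * _); exact: rmorph_nat.
  ring.
have Tii k : T k k = 0 by rewrite -(sum_delta2 T k k) -[RHS](Bvv (fun j => (j == k)%:R));
  apply: eq_bigr => x _; apply: eq_bigr => y _; congr (_ * _ * _); rewrite [RHS]rmorph_nat.
have c1 : 1^*%C = 1 :> R[i] by exact: rmorph1.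
have h1 := BD 1; rewrite c1 !Tii !mulr0 !mul1r add0r addr0 in h1.
have h2 := BD 'i%C; rewrite !Tii !mulr0 add0r addr0 in h2.
have i0 : 'i%C != 0 :> R[i] by rewrite eq_complex /= oner_eq0 andbF.
move: h2; rewrite conjci mulNr -mulrBr => /eqP; rewrite mulf_eq0 (negbTE i0) /= subr_eq0 => /eqP h2.
move: h1; rewrite -h2 -mulr2n => /eqP; rewrite mulrn_eq0 /= => /eqP; exact.
Qed.

(** * The integral as an invariant functional *)

Section SphereFunctional.
Variables (R : realType) (n : nat).
Local Notation C := R[i].
Local Notation Cn := 'rV[R[i]]_n.
Local Notation ezz := (@BihomPoly.eval_zzbar R n).
Local Notation Pol := (mpoly.mpoly (n + n) R[i]).
Variable sigma : probability (borel R n) R.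
Hypothesis hsigma : normalized_surface_measure sigma.
Local Notation cint := (sphere_int sigma).

Definition sphere_poly_int (P : Pol) : C := cint (ezz P).
Local Notation I := sphere_poly_int.

Lemma sphere_poly_int_rotation_fieldE (v : Cn) (P : Pol) : I (rotation_field v P) =
  \sum_(a < n) \sum_(b < n) ((v 0 a)^*%C * v 0 b) * I (gl_action a b P).
Proof.
have nZ a b : nice (fun z => ((v 0 a)^*%C * v 0 b) * ezz (gl_action a b P) z).
  by apply: niceM; [exact: nice_cst|exact: nice_ezz].
rewrite /I (eq_cint _ (fun z _ => ezz_rotation_field v P z)) (cint_sum hsigma); last first.
  by move=> a; apply: nice_sum.
apply: eq_bigr => a _; rewrite (cint_sum hsigma) //.
by apply: eq_bigr => b _; rewrite (cintZ hsigma _ (nice_ezz _)).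
Qed.

(** By invariance the integral of P composed with the rotation minus P is 0. Only the linear term
    and a remainder O(t^2) are left; since the step has size proportional to t, the integral of the
    field is O(t), hence 0. *)
Lemma sphere_poly_int_rotation_field (v : Cn) (P : Pol) :
  cdot v v != 0 -> I (rotation_field v P) = 0.
Proof.
move=> v0; have [B [K [B0 K0 _ hK]]] := rotation_derivative v0 P.
have q0 : 0 < 2 / cabs (cdot v v) by rewrite divr_gt0 // lt0r cabs_eq0 v0 cabs_ge0.
set X := I (rotation_field v P).
have main t : 0 < t -> t <= 1 -> cabs X <= 2 * K / (2 / cabs (cdot v v)) * t.
  move=> t0 t1; have hmu := cayley_coef_cond v0 t.
  set mu := cayley_coef v t in hmu; set s := cayley_step v t.
  have nU : nice (fun z => ezz P (rotation mu v z)) := nice_rotation hmu (nice_ezz P).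
  have nX := nice_ezz (rotation_field v P); have nP := nice_ezz P.
  pose h z := ezz P (rotation mu v z) + ((- 1) * ezz P z + (- s) * ezz (rotation_field v P) z).
  have nh : nice h.
    apply: niceD => //; apply: niceD; apply: niceM => //; exact: (nice_cst n).
  have ih : cint h = - s * X.
    rewrite /h cintD //; last by apply: niceD; apply: niceM => //; exact: (nice_cst n).
    rewrite cintD ?cintZ //; try by apply: niceM => //; exact: (nice_cst n).
    rewrite (cint_rotation hsigma hmu (nice_ezz P)) mulN1r addrA subrr add0r //.
  have bh : cabs (cint h) <= 2 * (K * t ^+ 2).
    apply: cint_bound => //; first by case: nh.
    move=> z Sz; have := hK t z; rewrite gtr0_norm // => /(_ t1 Sz).
    by rewrite /h mulN1r mulNr addrA.
  move: bh; rewrite ih cabsM cabsN (cayley_step_cabs) gtr0_norm // => bh.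
  rewrite -(ler_pM2l t0) -(ler_pM2l q0).
  rewrite (_ : _ * (t * cabs X) = t * (2 / cabs (cdot v v)) * cabs X); last by ring.
  rewrite (le_trans bh) // le_eqVlt; apply/orP; left; apply/eqP.
  move: q0; move: (2 / cabs (cdot v v)) => q q0; field; by rewrite gt_eqF.
apply: cabs_le0P => e e0; set D := 2 * K / (2 / cabs (cdot v v)) in main.
have D0 : 0 <= D by rewrite divr_ge0 ?(ltW q0) // mulr_ge0.
have D1 : 0 < D + 1 by rewrite ltr_wpDl.
pose t := Num.min 1 (e / (D + 1)).
have t0 : 0 < t by rewrite lt_min ltr01 divr_gt0.
have [t1 te] : t <= 1 /\ t <= e / (D + 1) by split; rewrite !ge_min lexx ?orbT.
apply: (le_trans (main t t0 t1)).
apply: (@le_trans _ _ ((D + 1) * t)); first by rewrite ler_wpM2r ?(ltW t0) // lerDl.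
by rewrite mulrC -ler_pdivlMr.
Qed.

Lemma sphere_poly_int_gl_action a b (P : Pol) : I (gl_action a b P) = 0.
Proof.
pose T x y := I (gl_action x y P).
pose B (u v : 'I_n -> C) := \sum_(x < n) \sum_(y < n) ((u x)^*%C * v y) * T x y.
have Bvv (v : 'I_n -> C) : B v v = 0.
  pose w : Cn := \row_i v i.
  have -> : B v v = I (rotation_field w P).
    rewrite sphere_poly_int_rotation_fieldE; apply: eq_bigr => x _.
    by apply: eq_bigr => y _; rewrite !mxE.
  (* The Cayley family divides by [cdot w w]; in the excluded case w is 0 and the sum is trivially
     0. *)
  have [w0|] := eqVneq (cdot w w) 0; last exact: sphere_poly_int_rotation_field.
  have wz j : w 0 j = 0.
    apply/eqP; rewrite -cabs_eq0 eq_le cabs_ge0 andbT.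
    by rewrite (le_trans (cabs_le_enorm w j)) // /enorm w0 sqrtr0.
  rewrite sphere_poly_int_rotation_fieldE big1 // => x _; rewrite big1 // => y _.
  by rewrite [w 0 y]wz mulr0 mul0r.
by apply: (@sesquilinear_polarization R n T) => v; exact: Bvv.
Qed.

Lemma sphere_functional_int : sphere_functional I.
Proof.
split.
- move=> P Q; rewrite /I -(cintD hsigma (nice_ezz P) (nice_ezz Q)).
  by apply: eq_cint => z _; rewrite ezzD.
- move=> c P; rewrite /I -(cintZ hsigma c (nice_ezz P)).
  by apply: eq_cint => z _; rewrite ezzZ.
- exact: sphere_poly_int_gl_action.
- move=> P; apply: eq_cint => z /sphereP Sz; rewrite ezzM ezz_normsq.
  by rewrite -/(cdot z z) Sz mul1r.
- by rewrite -[RHS](cint_cst hsigma 1); apply: eq_cint => z _; rewrite ezz1.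
Qed.

End SphereFunctional.

(** * Zonal kernels and the dimension of H^(p,q) *)

Lemma zonal_c_sym (F : numFieldType) n p q i : zonal_c F n p q i = zonal_c F n q p i.
Proof.
rewrite /zonal_c /zonal_lead addnC (mulrC (poch _ p)) (mulrC (poch (- p%:R) _)).
by rewrite (addrAC (- (n%:R - 2)) (- p%:R)).
Qed.

Lemma zonal_profile_sym (F : numFieldType) n p q (x y : F) :
  zonal_profile n p q x y = zonal_profile n q p y x.
Proof.
rewrite /zonal_profile minnC; apply: eq_bigr => i _.
by rewrite zonal_c_sym mulrAC.
Qed.

Lemma zonal_profile_rmorph (F : numFieldType) (f : {rmorphism F -> F}) n p q (x y : F) :
  f (zonal_profile n p q x y) = zonal_profile n p q (f x) (f y).
Proof.
have fpoch z i : f (poch z i) = poch (f z) i.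
  by rewrite /poch rmorph_prod; apply: eq_bigr => k _; rewrite rmorphD rmorph_nat.
rewrite /zonal_profile rmorph_sum; apply: eq_bigr => i _.
rewrite !rmorphM !rmorphXn; congr (_ * _ * _); rewrite /zonal_lead.
by rewrite !fmorphV !rmorphM !fpoch !(rmorphB, rmorphN, rmorph_nat, rmorph1).
Qed.

Section ZonalKernel.
Variables (R : realType) (n : nat).
Local Notation C := R[i].
Local Notation Cn := 'rV[R[i]]_n.
Local Notation ezz := (@BihomPoly.eval_zzbar R n).
Local Notation S := (sphere R n).
Local Notation Z := (@zonal_kernel R n).

Lemma zonal_kernelE p q (eta xi : Cn) :
  Z p q eta xi = zonal_profile n p q (cdot xi eta) (cdot xi eta)^*%C.
Proof.
rewrite /zonal_kernel big_mkord mulr_sumr; apply: eq_bigr => i _.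
by rewrite /zonal_c !mulrA.
Qed.

Lemma zonal_kernel_conj p q (eta xi : Cn) : (Z p q eta xi)^*%C = Z q p eta xi.
Proof.
rewrite !zonal_kernelE [RHS]zonal_profile_sym.
rewrite [LHS](zonal_profile_rmorph (conjc : {rmorphism C -> C})).
by congr zonal_profile; exact: conjcK.
Qed.

Lemma zonal_kernel_swap p q (eta xi : Cn) : Z p q xi eta = (Z p q eta xi)^*%C.
Proof.
by rewrite zonal_kernel_conj !zonal_kernelE -(cdot_conj xi eta) conjcK zonal_profile_sym.
Qed.

Lemma ezz_zonal_kernel p q (eta xi : Cn) : S xi -> ezz (zonal_poly eta p q) xi = Z p q eta xi.
Proof.
move=> /sphereP Sx; rewrite zonal_kernelE; exact: ezz_zonal_poly.
Qed.

Lemma zonal_kernel_pole p q (eta : Cn) : (1 < n)%N -> S eta -> Z p q eta eta = 1.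
Proof.
by move=> hn /sphereP Se; rewrite zonal_kernelE Se [X in zonal_profile _ _ _ _ X]rmorph1 zonal_profile11.
Qed.

Lemma HpqP p q h : Hpq p q h <->
  exists2 P, harmonic_bideg p q P & forall xi : Cn, S xi -> h xi = ezz P xi.
Proof.
split=> [[P /harmonic_bihomP[Q hQ QP] hP]|[P [hb hl] hP]].
  by exists Q => // xi Sx; rewrite hP // QP.
by exists P => //; exact: bideg_harmonic_bihom.
Qed.

Lemma Hpq_zonal p q (eta : Cn) : (1 < n)%N -> S eta -> Hpq p q (Z p q eta).
Proof.
move=> hn /sphereP Se; apply/HpqP; exists (zonal_poly eta p q).
  exact: harmonic_zonal_poly.
by move=> xi Sx; rewrite ezz_zonal_kernel.
Qed.

End ZonalKernel.

Section SphereDot.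
Variables (R : realType) (n : nat).
Local Notation C := R[i].
Local Notation Cn := 'rV[R[i]]_n.
Local Notation ezz := (@BihomPoly.eval_zzbar R n).
Local Notation S := (sphere R n).
Local Notation Z := (@zonal_kernel R n).
Local Notation V := (@Hpq R n).
Variable sigma : probability (borel R n) R.
Hypothesis hsigma : normalized_surface_measure sigma.
Local Notation dot := (sphere_dot sigma).

Lemma eq_dot (f g h k : Cn -> C) : (forall z, S z -> f z = h z) -> (forall z, S z -> g z = k z) ->
  dot f g = dot h k.
Proof. by move=> fh gk; apply: eq_cint => z Sz; rewrite fh // gk. Qed.

Lemma dot_suml (I : Type) (r : seq I) (c : I -> C) (h : I -> Cn -> C) k :
  (forall i, nice (h i)) -> nice k ->
  dot (fun z => \sum_(i <- r) c i * h i z) k = \sum_(i <- r) c i * dot (h i) k.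
Proof.
move=> nh nk; have nhk i : nice (fun z => h i z * (k z)^*%C).
  by apply: niceM => //; exact: nice_conj.
transitivity (sphere_int sigma (fun z => \sum_(i <- r) c i * (h i z * (k z)^*%C))).
  by apply: eq_cint => z _; rewrite mulr_suml; apply: eq_bigr => i _; rewrite mulrA.
rewrite (cint_sum hsigma) => [|i]; last by apply: niceM => //; exact: nice_cst.
by apply: eq_bigr => i _; rewrite (cintZ hsigma).
Qed.

Lemma dot_conj (h k : Cn -> C) : nice h -> nice k -> (dot h k)^*%C = dot k h.
Proof.
move=> nh nk; rewrite /sphere_dot -(cint_conj hsigma); last by apply: niceM => //; exact: nice_conj.
by apply: eq_cint => z _; rewrite conjc_mul conjcK mulrC.
Qed.

Lemma dot_sumr (I : Type) (r : seq I) (c : I -> C) (h : I -> Cn -> C) k :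
  (forall i, nice (h i)) -> nice k ->
  dot k (fun z => \sum_(i <- r) c i * h i z) = \sum_(i <- r) (c i)^*%C * dot k (h i).
Proof.
move=> nh nk; have nch i : nice (fun z => c i * h i z) by apply: niceM => //; exact: nice_cst.
rewrite -dot_conj //; last exact: nice_sum.
rewrite dot_suml // rmorph_sum; apply: eq_bigr => i _.
by rewrite [LHS]conjc_mul dot_conj.
Qed.

(** Members of [Hpq] are arbitrary off the sphere, so a measurable representative is chosen before
    integrating. *)
Lemma Hpq_nice p q h : V p q h -> exists k, [/\ nice k, V p q k & forall z, S z -> h z = k z].
Proof.
move=> /HpqP[P hP hh]; exists (ezz P); split => //; first exact: nice_ezz.
by apply/HpqP; exists P.
Qed.

Lemma Hpq_sum (I : Type) (r : seq I) (c : I -> C) (h : I -> Cn -> C) p q :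
  (forall i, V p q (h i)) -> V p q (fun z => \sum_(i <- r) c i * h i z).
Proof.
move=> /(_ _)/HpqP hV; have /choice[P hP] : forall i, exists P,
    harmonic_bideg p q P /\ forall z, S z -> h i z = ezz P z.
  by move=> i; have [P ? ?] := hV i; exists P.
have [|Q hQ QE] := @harmonic_bideg_sum R n I r c P p q; first by move=> i; case: (hP i).
apply/HpqP; exists Q => // z Sz; rewrite QE; apply: eq_bigr => i _.
by case: (hP i) => _ ->.
Qed.

Hypothesis hn : (1 < n)%N.
Local Notation kappa p q := (zonal_norm C n p q).

Lemma dot_zonal_kernel p q h (eta : Cn) : V p q h -> S eta -> dot h (Z p q eta) = kappa p q * h eta.
Proof.
move=> /HpqP[P hP hh] Se; rewrite hh //.
rewrite -(zonal_poly_reproducing (sphere_functional_int hsigma) (proj1 (sphereP _) Se) hn hP).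
by apply: eq_cint => z Sz; rewrite ezzM ezz_zonal_kernel // zonal_kernel_conj hh.
Qed.

Lemma dot_zonal_kernel_ortho p q p' q' h (eta : Cn) : V p q h -> S eta -> (p, q) != (p', q') ->
  dot h (Z p' q' eta) = 0.
Proof.
move=> /HpqP[P hP hh] Se pq.
rewrite -(zonal_poly_ortho (sphere_functional_int hsigma) (proj1 (sphereP _) Se) hn hP pq).
by apply: eq_cint => z Sz; rewrite ezzM ezz_zonal_kernel // zonal_kernel_conj hh.
Qed.

Lemma zonal_kernel_le1 p q (eta xi : Cn) : S eta -> S xi -> cabs (Z p q eta xi) <= 1.
Proof.
move=> Se Sx; set w := Z p q eta xi.
(* Expand 0 <= <h, h> for h = Z_eta - w Z_xi with the reproducing property. *)
pose c (b : bool) := if b then 1 else - w.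
pose h z := \sum_(b <- [:: true; false]) c b * Z p q (if b then eta else xi) z.
have hE z : h z = Z p q eta z - w * Z p q xi z.
  by rewrite /h !big_cons big_nil /c mul1r addr0 mulNr.
have hV : V p q h by apply: Hpq_sum => -[]; exact: Hpq_zonal.
have [k [nk kV hk]] := Hpq_nice hV.
have nZ e : S e -> exists2 l, nice l & forall z, S z -> Z p q e z = l z.
  by move=> /(Hpq_zonal p q hn)/Hpq_nice[l [? _ ?]]; exists l.
have [l1 nl1 E1] := nZ _ Se; have [l2 nl2 E2] := nZ _ Sx.
have E : dot k k = kappa p q * (1 - cabs w ^+ 2)%:C%C.
  transitivity (dot k (fun z => \sum_(b <- [:: true; false]) c b * (if b then l1 else l2) z)).
    by apply: eq_dot => // z Sz; rewrite -hk // /h; apply: eq_bigr => -[] _; rewrite ?E1 ?E2.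
  rewrite dot_sumr //; last by case.
  rewrite !big_cons big_nil /c addr0.
  rewrite -(@eq_dot k (Z p q eta) k l1) // -(@eq_dot k (Z p q xi) k l2) //.
  rewrite !dot_zonal_kernel // -!hk // !hE !zonal_kernel_pole //.
  have -> : (1 - cabs w ^+ 2)%:C%C = 1 - w * w^*%C by rewrite mulr_conj rmorphB rmorph1.
  rewrite (zonal_kernel_swap p q eta xi) -/w.
  have -> : (- w)^*%C = - w^*%C by exact: rmorphN.
  have -> : 1^*%C = 1 :> C by exact: rmorph1.
  move: (w^*%C) => w'; ring.
have := cint_sqr_ge0 sigma nk; rewrite -/(dot k k) E.
have k0 : 0 < kappa p q by exact: zonal_norm_gt0.
have -> : kappa p q = (complex.Re (kappa p q))%:C%C by rewrite RRe_real // gtr0_real.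
have {}k0 : 0 < complex.Re (kappa p q).
  by move: k0; rewrite ltcE => /andP[].
rewrite -rmorphM /= pmulr_rge0 // subr_ge0 => w1.
by rewrite -(@expr_le1 _ 2) // cabs_ge0.
Qed.

(* With the inverse H of the Gram matrix G of a basis b, the zonal kernel has value
   1 = kappa * \sum_ij H_ij b_j(eta) conj(b_i(eta)) at its pole eta; integrate over eta. *)
Lemma has_dim_Hpq p q m : has_dim (V p q) m -> m%:R * kappa p q = 1.
Proof.
case=> b0 [V0 indep0 span0].
have /choice[b hb] : forall i, exists k, [/\ nice k, V p q k & forall z, S z -> b0 i z = k z].
  by move=> i; exact: Hpq_nice.
have nb i : nice (b i) by case: (hb i).
have Vb i : V p q (b i) by case: (hb i).
have bE i z : S z -> b0 i z = b i z by case: (hb i) => _ _; apply.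
pose G : 'M[C]_m := \matrix_(j, i) dot (b j) (b i).
have Gu (u : 'rV[C]_m) : u *m G = 0 -> u = 0.
  move=> uG; apply/rowP => j; rewrite mxE; apply: (indep0 (u 0)) => eta Se.
  pose h z := \sum_(i < m) u 0 i * b i z.
  have Vh : V p q h by exact: Hpq_sum.
  have nh : nice h by apply: nice_sum => i; apply: niceM => //; exact: nice_cst.
  transitivity (h eta); first by apply: eq_bigr => i _; rewrite bE.
  have [c hc] := span0 _ (Hpq_zonal p q hn Se).
  have k0 : kappa p q != 0 by rewrite gt_eqF // zonal_norm_gt0.
  apply: (mulfI k0); rewrite mulr0 -(dot_zonal_kernel Vh Se).
  transitivity (dot h (fun z => \sum_(i < m) c i * b i z)).
    by apply: eq_dot => // z Sz; rewrite hc //; apply: eq_bigr => i _; rewrite bE.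
  rewrite dot_sumr // big1 // => i _.
  have /matrixP/(_ 0 i) := uG; rewrite !mxE => E.
  rewrite (_ : dot h (b i) = 0) ?mulr0 // -[RHS]E dot_suml //.
  by apply: eq_bigr => l _; rewrite mxE.
have Gunit : G \in unitmx.
  rewrite -row_free_unit -kermx_eq0; apply/eqP/row_matrixP => i; rewrite row0.
  by apply: Gu; rewrite -row_mul mulmx_ker row0.
pose H := invmx G.
have one (eta : Cn) : S eta ->
    \sum_(i < m) \sum_(j < m) (kappa p q * H i j) * (b j eta * (b i eta)^*%C) = 1.
  move=> Se; have [c hc] := span0 _ (Hpq_zonal p q hn Se).
  pose cv : 'cV[C]_m := \col_i (c i)^*%C; pose bv : 'cV[C]_m := \col_j b j eta.
  have Gc : G *m cv = kappa p q *: bv.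
    apply/colP => j; rewrite !mxE -(dot_zonal_kernel (Vb j) Se).
    transitivity (dot (b j) (fun z => \sum_(i < m) c i * b i z)).
      by rewrite dot_sumr //; apply: eq_bigr => i _; rewrite !mxE mulrC.
    by apply: eq_dot => // z Sz; rewrite hc //; apply: eq_bigr => i _; rewrite bE.
  have cE i : (c i)^*%C = kappa p q * \sum_(j < m) H i j * b j eta.
    have /colP/(_ i) : cv = kappa p q *: (H *m bv) by rewrite scalemxAr -Gc mulKmx.
    by rewrite !mxE => ->; congr (_ * _); apply: eq_bigr => j _; rewrite mxE.
  have c1 : 1^*%C = 1 :> C by exact: rmorph1.
  rewrite -[RHS]c1 -(zonal_kernel_pole p q hn Se) hc // rmorph_sum; apply: eq_bigr => i _.
  rewrite bE // [RHS]conjc_mul cE !mulr_sumr mulr_suml; apply: eq_bigr => j _.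
  by rewrite !mulrA.
have nbb i j : nice (fun z => b j z * (b i z)^*%C) by apply: niceM => //; exact: nice_conj.
have nbbc i j : nice (fun z => (kappa p q * H i j) * (b j z * (b i z)^*%C)).
  by apply: niceM => //; exact: nice_cst.
rewrite -[RHS](cint_cst hsigma 1) -(eq_cint _ one) (cint_sum hsigma); last by move=> i; exact: nice_sum.
under eq_bigr => i _ do rewrite (cint_sum hsigma) //.
transitivity (kappa p q * \tr (H *m G)); first by rewrite mulVmx // mxtrace1 mulrC.
rewrite /mxtrace mulr_sumr; apply: eq_bigr => i _; rewrite mxE mulr_sumr; apply: eq_bigr => j _.
by rewrite (cintZ hsigma) // mxE mulrA.
Qed.

End SphereDot.

Lemma dependent_family (F : fieldType) m N (A : 'M[F]_(m, N)) : (N < m)%N ->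
  exists2 u : 'rV[F]_m, u != 0 & u *m A = 0.
Proof.
move=> Nm; have : ~~ row_free A.
  by rewrite /row_free neq_ltn (leq_ltn_trans (rank_leq_col A) Nm).
rewrite -kermx_eq0 => /rowV0Pn[u /sub_kermxP uA u0]; by exists u.
Qed.

(** Cauchy-Schwarz, from the squared norm 1 - |w|^2 of xi - w eta. *)
Lemma cdot_le1 (R : realType) n (xi eta : 'rV[R[i]]_n) : sphere R n xi -> sphere R n eta ->
  cabs (cdot xi eta) <= 1.
Proof.
move=> /sphereP Sx /sphereP Se; set w := cdot xi eta.
have : cdot (xi + (- w) *: eta) (xi + (- w) *: eta) = (1 - cabs w ^+ 2)%:C%C.
  have -> : (1 - cabs w ^+ 2)%:C%C = 1 - w * w^*%C by rewrite mulr_conj rmorphB rmorph1.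
  rewrite cdotDl !cdotDr !cdotZl !cdotZr Sx Se -(cdot_conj xi eta) -/w.
  have -> : (- w)^*%C = - w^*%C by exact: rmorphN.
  move: (w^*%C) => w'; ring.
rewrite cdotE => /complexI w1; have : 0 <= 1 - cabs w ^+ 2.
  by rewrite -w1 sumr_ge0 // => j _; exact: sqr_ge0.
by rewrite subr_ge0 => w2; rewrite -(@expr_le1 _ 2) // cabs_ge0.
Qed.

(** * Dimension and zonal expansion of monomials *)

Section Dimension.
Variables (R : realType) (n : nat).
Local Notation C := R[i].
Local Notation Cn := 'rV[R[i]]_n.
Local Notation S := (sphere R n).
Local Notation Z := (@zonal_kernel R n).
Local Notation V := (@Hpq R n).

(** A basis is an independent family of maximal size; sizes are bounded by the number of spanning
    monomials. *)
Lemma has_dim_ex p q : exists m, has_dim (V p q) m.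
Proof.
have [N [e he]] := @bideg_finite_span R n p q.
have spanV h : V p q h -> exists c : 'I_N -> C, forall z, S z -> h z = \sum_(i < N) c i * e i z.
  by move=> /HpqP[P [/he[c hc] _] hP]; exists c => z Sz; rewrite hP.
pose indep m (b : 'I_m -> Cn -> C) := (forall i, V p q (b i)) /\
  forall c : 'I_m -> C, (forall xi, S xi -> \sum_(i < m) c i * b i xi = 0) -> forall i, c i = 0.
pose P m := `[< exists b, @indep m b >].
have P0 : exists m, P m.
  by exists 0%N; apply/asboolP; exists (fun=> fun=> 0); split => [[]//|c _ []].
have PN m : P m -> (m <= N)%N.
  move=> /asboolP[b [Vb hb]]; rewrite leqNgt; apply/negP => Nm.
  have /choice[c hc] := fun i => spanV _ (Vb i).
  have [u /eqP u0 uA] := dependent_family (\matrix_(i < m, j < N) c i j) Nm.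
  apply: u0; apply/rowP => i; rewrite mxE; apply: (hb (u 0)) => z Sz.
  under eq_bigr => k _ do rewrite hc // mulr_sumr.
  rewrite exchange_big /= big1 // => j _.
  under eq_bigr => k _ do rewrite mulrA.
  rewrite -mulr_suml; have /rowP/(_ j) := uA; rewrite !mxE.
  by under eq_bigr => k _ do rewrite mxE; move=> ->; rewrite mul0r.
case: (ex_maxnP P0 PN) => m /asboolP[b [Vb hb]] mmax.
exists m, b; split => // h Vh.
have nP : ~ P m.+1 by move=> /mmax; rewrite ltnn.
pose b' (i : 'I_m.+1) := oapp b h (unlift ord0 i).
have Vb' i : V p q (b' i) by rewrite /b'; case: (unlift _ _).
(* Maximality gives a relation involving [h], whose coefficient cannot vanish because [b] is
   independent. *)
have : ~ indep _ b' by move=> ib; apply: nP; apply/asboolP; exists b'.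
move=> /not_andP[//|/existsNP[c /not_implyP[hc /existsNP[i ci]]]].
have E z : S z -> c ord0 * h z + \sum_(i < m) c (lift ord0 i) * b i z = 0.
  move=> /hc; rewrite big_ord_recl /b' unlift_none /= => E.
  by rewrite -[RHS]E; congr (_ + _); apply: eq_bigr => k _; rewrite liftK.
have [c0|c0] := eqVneq (c ord0) 0.
  exfalso; apply: ci; have lc := hb (fun k => c (lift ord0 k)).
  case: (unliftP ord0 i) => [k ->|->] //; apply: lc => z Sz.
  by have := E z Sz; rewrite c0 mul0r add0r.
exists (fun k => - (c ord0)^-1 * c (lift ord0 k)) => z Sz.
under eq_bigr do rewrite -mulrA.
rewrite -mulr_sumr; have /eqP := E z Sz; rewrite addrC addr_eq0 => /eqP ->.
by rewrite mulrNN mulKf.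
Qed.

Variable sigma : probability (borel R n) R.
Hypothesis hsigma : normalized_surface_measure sigma.
Hypothesis hn : (1 < n)%N.
Local Notation kappa p q := (zonal_norm C n p q).
Local Notation dim p q := ((dimH R n p q)%:R : C).
Local Notation dot := (sphere_dot sigma).

(** By [has_dim_ex], [dimH] is a genuine dimension and not the default value 0 of [xget]. *)
Lemma dimH_norm p q : dim p q * kappa p q = 1.
Proof.
apply: (has_dim_Hpq hsigma hn); exact: (xgetPex 0%N (has_dim_ex p q)).
Qed.

Variable eta : Cn.
Hypothesis Seta : S eta.

Lemma nice_cdot : nice (fun z => cdot z eta).
Proof. by apply: nice_sum => j; apply: niceM; [exact: nice_coord|exact: nice_cst]. Qed.

Lemma niceX (h : Cn -> C) k : nice h -> nice (fun z => h z ^+ k).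
Proof.
move=> nh; elim: k => [|k IHk]; first by under eq_fun do rewrite expr0; exact: nice_cst.
by under eq_fun do rewrite exprS; exact: niceM.
Qed.

Lemma dot_monomial p q r :
  dot (fun z => cdot z eta ^+ (p + r) * (cdot z eta)^*%C ^+ (q + r)) (Z p q eta)
  = pairing_coef C n q p r.
Proof.
rewrite -(zonal_poly_monomial (sphere_functional_int hsigma) (proj1 (sphereP _) Seta) hn).
apply: eq_cint => z Sz.
by rewrite ezzM ezz_zonal_kernel // zonal_kernel_conj mulrC ezz_pairing_monomial.
Qed.

(** Pairing an expansion from [monomial_zonal_span] with one kernel leaves, by orthogonality, kappa
    times the coefficient sought; the left side is the known integral [dot_monomial], and 1 / kappa
    is the dimension. *)
Lemma monomial_zonal j k xi : S xi -> cdot xi eta ^+ j * (cdot xi eta)^*%C ^+ k =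
  \sum_(i < (minn j k).+1)
     (pairing_coef C n (k - i) (j - i) i * dim (j - i) (k - i)) * Z (j - i) (k - i) eta xi.
Proof.
move=> Sxi; have [b hb] := monomial_zonal_span C hn j k.
have hb' z : cdot z eta ^+ j * (cdot z eta)^*%C ^+ k =
    \sum_(i < (minn j k).+1) b i * Z (j - i) (k - i) eta z.
  by rewrite hb; apply: eq_bigr => i _; rewrite zonal_kernelE.
rewrite hb'; apply: eq_bigr => i0 _; congr (_ * _).
have i0j : (i0 <= j)%N by have := ltn_ord i0; lia.
have i0k : (i0 <= k)%N by have := ltn_ord i0; lia.
have := dot_monomial (j - i0) (k - i0) i0; rewrite !subnK // => <-.
have /choice[l hl] : forall i : 'I_(minn j k).+1, exists l, [/\ nice l,
    V (j - i) (k - i) l & forall z, S z -> Z (j - i) (k - i) eta z = l z].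
  by move=> i; apply: Hpq_nice; exact: Hpq_zonal.
have -> : dot (fun z => cdot z eta ^+ j * (cdot z eta)^*%C ^+ k) (Z (j - i0) (k - i0) eta)
    = dot (fun z => \sum_(i < (minn j k).+1) b i * l i z) (l i0).
  apply: eq_dot => z Sz; last by case: (hl i0) => _ _; apply.
  by rewrite hb'; apply: eq_bigr => i _; congr (_ * _); case: (hl i) => _ _; apply.
rewrite (dot_suml hsigma); last 2 first.
- by move=> i; case: (hl i).
- by case: (hl i0).
have E i : dot (l i) (l i0) = dot (l i) (Z (j - i0) (k - i0) eta).
  by apply: eq_dot => // z Sz; case: (hl i0) => _ _ ->.
rewrite (bigD1 i0) //= big1 ?addr0 => [|i ii].
  rewrite E (dot_zonal_kernel hsigma hn) //; last by case: (hl i0).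
  have <- : Z (j - i0) (k - i0) eta eta = l i0 eta by case: (hl i0) => _ _; apply.
  by rewrite zonal_kernel_pole // mulr1 -mulrA [_ * dim _ _]mulrC dimH_norm mulr1.
rewrite E (dot_zonal_kernel_ortho hsigma hn (p := j - i) (q := k - i)) ?mulr0 //.
  by case: (hl i).
apply: contraNneq ii => -[e1 e2]; apply/eqP/val_inj => /=.
by have := ltn_ord i; lia.
Qed.

Lemma monomial_weights j k : \sum_(i < (minn j k).+1)
   (pairing_coef C n (k - i) (j - i) i * dim (j - i) (k - i)) = 1.
Proof.
have := monomial_zonal j k Seta; have /sphereP -> := Seta.
have -> : 1^*%C = 1 :> C by exact: rmorph1.
rewrite !expr1n mulr1 => E; rewrite -[RHS]/(1 : C) [RHS]E; apply: eq_bigr => i _.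
by rewrite zonal_kernel_pole // mulr1.
Qed.

End Dimension.

Lemma pairing_coef00 (F : numFieldType) n r :
  pairing_coef F n 0 0 r = ('C(n.-1 + r, r)%:R)^-1.
Proof.
rewrite /pairing_coef !add0n !addn0.
have := bin_fact (leq_addl n.-1 r); rewrite addnK => <-.
have f0 k : k`!%:R != 0 :> F by rewrite pnatr_eq0 -lt0n fact_gt0.
have b0 : 'C(n.-1 + r, r)%:R != 0 :> F by rewrite pnatr_eq0 -lt0n bin_gt0 leq_addl.
by rewrite !natrM; field; rewrite b0 !f0.
Qed.

(** Compare with the binomial of r + 1 over r; this growth forces the circle to have measure 0. *)
Lemma leq_bin_succ n r : (1 < n)%N -> (r < 'C(n.-1 + r, r))%N.
Proof.
case: n => [|[|n]] // _ /=; rewrite -(binSn r) leq_bin2l //.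
by rewrite addSn ltnS leq_addl.
Qed.

(** * The points with |(z | eta)| = 1 *)

Section BoundaryCircle.
Variables (R : realType) (n : nat).
Local Notation C := R[i].
Local Notation Cn := 'rV[R[i]]_n.
Local Notation S := (sphere R n).
Variable sigma : probability (borel R n) R.
Hypothesis hsigma : normalized_surface_measure sigma.
Hypothesis hn : (1 < n)%N.
Variable eta : Cn.
Hypothesis Seta : S eta.

(* The set |(z | eta)| = 1 has measure at most the integral of |(z | eta)|^(2 k),
   which is 1 / 'C(n - 1 + k, k), for every k. *)
Lemma boundary_null : exists N : set (borel R n), [/\ measurable N, sigma N = 0%E
  & forall z, S z -> ~ N z -> cabs (cdot z eta) < 1].
Proof.
pose g (z : Cn) : R := complex.Re (cdot z eta * (cdot z eta)^*%C).
have gE z : g z = cabs (cdot z eta) ^+ 2 by rewrite /g mulr_conj.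
have ng : nice (fun z => cdot z eta * (cdot z eta)^*%C).
  by apply: niceM; [exact: nice_cdot|apply: nice_conj; exact: nice_cdot].
have mg : measurable_fun [set: borel R n] (g : borel R n -> R) by case: ng => -[].
pose N : set (borel R n) := S `&` g @^-1` [set 1].
have mS := @sphere_measurable R n.
have mN : measurable N.
  by apply: measurableI => //; rewrite -[X in measurable X]setTI; exact: mg.
exists N; split => //; last first.
  move=> z Sz Nz; rewrite lt_neqAle cdot_le1 // andbT; apply/eqP => w1; apply: Nz.
  by split => //=; rewrite gE w1 expr1n.
have bnd k : (sigma N <= (k.+1%:R^-1)%:E)%E.
  have [ig _] := nice_integrable hsigma (niceX k ng).
  have gk z : complex.Re ((cdot z eta * (cdot z eta)^*%C) ^+ k) = g z ^+ k.
    by rewrite gE mulr_conj -rmorphXn.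
  have Z00 z : zonal_kernel 0 0 eta z = 1.
    rewrite zonal_kernelE -(zonal_profile11 C hn 0 0) /zonal_profile; apply: eq_bigr => i _.
    by rewrite !sub0n !expr0.
  have rint : Rintegral sigma S (fun z => g z ^+ k) = ('C(n.-1 + k, k)%:R)^-1.
    have := dot_monomial hsigma hn Seta 0 0 k.
    rewrite pairing_coef00 -(rmorph_nat (real_complex R)) -fmorphV => /(congr1 (@complex.Re R)) /= <-.
    apply: eq_Rintegral => z _; rewrite /= !add0n Z00.
    by rewrite -exprMn -gk (_ : 1^*%C = 1 :> C) ?mulr1 //; exact: rmorph1.
  have gfin : (\int[sigma]_(z in S) (g z ^+ k)%:E)%E = (Rintegral sigma S (fun z => g z ^+ k))%:E :> \bar R.
    rewrite /Rintegral fineK // integrable_fin_num //.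
    by apply: eq_integrable ig => // z _ /=; rewrite gk.
  apply: (@le_trans _ _ (\int[sigma]_(z in S) (g z ^+ k)%:E)%E); last first.
    rewrite gfin rint lee_fin lef_pV2 ?posrE ?ltr0n ?ler_nat //; first exact: leq_bin_succ.
    by rewrite bin_gt0 leq_addl.
  have -> : sigma N = (\int[sigma]_(z in S) (\1_N z)%:E)%E.
    by rewrite integral_indic // setIidl //; exact: subIsetl.
  apply: ge0_le_integral_nomeas => z Sz; first by rewrite lee_fin.
  rewrite lee_fin indicE; case: (boolP (z \in N)) => [|_]; last by rewrite gE exprn_ge0 ?sqr_ge0.
  by rewrite inE => -[_ /= ->]; rewrite expr1n.
apply/eqP; rewrite eq_le measure_ge0 andbT; apply/lee_addgt0Pr => e e0; rewrite add0e.
have [k hk] : exists k : nat, k.+1%:R^-1 < e.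
  by exists (Num.truncn e^-1); rewrite invf_plt ?posrE ?ltr0n // truncnS_gt.
by apply: (le_trans (bnd k)); rewrite lee_fin ltW.
Qed.

End BoundaryCircle.

(** * The zonal series *)

Section Summation.
Variable R : realType.
Local Notation C := R[i].

Lemma hasum_inj (K I : choiceType) (f : I -> K) (g : K -> I) (v : K -> C) s :
  cancel f g -> (forall k, f (g k) != k -> v k = 0) ->
  hasum v s -> hasum (v \o f) s.
Proof.
move=> fK v0 hs e e0; have [F0 hF0] := hs e e0.
exists [fset g k | k in F0]%fset => F FF.
have -> : \sum_(i <- F) (v \o f) i = \sum_(k <- [fset f i | i in F]%fset) v k.
  by rewrite big_imfset //= => i j _ _; exact: (can_inj fK).
rewrite (big_fset_incl _ (fsubsetUr F0 [fset f i | i in F]%fset)); first exact/hF0/fsubsetUl.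
move=> k; rewrite in_fsetU => /orP[kF0 kn|-> //]; apply: v0; apply: contraNneq kn => <-.
by apply: in_imfset; rewrite (fsubsetP FF) // in_imfset.
Qed.

(** [F0] depends only on the majorant [b]; this is the Weierstrass test in the form that gives
    uniformity in xi. *)
Lemma hasum_tail_bound (I : choiceType) (v : I -> C) (b : I -> R) s e (F0 : {fset I}) :
  (forall i, cabs (v i) <= b i) -> hasum v s ->
  (forall t : seq I, uniq t -> (forall i, i \in t -> i \notin F0) -> \sum_(i <- t) b i <= e) ->
  forall F : {fset I}, (F0 `<=` F)%fset -> cabs (\sum_(i <- F) v i - s) <= e.
Proof.
move=> vb hs hb F F0F; apply/ler_addgt0Pr => e' e'0; have [G0 hG0] := hs e' e'0.
have := hG0 (G0 `|` F)%fset (fsubsetUl _ _) => hG.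
rewrite -(cabsB s) (_ : s - _ = - (\sum_(i <- (G0 `|` F)%fset) v i - s)
  + (\sum_(i <- (G0 `|` F)%fset) v i - \sum_(i <- F) v i)); last by ring.
rewrite (le_trans (cabsD _ _)) // cabsN addrC lerD //.
have FG : perm_eq [seq i <- (G0 `|` F)%fset | i \in F] F.
  apply: uniq_perm; rewrite ?filter_uniq ?fset_uniq // => i.
  by rewrite mem_filter in_fsetU; case: (i \in F); rewrite ?orbT.
rewrite (bigID (fun i => i \in F)) /= -big_filter (perm_big _ FG) [X in cabs X](_ : _ =
  \sum_(i <- (G0 `|` F)%fset | i \notin F) v i); last by rewrite addrAC subrr add0r.
rewrite -big_filter (le_trans (cabs_sum _ _ _)) // (le_trans (ler_sum _ (fun i _ => vb i))) //.
apply: hb; first by rewrite filter_uniq ?fset_uniq.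
move=> i; rewrite mem_filter => /andP[iF _]; apply: contraNN iF; exact: fsubsetP.
Qed.

End Summation.

Section ZonalSeries.
Variables (R : realType) (n : nat).
Local Notation C := R[i].
Local Notation Cn := 'rV[R[i]]_n.
Local Notation S := (sphere R n).
Local Notation Z := (@zonal_kernel R n).
Local Notation dim p q := ((dimH R n p q)%:R : C).
Variable sigma : probability (borel R n) R.
Hypothesis hsigma : normalized_surface_measure sigma.
Hypothesis hn : (1 < n)%N.
Variable phi : C -> C.
Variable A : R.
Hypothesis hA : bsum (fun i : nat * nat => taylor_coef phi i.1 i.2) A.
Variable T : C -> C.
Hypothesis hT : forall w, cabs w <= 1 ->
  hasum (power_terms (taylor_coef phi) w w^*%C) (T w).
Variable eta : Cn.
Hypothesis Seta : S eta.

(* the contribution of the Taylor coefficient of bidegree (p + r, q + r) to the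
   coefficient of Z^(p,q), for k = ((p, q), r) *)
Definition zonal_weight (k : nat * nat * nat) : C :=
  pairing_coef C n k.1.2 k.1.1 k.2 * dim k.1.1 k.1.2.
Definition taylor_index (k : nat * nat * nat) : nat * nat := (k.1.1 + k.2, k.1.2 + k.2)%N.
Definition zonal_part (k : nat * nat * nat) : C :=
  taylor_coef phi (taylor_index k).1 (taylor_index k).2 * zonal_weight k.

Lemma dim_gt0 p q : 0 < dim p q.
Proof.
rewrite ltr0n lt0n; apply/eqP => d0; have := dimH_norm hsigma hn p q.
by rewrite d0 mul0r => /eqP; rewrite eq_sym oner_eq0.
Qed.

Lemma pairing_coef_gt0 p q r : 0 < pairing_coef C n p q r.
Proof. by rewrite /pairing_coef !(mulr_gt0, invr_gt0) // ltr0n fact_gt0. Qed.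

Lemma zonal_weight_ge0 k : zonal_weight k = (cabs (zonal_weight k))%:C%C.
Proof.
rewrite -cabsE gtr0_norm //; apply: mulr_gt0; [exact: pairing_coef_gt0|exact: dim_gt0].
Qed.

Definition taylor_fibre (j k : nat) : seq (nat * nat * nat) :=
  [seq ((j - i, k - i), i)%N | i <- iota 0 (minn j k).+1].

Lemma taylor_fibre_uniq j k : uniq (taylor_fibre j k).
Proof. by rewrite map_inj_uniq ?iota_uniq // => a b [_ _ ->]. Qed.

Lemma mem_taylor_fibre j k x : (x \in taylor_fibre j k) = (taylor_index x == (j, k)).
Proof.
apply/mapP/eqP => [[l]|]; first by rewrite mem_iota => hi ->; rewrite /taylor_index /=; congr (_, _); lia.
case: x => -[p q] r [<- <-]; exists r; first by rewrite mem_iota; lia.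
by rewrite !addnK.
Qed.

Lemma sum_taylor_fibre (V : nmodType) (F : nat * nat * nat -> V) j k :
  \sum_(x <- taylor_fibre j k) F x = \sum_(i < (minn j k).+1) F ((j - i, k - i), i : nat)%N.
Proof. by rewrite big_map -(big_mkord xpredT (fun i => F ((j - i, k - i), i)%N)). Qed.

(** On a Taylor fibre the weights are positive with sum 1, so the moduli add up to that of the
    Taylor coefficient: the l^1 bound is preserved. *)
Lemma bsum_zonal_part : bsum zonal_part A.
Proof.
apply: (rsum_fibre (pi := taylor_index) _ hA) => -[j k] s us hs.
apply: (@le_trans _ _ (\sum_(x <- taylor_fibre j k) cabs (zonal_part x))).
  apply: sum_uniq_subset => //; [by move=> i; exact: cabs_ge0|exact: taylor_fibre_uniq|].
  by move=> x /hs xjk; rewrite mem_taylor_fibre xjk.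
rewrite (eq_big_seq (fun x => cabs (taylor_coef phi j k) * cabs (zonal_weight x))); last first.
  by move=> x; rewrite mem_taylor_fibre /zonal_part => /eqP ->; rewrite cabsM.
rewrite -mulr_sumr [X in _ * X](_ : _ = 1) ?mulr1 //; apply: complexI.
rewrite rmorph_sum (eq_bigr _ (fun x _ => esym (zonal_weight_ge0 x))) sum_taylor_fibre.
rewrite [RHS]rmorph1 -(monomial_weights hsigma hn Seta j k); apply: eq_bigr => i _.
by [].
Qed.

Definition zonal_family (xi : Cn) (x : nat * nat * nat) : C :=
  zonal_part x * Z x.1.1 x.1.2 eta xi.

Lemma bsum_zonal_family xi : S xi -> bsum (zonal_family xi) A.
Proof.
move=> Sx; apply: bsum_le bsum_zonal_part => x; rewrite cabsM ler_piMr ?cabs_ge0 //.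
exact: (zonal_kernel_le1 hsigma).
Qed.

(** Grouping by [taylor_index] reassembles each Taylor monomial through [monomial_zonal]. *)
Lemma hasum_zonal_family xi : S xi -> hasum (zonal_family xi) (T (cdot xi eta)).
Proof.
move=> Sx; have [s hs] := bsum_hasum (bsum_zonal_family Sx).
suff <- : s = T (cdot xi eta) by [].
apply: hasum_unique (hT (cdot_le1 Sx Seta)).
apply: (hasum_partition (pi := taylor_index) (bsum_zonal_family Sx) hs) => -[j k] /=.
rewrite -mulrA (monomial_zonal hsigma hn Seta j k Sx) mulr_sumr.
have -> : \sum_(i < (minn j k).+1) taylor_coef phi j k *
    (pairing_coef C n (k - i) (j - i) i * dim (j - i) (k - i) * Z (j - i) (k - i) eta xi)
    = \sum_(x <- taylor_fibre j k) (if taylor_index x == (j, k) then zonal_family xi x else 0).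
  rewrite sum_taylor_fibre; apply: eq_bigr => i _.
  have -> : taylor_index ((j - i, k - i), i : nat)%N = (j, k).
    by rewrite /taylor_index /=; have := ltn_ord i => hi; congr (_, _); lia.
  rewrite eqxx /zonal_family /zonal_part mulrA /=.
  have [-> ->] : (j - i + i = j /\ k - i + i = k)%N by have := ltn_ord i => hi; split; lia.
  by [].
apply: hasum_seq => [|x]; first exact: taylor_fibre_uniq.
by rewrite mem_taylor_fibre => /negbTE ->.
Qed.

(** The factorials (p+r)! (q+r)! of [pairing_coef] cancel the Taylor denominators. *)
Lemma zonal_part_coef p q r : zonal_part ((p, q), r) =
  ((n.-1)`!%:R * dim p q) * zonal_coef_term n phi p q r.
Proof.
rewrite /zonal_part /zonal_weight /taylor_coef /pairing_coef /zonal_coef_term /=.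
rewrite (addnAC n.-1 q p).
have f0 k : k`!%:R != 0 :> C by rewrite pnatr_eq0 -lt0n fact_gt0.
move: (wirtinger_iter _ _ _ _) => D.
move: (f0 (p + r)%N) (f0 (q + r)%N) (f0 r) (f0 (n.-1 + p + q + r)%N).
move: (_`!%:R) (_`!%:R) (_`!%:R) (_`!%:R) => a b c d a0 b0 c0 d0.
by field; rewrite a0 b0 c0 d0.
Qed.

Lemma zonal_coef_sum p q : cvgn (series (zonal_coef_term n phi p q)) /\
  hasum (fun x => if x.1 == (p, q) then zonal_part x else 0)
    (zonal_coef n phi p q * dim p q).
Proof.
have [s hs] : exists s, hasum (fun x => if x.1 == (p, q) then zonal_part x else 0) s.
  apply: (@bsum_hasum _ _ _ A); apply: bsum_le bsum_zonal_part => x.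
  by case: ifP => // _; rewrite cabs0 cabs_ge0.
have c0 : (n.-1)`!%:R * dim p q != 0.
  by rewrite mulf_neq0 ?(gt_eqF (dim_gt0 p q)) // pnatr_eq0 -lt0n fact_gt0.
have : hasum (zonal_coef_term n phi p q) (((n.-1)`!%:R * dim p q)^-1 * s).
  have := hasum_inj (f := fun r => ((p, q), r)) (g := snd) _ _ hs.
  move=> /(_ (fun=> erefl)) h; apply: eq_hasum (hasumZ _ (h _)).
    by move=> r /=; rewrite eqxx zonal_part_coef mulrA mulVf // mul1r.
  by move=> -[y r] /= yr; case: eqP => // yE; rewrite yE eqxx in yr.
move=> /cvg_series_hasum hc; split; first by apply/cvg_ex; eexists; exact: hc.
suff -> : zonal_coef n phi p q * dim p q = s by [].
by rewrite /zonal_coef (cvg_lim _ hc) // mulrAC mulrA mulfV // mul1r.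
Qed.

Local Notation term p q xi := (zonal_coef n phi p q * dim p q * Z p q eta xi).

Lemma zonal_series xi : S xi ->
  bsum (fun i : nat * nat => term i.1 i.2 xi) A /\
  hasum (fun i : nat * nat => term i.1 i.2 xi) (T (cdot xi eta)).
Proof.
move=> Sx.
have hf (i : nat * nat) : hasum (fun x => if x.1 == i then zonal_family xi x else 0) (term i.1 i.2 xi).
  case: i => p q; have [_ h] := zonal_coef_sum p q.
  rewrite mulrC; apply: eq_hasum (hasumZ _ h) => x.
  by case: eqP => [xE|_]; rewrite ?mulr0 // /zonal_family xE mulrC.
split; first exact: (bsum_partition (pi := fst) (bsum_zonal_family Sx) hf).
exact: (hasum_partition (pi := fst) (bsum_zonal_family Sx) (hasum_zonal_family Sx) hf).
Qed.

(** Since the kernels are bounded by 1, the constants d_(p,q) dim H^(p,q) form a majorant common to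
    all xi. *)
Lemma zonal_series_uniform (e : R) : 0 < e -> exists F0 : {fset nat * nat},
  forall F : {fset nat * nat}, (F0 `<=` F)%fset -> forall xi, S xi ->
  cabs (\sum_(i <- F) term i.1 i.2 xi - T (cdot xi eta)) <= e.
Proof.
move=> e0; have hb : bsum (fun i : nat * nat => zonal_coef n phi i.1 i.2 * dim i.1 i.2) A.
  apply: (bsum_partition (pi := fst) bsum_zonal_part) => -[p q].
  by have [_] := zonal_coef_sum p q.
have [F0 hF0] := rsum_tail (fun=> cabs_ge0 _) hb e0; exists F0 => F FF xi Sx.
apply: (hasum_tail_bound _ (proj2 (zonal_series Sx)) hF0) => // i.
by rewrite cabsM ler_piMr ?cabs_ge0 // (zonal_kernel_le1 hsigma).
Qed.

End ZonalSeries.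

(** * Orthogonal projections and convergence in L^2 *)

Section Expansion.
Variables (R : realType) (n : nat).
Local Notation C := R[i].
Local Notation Cn := 'rV[R[i]]_n.
Local Notation S := (sphere R n).
Local Notation Z := (@zonal_kernel R n).
Local Notation V := (@Hpq R n).

Lemma nice_zonal_kernel p q (eta : Cn) : nice (Z p q eta).
Proof.
apply: (eq_nice (fun xi => esym (zonal_kernelE p q eta xi))); apply: nice_sum => i.
apply: niceM; first by apply: niceM; [exact: nice_cst|apply: niceX; exact: nice_cdot].
by apply: niceX; apply: nice_conj; exact: nice_cdot.
Qed.

Variable sigma : probability (borel R n) R.
Hypothesis hsigma : normalized_surface_measure sigma.
Local Notation dot := (sphere_dot sigma).

Lemma dotB (f g h : Cn -> C) : nice f -> nice g -> nice h ->
  dot (fun z => f z - g z) h = dot f h - dot g h.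
Proof.
move=> nf ng nh; have nc := nice_conj nh.
have nfh := niceM nf nc; have ngh := niceM ng nc.
rewrite /sphere_dot -[X in _ - X]mul1r -mulNr -(cintZ hsigma _ ngh).
rewrite -(cintD hsigma nfh) //; last by apply: niceM => //; exact: nice_cst.
by apply: eq_cint => z _; rewrite mulrBl mulN1r.
Qed.

Section Limit.
Hypothesis hn : (1 < n)%N.
Variables (eta : Cn) (c : nat -> nat -> C) (s : Cn -> C) (M : R).
Hypothesis Seta : S eta.
Local Notation term p q xi := (c p q * Z p q eta xi).
Local Notation psum F xi := (\sum_(i <- F) term i.1 i.2 xi).
Hypothesis term_unif : forall e : R, 0 < e -> exists F0 : {fset nat * nat},
  forall F : {fset nat * nat}, (F0 `<=` F)%fset -> forall xi, S xi ->
  cabs (psum F xi - s xi) <= e.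
Hypothesis s_bound : forall xi, S xi -> cabs (s xi) <= M.

Lemma nice_term p q : nice (fun xi => term p q xi).
Proof. by apply: niceM; [exact: nice_cst|exact: nice_zonal_kernel]. Qed.

Lemma nice_psum (F : {fset nat * nat}) : nice (fun xi => psum F xi).
Proof. by apply: nice_sum => i; exact: nice_term. Qed.

Lemma uniformly_summable_term :
  uniformly_summable_to S (fun p q xi => term p q xi) s.
Proof.
move=> P /uniform_nbhs[E [entE EP]]; move: entE; rewrite -entourage_from_ballE => -[e /= e0 eE].
have e1 : e = (complex.Re e)%:C%C by rewrite RRe_real // gtr0_real.
have e2 : 0 < complex.Re e by rewrite -ltcR -e1.
have [|F0 hF] := term_unif (e := complex.Re e / 2); first by rewrite divr_gt0.
exists F0 => // F FF; apply: EP => xi Sxi; apply: eE => /=.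
rewrite -ball_normE /ball_ /= e1 cabsE ltcR cabsB.
by apply: (le_lt_trans (hF F FF xi Sxi)); rewrite ltr_pdivrMr // ltr_pMr // ltr1n.
Qed.

(** Nothing is known of [s] off the sphere; cutting it to 0 there makes it measurable on all of
    C^n. *)
Definition sphere_limit (xi : Cn) : C := if xi \in S then s xi else 0.

(** Measurability passes to limits of sequences, so a sequence of finite sets with errors 1/(m + 1)
    is extracted from the convergence along finite sets. *)
Lemma nice_sphere_limit : nice sphere_limit.
Proof.
have sE z : S z -> sphere_limit z = s z by move=> Sz; rewrite /sphere_limit mem_set.
split; last by exists M => z Sz; rewrite sE // s_bound.
have /choice[F hF] : forall m : nat, exists F : {fset nat * nat},
    forall xi, S xi -> cabs (psum F xi - s xi) <= m.+1%:R^-1.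
  move=> m; have [|F0 h] := term_unif (e := m.+1%:R^-1); first by rewrite invr_gt0.
  by exists F0; apply: h.
have cvg (r : C -> R) : (forall x y, `|r x - r y| <= cabs (x - y)) ->
    forall xi, S xi -> r (psum (F m) xi) @[m --> \oo] --> r (s xi).
  move=> hr xi Sxi; apply/cvgrPdist_le => e e0.
  near=> m; rewrite distrC (le_trans (hr _ _)) // (le_trans (hF m xi Sxi)) // ltW //.
  near: m; exact: (near_infty_natSinv_lt (PosNum e0)).
have mS := @sphere_measurable R n.
split.
  have -> : (fun z : borel R n => complex.Re (sphere_limit z)) =
      (fun z : borel R n => complex.Re (s z)) \_ S.
    by apply/funext => z; rewrite /sphere_limit patchE; case: ifP.
  apply/(measurable_restrictT _ mS).
  apply: (@measurable_fun_cvg _ (borel R n) R S (fun m z => complex.Re (psum (F m) z))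
    (fun z => complex.Re (s z))) => [m|z Sz].
    by apply: measurable_funTS; case: (nice_psum (F m)) => -[].
  by apply: (cvg (@complex.Re R)) => // x y; rewrite -raddfB; exact: Re_le_cabs.
have -> : (fun z : borel R n => complex.Im (sphere_limit z)) =
    (fun z : borel R n => complex.Im (s z)) \_ S.
  by apply/funext => z; rewrite /sphere_limit patchE; case: ifP.
apply/(measurable_restrictT _ mS).
apply: (@measurable_fun_cvg _ (borel R n) R S (fun m z => complex.Im (psum (F m) z))
    (fun z => complex.Im (s z))) => [m|z Sz].
  by apply: measurable_funTS; case: (nice_psum (F m)) => -[].
by apply: (cvg (@complex.Im R)) => // x y; rewrite -raddfB; exact: Im_le_cabs.
Unshelve. all: by end_near.
Qed.

Variables (f : Cn -> C) (N : set (borel R n)).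
Hypothesis mN : measurable N.
Hypothesis N0 : sigma N = 0%E.
Hypothesis fs : forall z, S z -> ~ N z -> f z = s z.

Lemma expansion_term : spherical_harmonic_expansion sigma f (fun p q xi => term p q xi).
Proof.
have VZ p q : V p q (fun xi => term p q xi).
  have := Hpq_sum [:: tt] (fun=> c p q) (fun=> Hpq_zonal p q hn Seta).
  by under [X in V p q X]funext => z do rewrite big_seq1.
have sE z : S z -> sphere_limit z = s z by move=> Sz; rewrite /sphere_limit mem_set.
have nl := nice_sphere_limit.
split=> //.
- move=> p q h /Hpq_nice[k [nk Vk hk]].
  have nt := nice_term p q.
  have -> : dot (fun xi => f xi - term p q xi) h = dot (fun xi => sphere_limit xi - term p q xi) k.
    apply: (cint_null mN N0).
      apply: cmeasurableM; last by apply: cmeasurable_conj; case: nk.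
      rewrite -[X in cmeasurable X]/(fun z => sphere_limit z - term p q z).
      have : nice (fun z => sphere_limit z + (-1) * term p q z).
        by apply: niceD => //; apply: niceM => //; exact: nice_cst.
      by case=> + _; under eq_fun do rewrite mulN1r.
    by move=> z Sz Nz; rewrite fs // sE // hk.
  have [L hL] : exists L, forall z, S z -> cabs (k z) <= L by case: nk.
  apply: cabs_le0P => e e0.
  have L1 : 0 < 2 * (`|L| + 1) by rewrite mulr_gt0 // ltr_wpDl.
  have [|F0 hF0] := term_unif (e := e / (2 * (`|L| + 1))); first by rewrite divr_gt0.
  (* By orthogonality every partial sum containing (p, q) has the same inner product with [k] as
     that one term, while it is uniformly close to the limit. *)
  pose F := ((p, q) |` F0)%fset.
  have -> : dot (fun xi => sphere_limit xi - term p q xi) k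
      = dot (fun xi => sphere_limit xi - psum F xi) k.
    rewrite !dotB //; last exact: nice_psum.
    congr (_ - _); rewrite (dot_suml hsigma) => [|i|//]; last exact: nice_zonal_kernel.
    have ZE i : dot (Z i.1 i.2 eta) k = (dot k (Z i.1 i.2 eta))^*%C.
      by rewrite (dot_conj hsigma) //; exact: nice_zonal_kernel.
    rewrite (big_fsetD1 (p, q)) ?fset1U1 //= [X in _ + X]big1_fset ?addr0.
      have := dot_suml hsigma [:: tt] (fun=> c p q) (fun=> nice_zonal_kernel p q eta) nk.
      by rewrite big_seq1 => <-; apply: eq_dot => // z _; rewrite big_seq1.
    move=> i; rewrite in_fsetD1 => /andP[ipq _] _.
    rewrite ZE (dot_zonal_kernel_ortho hsigma hn Vk) //.
      by rewrite (_ : 0^*%C = 0 :> C) ?mulr0 //; exact: rmorph0.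
    by move: ipq; case: i => a b; rewrite eq_sym.
  apply: (@le_trans _ _ (2 * (e / (2 * (`|L| + 1)) * `|L|))).
    apply: cint_bound => //.
      apply: cmeasurableM; last by apply: cmeasurable_conj; case: nk.
      have : nice (fun z => sphere_limit z + (-1) * psum F z).
        by apply: niceD => //; apply: niceM; [exact: nice_cst|exact: nice_psum].
      by case=> + _; under eq_fun do rewrite mulN1r.
    move=> z Sz; rewrite cabsM cabs_conj ler_pM ?cabs_ge0 //.
      by rewrite sE // cabsB hF0 // fsubsetUr.
    by rewrite (le_trans (hL z Sz)) // ler_norm.
  rewrite mulrA mulrCA -mulrA ler_piMr ?(ltW e0) //.
  by rewrite mulrAC ler_pdivrMr // mul1r ler_wpM2l // lerDl.
- have small (e : R) : 0 < e -> \forall F \near summability.totally,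
    (0 <= \int[sigma]_(xi in S) (cabs (f xi - dsum (fun p q => term p q xi) F) ^+ 2)%:E
       <= (e ^+ 2)%:E)%E.
    move=> e0; have [F0 hF0] := term_unif e0; exists F0 => // F FF /=.
    rewrite integral_ge0 /= => [|z _]; last by rewrite lee_fin sqr_ge0.
    (* On [N] nothing bounds [f], so the majorant keeps the integrand there; it differs from the
       constant e^2 only on a null set. *)
    pose G (z : borel R n) : \bar R := if `[< N z >] then (cabs (f z - psum F z) ^+ 2)%:E else (e ^+ 2)%:E.
    apply: (@le_trans _ _ (\int[sigma]_(xi in S) G xi)%E).
      apply: ge0_le_integral_nomeas => z Sz; first by rewrite lee_fin sqr_ge0.
      rewrite /G; case: asboolP => // Nz.
      by rewrite lee_fin fs // lerXn2r ?nnegrE ?cabs_ge0 ?(ltW e0) // cabsB hF0.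
    rewrite (ge0_integral_null (sphere_measurable (n := n)) mN N0 (g := fun=> (e ^+ 2)%:E)).
    + rewrite integral_cst; last exact: sphere_measurable.
      by rewrite [X in (_ * X)%E](_ : _ = 1%E) ?mule1 //; exact: sigma_sphere.
    + exact: measurable_cst.
    + by move=> z _; rewrite /G; case: asboolP => _; rewrite lee_fin sqr_ge0.
    + by move=> z _; rewrite lee_fin sqr_ge0.
    + by move=> z [_ Nz]; rewrite /G; case: asboolP.
  apply/fine_cvgP; split.
    near=> F; have : (0 <= \int[sigma]_(xi in S)
      (cabs (f xi - dsum (fun p q => term p q xi) F) ^+ 2)%:E <= (1 ^+ 2)%:E)%E.
      near: F; exact: small.
    move=> /andP[h0 h1]; rewrite ge0_fin_numE //; exact: le_lt_trans h1 (ltry _).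
  apply/cvgrPdist_le => e e0; near=> F.
  have : (0 <= \int[sigma]_(xi in S)
      (cabs (f xi - dsum (fun p q => term p q xi) F) ^+ 2)%:E <= (Num.sqrt e ^+ 2)%:E)%E.
    by near: F; apply: small; rewrite sqrtr_gt0.
  rewrite sqr_sqrtr ?(ltW e0) // => /andP[h0 h1].
  have hfin : (\int[sigma]_(xi in S)
      (cabs (f xi - dsum (fun p q => term p q xi) F) ^+ 2)%:E)%E \is a fin_num.
    by rewrite ge0_fin_numE //; exact: le_lt_trans h1 (ltry _).
  rewrite /= sub0r normrN ger0_norm ?fine_ge0 //.
  by rewrite -lee_fin fineK.
Unshelve. all: by end_near.
Qed.

End Limit.
End Expansion.

Theorem theorem2 (R : realType) (n : nat) (hn : (2 <= n)%N)
    (sigma : probability (borel R n) R)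
    (hsigma : normalized_surface_measure sigma)
    (eta : 'rV[R[i]]_n) (heta : sphere R n eta)
    (phi : R[i] -> R[i]) (f : 'rV[R[i]]_n -> R[i])
    (hf : zonal_function eta phi f)
    (hphi : real_analytic_on (unit_disc R)° phi)
    (htaylor : forall w : R[i], cabs w = 1 ->
       abs_summable (taylor_term phi w)) :
  let term p q xi :=
    zonal_coef n phi p q * (dimH R n p q)%:R * zonal_kernel p q eta xi in
  [/\ forall p q, cvgn (series (zonal_coef_term n phi p q)),
      spherical_harmonic_expansion sigma f term,
      forall xi, sphere R n xi -> abs_summable (fun p q => term p q xi)
    & exists2 s : 'rV[R[i]]_n -> R[i],
        uniformly_summable_to (sphere R n) term s &
        forall xi, sphere R n xi ->
          (unit_disc R)° (cdot xi eta) \/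
          phi w @[w --> within (unit_disc R) (nbhs (cdot xi eta))]
            --> phi (cdot xi eta) ->
          s xi = f xi].
Proof.
move=> term; have [A hA] := taylor_coef_bsum htaylor.
have [T hT] := taylor_fun_exists htaylor.
pose s xi := T (cdot xi eta).
have unif := zonal_series_uniform hsigma hn hA hT heta.
have s_bound xi : sphere R n xi -> cabs (s xi) <= A.
  by move=> /(zonal_series hsigma hn hA hT heta)[]; exact: bsum_hasum_bound.
have [N [mN N0 hN]] := boundary_null hsigma hn heta.
split.
- by move=> p q; case: (zonal_coef_sum hsigma hn hA heta p q).
- apply: (expansion_term hsigma hn heta unif s_bound mN N0) => z Sz Nz.
  by rewrite hf // (phi_taylor hphi htaylor hT) //; exact: hN.
- move=> xi Sxi; apply/abs_summableP; exists A.
  by case: (zonal_series hsigma hn hA hT heta Sxi).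
exists s; first exact: uniformly_summable_term unif.
move=> xi Sxi h; rewrite hf //; apply/esym.
have := cdot_le1 Sxi heta; rewrite le_eqVlt => /orP[/eqP w1|w1].
  (* On the unit circle only the continuity alternative is possible. *)
  case: h => [/interior_unit_disc|]; first by rewrite w1 ltxx.
  exact: (phi_taylor_boundary hphi htaylor hT).
exact: (phi_taylor hphi htaylor hT).
Qed.
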